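(* Let $d\in\{2,3\}$, let $\rho>0$ be fixed, and let $I_{\mathrm{CD}}(z)$ be the Cauchy-data imaging functional $$I_{\mathrm{CD}}(z)=\int_\Gamma\left|\int_\Gamma \partial_\nu\overline{\Phi(x,z)}\,u^s(x,y)-\overline{\Phi(x,z)}\,\partial_\nu u^s(x,y)\,ds(x)\right|^\rho ds(y)$$ associated with the isotropic scattering problem (defined in the context). Then for $z\notin D$ $$I_{\mathrm{CD}}(z)=\mathcal{O}\left(\mathrm{dist}(z,D)^{(1-d)\rho/2}\right)\quad\text{as }\mathrm{dist}(z,D)\to\infty,$$ i.e. there exist constants $C>0$ and $r_0>0$, independent of $z$, such that $I_{\mathrm{CD}}(z)\le C\,\mathrm{dist}(z,D)^{(1-d)\rho/2}$ for every $z\in\mathbb{R}^d\setminus(D\cup\Gamma)$ with $\mathrm{dist}(z,D)\ge r_0$.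
   Context: Setting. $d\in\{2,3\}$, $k>0$ is the wave number. $D\subset\mathbb{R}^d$ is a bounded simply connected open set with Lipschitz boundary such that $\mathbb{R}^d\setminus\overline{D}$ is connected. The contrast $q\in L^\infty(\mathbb{R}^d)$ (complex valued) satisfies $\Im(q)\ge 0$, $q=0$ in $\mathbb{R}^d\setminus\overline{D}$, and has support $D$ (up to closure). $\Omega\subset\mathbb{R}^d$ is a bounded domain with $C^2$ boundary $\Gamma=\partial\Omega$, $D\subset\Omega$ and $\mathrm{dist}(\Gamma,D)>0$. Fundamental solution: $\Phi(x,y)=\frac{\mathrm{i}}{4}H^{(1)}_0(k|x-y|)$ if $d=2$ and $\Phi(x,y)=\frac{e^{\mathrm{i}k|x-y|}}{4\pi|x-y|}$ if $d=3$, where $H^{(1)}_0$ is the Hankel function of the first kind of order zero. Scattered field: for $y\in\Gamma$, with $u^i(\cdot,y)=\Phi(\cdot,y)$, $u^s(\cdot,y)\in H^1_{\mathrm{loc}}(\mathbb{R}^d)$ is the unique solution (the problem is well-posed) of $$\Delta u^s(\cdot,y)+k^2(1+q)u^s(\cdot,y)=-k^2q\,u^i(\cdot,y)\ \text{ in }\mathbb{R}^d,\qquad \lim_{r\to\infty}r^{(d-1)/2}\Big(\frac{\partial}{\partial r}-\mathrm{i}k\Big)u^s(\cdot,y)=0,\ r=|x|,$$ the radiation condition holding uniformly over all directions. In $I_{\mathrm{CD}}$, $\partial_\nu$ denotes the derivative in the variable $x\in\Gamma$ along the outward unit normal $\nu$ to $\Gamma=\partial\Omega$. *)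

(* Defs.v *)
From HB Require Import structures.
From mathcomp Require Import all_boot all_order all_algebra.
From mathcomp Require Import complex.
From mathcomp Require Import all_classical all_reals all_analysis.

Set Implicit Arguments.
Unset Strict Implicit.
Unset Printing Implicit Defensive.

Import Order.TTheory GRing.Theory Num.Theory.
Import numFieldNormedType.Exports.

Local Open Scope classical_set_scope.
Local Open Scope ring_scope.
Local Open Scope complex_scope.

Local Notation re := (@complex.Re _).
Local Notation im := (@complex.Im _).
Local Notation normc := (@ComplexField.Normc.normc _).

(* The topology and the norm `|x| that the library puts on 'rV[R]_d are those
   of the sup norm: all metric notions below go through [enorm] instead. *)
Section euclidean.
Context {R : realType} {d : nat}.
Implicit Types (x y z : 'rV[R]_d) (A B : set 'rV[R]_d).

Definition dot x y : R := \sum_i x 0 i * y 0 i.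
Definition enorm x : R := Num.sqrt (dot x x).
Definition eball x (r : R) : set 'rV[R]_d := [set y | enorm (y - x) < r].
Definition dist x A : R := inf [set enorm (x - y) | y in A].
Definition dist_set A B : R := inf [set enorm (x - y) | x in A & y in B].
Definition boundary A := closure A `\` interior A.

(* Supremum taken in [0, +oo], so that the empty set has diameter 0. *)
Definition diam A : \bar R :=
  ereal_sup ([set 0%E] `|` [set (enorm (x - y))%:E | x in A & y in A]).

Definition box x y : set 'rV[R]_d :=
  [set z | forall i, x 0 i <= z 0 i <= y 0 i].

End euclidean.

(* Copy of [T] in which every set is measurable: it lets [mu_ext] range over
   arbitrary countable covers. *)
Definition all_sets (T : Type) : Type := T.

Section all_sets.
Variable T : pointedType.
HB.instance Definition _ := Pointed.on (all_sets T).
HB.instance Definition _ := @isMeasurable.Build default_measure_display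
  (all_sets T) setT I (fun _ _ => I) (fun _ _ => I).
End all_sets.

Section cover_outer.
Context {R : realType} {T : pointedType}.
Local Open Scope ereal_scope.
Variables (C : set (set T)) (tau : set T -> \bar R).

Definition cover_gauge (A : set (all_sets T)) : \bar R :=
  if `[< A = set0 >] then 0 else if `[< C A >] then `|tau A| else +oo.

(* inf { sum_k tau (F k) | X `<=` \bigcup_k F k, every F k is empty or in C },
   for tau nonnegative on C. *)
Definition cover_outer : set T -> \bar R := mu_ext cover_gauge.

Lemma cover_gauge0 : cover_gauge set0 = 0.
Proof. by rewrite /cover_gauge asboolT. Qed.

Lemma cover_gauge_ge0 A : 0 <= cover_gauge A.
Proof.
rewrite /cover_gauge; case: ifP => // _.
by case: ifP => // _; rewrite ?abse_ge0 ?leey.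
Qed.

Lemma cover_outer_ge0 X : 0 <= cover_outer X.
Proof. exact: mu_ext_ge0 cover_gauge_ge0 _. Qed.

Lemma le_cover_outer : {homo cover_outer : A B / A `<=` B >-> A <= B}.
Proof. exact: (@le_mu_ext _ _ _ cover_gauge). Qed.

HB.instance Definition _ := isOuterMeasure.Build R T cover_outer
  (mu_ext0 cover_gauge0 cover_gauge_ge0) cover_outer_ge0
  le_cover_outer (mu_ext_sigma_subadditive cover_gauge_ge0).

End cover_outer.

Section lebesgue.
Context (R : realType) (d : nat).

Definition is_box : set (set 'rV[R]_d) :=
  [set A | exists a b : 'rV[R]_d, (forall i, a 0 i <= b 0 i) /\ A = box a b].

Definition box_volume (A : set 'rV[R]_d) : \bar R :=
  (\prod_(i < d)
     (sup [set x 0 i | x in A] - inf [set x 0 i | x in A]))%:E.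

Definition leb_outer : {outer_measure set 'rV[R]_d -> \bar R} :=
  cover_outer is_box box_volume.

Definition leb : {measure set (caratheodory_type leb_outer) -> \bar R} :=
  leb_outer.

End lebesgue.

Section hausdorff.
Context (R : realType) (d s : nat).
Local Open Scope ereal_scope.

(* Volume of the ball of diameter 1 of R^s: with this factor the Hausdorff
   measure of dimension s is the s-dimensional area (1 for s = 1, pi / 4 for
   s = 2). *)
Definition hausdorff_factor : \bar R := leb_outer R s (eball 0 (2^-1)%R).

Definition hausdorff_delta (e : R) : {outer_measure set 'rV[R]_d -> \bar R} :=
  cover_outer [set A | diam A <= e%:E]
              (fun A => hausdorff_factor * diam A ^+ s).

Definition hausdorff_outer (A : set 'rV[R]_d) : \bar R :=
  ereal_sup [set hausdorff_delta e A | e in [set e : R | (0 < e)%R]].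

Lemma hausdorff_outer0 : hausdorff_outer set0 = 0.
Proof.
apply/eqP; rewrite eq_le; apply/andP; split.
  by apply: ge_ereal_sup => _ [e _ <-]; rewrite outer_measure0.
by apply: ereal_sup_ubound; exists 1%R => //=; rewrite outer_measure0.
Qed.

Lemma hausdorff_outer_ge0 A : 0 <= hausdorff_outer A.
Proof.
apply: (@le_trans _ _ (hausdorff_delta 1 A)); first exact: outer_measure_ge0.
by apply: ereal_sup_ubound; exists 1%R => //=.
Qed.

Lemma le_hausdorff_outer :
  {homo hausdorff_outer : A B / A `<=` B >-> (A <= B)%E}.
Proof.
move=> A B AB; apply: ge_ereal_sup => _ [e e0 <-].
apply: (@le_trans _ _ (hausdorff_delta e B)); first exact: le_outer_measure.
by apply: ereal_sup_ubound; exists e.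
Qed.

Lemma hausdorff_outer_sigma_subadditive : sigma_subadditive hausdorff_outer.
Proof.
move=> F; apply: ge_ereal_sup => _ [e e0 <-].
apply: (le_trans (outer_measure_sigma_subadditive (hausdorff_delta e) F)).
apply: lee_nneseries => n _; first by move=> _; exact: outer_measure_ge0.
by apply: ereal_sup_ubound; exists e.
Qed.

HB.instance Definition _ := isOuterMeasure.Build R 'rV[R]_d hausdorff_outer
  hausdorff_outer0 hausdorff_outer_ge0 le_hausdorff_outer
  hausdorff_outer_sigma_subadditive.

End hausdorff.

Definition surf_outer (R : realType) (d : nat) :
  {outer_measure set 'rV[R]_d -> \bar R} := @hausdorff_outer R d d.-1.
Definition surf (R : realType) (d : nat) :
  {measure set (caratheodory_type (surf_outer R d)) -> \bar R} :=
  surf_outer R d.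

Section calculus.
Context {R : realType} {d : nat}.
Implicit Types (x v : 'rV[R]_d) (u : 'rV[R]_d -> R[i]) (f : 'rV[R]_d -> R).

Definition basis (i : 'I_d) : 'rV[R]_d := delta_mx 0 i.
Definition gradient f x : 'rV[R]_d := \row_i 'D_(basis i) f x.
Definition laplacian f x : R :=
  \sum_i 'D_(basis i) (fun y => 'D_(basis i) f y) x.

(* f is of class C^n on the (open) set O. *)
Fixpoint Ck (O : set 'rV[R]_d) (n : nat) f : Prop :=
  (forall x, O x -> {for x, continuous f}) /\
  if n is n'.+1 then
    forall i, (forall x, O x -> derivable f x (basis i)) /\
              Ck O n' (fun x => 'D_(basis i) f x)
  else True.

Definition complex_Ck O n u := Ck O n (re \o u) /\ Ck O n (im \o u).

Definition complex_derive v u x : R[i] :=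
  'D_v (re \o u) x +i* 'D_v (im \o u) x.

Definition test_function f :=
  (forall n, Ck setT n f) /\ exists r, forall x, r <= enorm x -> f x = 0.

End calculus.

Section complex_integration.
Context {R : realType} {disp : measure_display} {T : measurableType disp}.

Definition complex_measurable (A : set T) (f : T -> R[i]) :=
  measurable_fun A (re \o f) /\ measurable_fun A (im \o f).

Definition complex_integral (mu : {measure set T -> \bar R}) (A : set T)
    (f : T -> R[i]) : R[i] :=
  (\int[mu]_(t in A) re (f t)) +i* (\int[mu]_(t in A) im (f t)).

End complex_integration.

Section domains.
Context {R : realType} {d : nat}.
Implicit Types (A : set 'rV[R]_d) (p e n : 'rV[R]_d) (g : 'rV[R]_d -> R).

(* Signed height of x over the graph of g, in the direction e: the hyperplane
   orthogonal to e is parametrised by x - (x . e) e, so that g only matters on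
   that hyperplane. *)
Definition height e g (x : 'rV[R]_d) : R := dot x e - g (x - dot x e *: e).

(* Near p, A is the strict hypograph of g in the direction e. *)
Definition local_hypograph A p e g :=
  enorm e = 1 /\ \forall x \near p, A x <-> height e g x < 0.

Definition lipschitz_boundary A :=
  forall p, boundary A p ->
  exists e g, [lipschitz g x | x in [set: 'rV[R]_d]] /\ local_hypograph A p e g.

Definition C2_boundary A :=
  forall p, boundary A p ->
  exists e g, Ck setT 2 g /\ local_hypograph A p e g.

Definition outward_unit_normal A p n :=
  exists e g, [/\ Ck setT 2 g, local_hypograph A p e g &
    n = (enorm (gradient (height e g) p))^-1 *: gradient (height e g) p].

(* For open sets connectedness and path-connectedness agree. *)
Definition simply_connected A :=
  connected A /\
  forall c : R -> 'rV[R]_d,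
    {within `[0, 1], continuous c} -> c @` `[0, 1] `<=` A -> c 0 = c 1 ->
  exists H : R * R -> 'rV[R]_d,
    [/\ {within `[0, 1] `*` `[0, 1], continuous H},
        H @` (`[0, 1] `*` `[0, 1]) `<=` A,
        forall t, `[0, 1]%classic t -> H (0, t) = c t /\ H (1, t) = c 0 &
        forall s, `[0, 1]%classic s -> H (s, 0) = c 0 /\ H (s, 1) = c 0].

End domains.

Section hankel.
Context {R : realType}.
Implicit Types t : R.

Definition euler_gamma : R := limn (fun n => series harmonic n - ln n%:R).

Definition besselJ0 t : R :=
  limn (series (fun m => (-1) ^+ m * (t / 2) ^+ m.*2 / m`!%:R ^+ 2)).

(* [series harmonic m] is 1 + 1/2 + ... + 1/m. *)
Definition besselY0 t : R :=
  2 / pi * ((ln (t / 2) + euler_gamma) * besselJ0 t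
    - limn (series (fun m =>
        (-1) ^+ m * series harmonic m * (t / 2) ^+ m.*2 / m`!%:R ^+ 2))).

Definition hankel0 t : R[i] := besselJ0 t +i* besselY0 t.

End hankel.

Section scattering.
Context {R : realType} {d : nat}.
Implicit Types (k : R) (q f g u : 'rV[R]_d -> R[i]) (A D : set 'rV[R]_d).

(* Fundamental solution; only meant for d = 2 and d = 3. *)
Definition Phi k (x y : 'rV[R]_d) : R[i] :=
  let r := enorm (x - y) in
  if d == 2 then (0 +i* 1) / 4 * hankel0 (k * r)
  else (cos (k * r) +i* sin (k * r)) / (4 * pi * r)%:C.

Local Notation T := (caratheodory_type (leb_outer R d)).

(* Square of the L^2(A) norm. *)
Definition sqnorm2 A u : \bar R :=
  (\int[leb R d]_(x in A) ((normc (u x)) ^+ 2)%:E)%E.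

Definition L2 A u := complex_measurable (A : set T) u /\ (sqnorm2 A u < +oo)%E.

Definition L2loc u := forall r : R, L2 (eball 0 r) u.

Definition Linfty q := complex_measurable (setT : set T) q /\
  exists M : R, \forall x \ae leb R d, normc (q x) <= M.

Definition weak_gradient u (v : 'I_d -> 'rV[R]_d -> R[i]) :=
  forall i, L2loc (v i) /\
    forall phi, test_function phi ->
      complex_integral (leb R d) setT (fun x => u x * ('D_(basis i) phi x)%:C) =
      - complex_integral (leb R d) setT (fun x => v i x * (phi x)%:C).

Definition H1loc u := L2loc u /\ exists v, weak_gradient u v.

(* Complement of the largest open set on which q vanishes almost everywhere. *)
Definition ess_support q : set 'rV[R]_d :=
  [set x | forall U, nbhs x U ->
     ~ (leb R d).-negligible ((U `&` [set y | q y != 0]) : set T)].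

(* Laplace(u) + k^2 (1 + q) u = f in the sense of distributions on R^d. *)
Definition helmholtz k q f u :=
  forall phi, test_function phi ->
    complex_integral (leb R d) setT (fun x =>
      u x * (laplacian phi x)%:C + (k ^+ 2)%:C * (1 + q x) * u x * (phi x)%:C) =
    complex_integral (leb R d) setT (fun x => f x * (phi x)%:C).

Definition sommerfeld k u :=
  forall eps : R, 0 < eps ->
  \forall r \near +oo, forall x, enorm x = r ->
    r `^ ((d%:R - 1) / 2)
      * normc (complex_derive (r^-1 *: x) u x - (0 +i* k) * u x) < eps.

(* The scattered field generated by the incident field g. An element of H1loc
   is only defined almost everywhere; outside closure D, where q vanishes, we
   take the representative that is a classical solution (interior regularity),
   so that its values, its normal derivatives and the radiation condition make
   sense pointwise. *)
Definition scattered_field k D q g u :=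
  [/\ H1loc u,
      complex_Ck (~` closure D) 2 u,
      helmholtz k q (fun x => - (k ^+ 2)%:C * q x * g x) u &
      sommerfeld k u].

(* Well-posedness in the sense of Hadamard: existence, uniqueness, and
   continuous dependence in H^1 norm on bounded sets. *)
Definition well_posed k D q :=
  [/\ forall g, L2 D g -> exists u, scattered_field k D q g u,
      forall g u u', L2 D g ->
        scattered_field k D q g u -> scattered_field k D q g u' ->
        \forall x \ae leb R d, u x = u' x &
      forall r : R, exists C : R, forall g u v, L2 D g ->
        scattered_field k D q g u -> weak_gradient u v ->
        (sqnorm2 (eball 0 r) u + \sum_i sqnorm2 (eball 0 r) (v i)
          <= C%:E * sqnorm2 D g)%E].

(* [us x y] is u^s(x, y). *)
Definition I_CD k rho (Gamma : set 'rV[R]_d) (nu : 'rV[R]_d -> 'rV[R]_d)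
    (us : 'rV[R]_d -> 'rV[R]_d -> R[i]) (z : 'rV[R]_d) : \bar R :=
  (\int[surf R d]_(y in Gamma)
    ((normc (complex_integral (surf R d) Gamma (fun x =>
        complex_derive (nu x) (fun x' => conjc (Phi k x' z)) x * us x y
        - conjc (Phi k x z) * complex_derive (nu x) (us ^~ y) x))) `^ rho)%:E)%E.

End scattering.

(* Main.v *)
(* Everything follows from bounds that are uniform on Gamma. The fundamental
   solution is a radial profile which, together with its derivative, is
   O(r^((1-d)/2)): explicit for d = 3, and for d = 2 a consequence of the Bessel
   equation, since w = sqrt t * f has a nonincreasing energy. Hence Phi(., z) and
   its derivatives are O(dist(z, D)^((1-d)/2)) on Gamma. Well-posedness bounds the
   L^2 norms of u^s(., y) on balls uniformly in y, because Phi(., y) is bounded on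
   D; as u^s solves the homogeneous Helmholtz equation near Gamma, testing the
   equation against a truncated and mollified fundamental solution turns the L^2
   bound into a bound on its values and Lipschitz constants there, and a Lipschitz
   constant dominates every directional derivative. Finally Gamma has finite
   surface measure, being locally a Lipschitz graph. When D is empty,
   dist(z, D) = inf set0 = 0, so no z is far from D. *)
Require Import Defs.
From HB Require Import structures.
From mathcomp Require Import all_boot all_order all_algebra.
From mathcomp Require Import complex.
From mathcomp Require Import all_classical all_reals all_analysis.
From mathcomp Require Import measurable_realfun.
From mathcomp Require Import ring lra.

Set Implicit Arguments.
Unset Strict Implicit.
Unset Printing Implicit Defensive.

Import Order.TTheory GRing.Theory Num.Theory.
Import numFieldNormedType.Exports.

Local Open Scope classical_set_scope.
Local Open Scope ring_scope.

(** Two obstacles shape the details. The values and normal derivatives of the fields on Gamma are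
    not known to be measurable for the surface measure, nor is the inner integral as a function of
    [y]. Integrals over Gamma are therefore bounded by a supremum times an outer measure, an
    inequality valid for arbitrary functions. Moreover, all measures are infima over covers: one
    cover gives an upper bound, whereas lower bounds come from maximality among the outer measures
    below the gauge. Only a positive volume of the unit box is required, and it follows from [q]
    having nonempty support. The mollification is no convolution: a profile f(|x|^2), singular at 0,
    is replaced by f(|x|^2 + e^2). For f, the first two terms of the expansion of a fundamental
    solution are taken. One term alone would leave k^2 f in the remainder, which is unbounded at the
    centre; with two terms the remainder is bounded and Lipschitz in |x|. The approximate identity
    is not normalised: its mass is bounded below uniformly in e and does not depend on the centre,
    which is what comparing the solution at two points requires. *)

(** * The Euclidean norm, compared with the sup norm of the topology *)

Section enorm_theory.
Context {R : realType} {d : nat}.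
Implicit Types (x y z : 'rV[R]_d).

Lemma dotC x y : dot x y = dot y x.
Proof. by apply: eq_bigr => i _; rewrite mulrC. Qed.

Lemma dotDl x y z : dot (x + y) z = dot x z + dot y z.
Proof. by rewrite -big_split; apply: eq_bigr => i _; rewrite mxE mulrDl. Qed.

Lemma dotZl (a : R) x z : dot (a *: x) z = a * dot x z.
Proof. by rewrite mulr_sumr; apply: eq_bigr => i _; rewrite mxE mulrA. Qed.

Lemma dotDr x y z : dot z (x + y) = dot z x + dot z y.
Proof. by rewrite dotC dotDl !(dotC z). Qed.

Lemma dotZr (a : R) x z : dot z (a *: x) = a * dot z x.
Proof. by rewrite dotC dotZl (dotC z). Qed.

Lemma dot_ge0 x : 0 <= dot x x.
Proof. by apply: sumr_ge0 => i _; rewrite -expr2 sqr_ge0. Qed.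

Lemma enorm_ge0 x : 0 <= enorm x.
Proof. exact: sqrtr_ge0. Qed.

Lemma sqr_enorm x : enorm x ^+ 2 = dot x x.
Proof. by rewrite sqr_sqrtr ?dot_ge0. Qed.

Lemma enormZ (a : R) x : enorm (a *: x) = `|a| * enorm x.
Proof.
by rewrite /enorm dotZl dotZr mulrA -expr2 sqrtrM ?sqr_ge0// sqrtr_sqr.
Qed.

Lemma enormN x : enorm (- x) = enorm x.
Proof. by rewrite -scaleN1r enormZ normrN1 mul1r. Qed.

Lemma enormB x y : enorm (x - y) = enorm (y - x).
Proof. by rewrite -enormN opprB. Qed.

Lemma enorm0 : enorm (0 : 'rV[R]_d) = 0.
Proof. by rewrite -(scale0r 0) enormZ normr0 mul0r. Qed.

(** Cauchy-Schwarz: for [enorm x != 0], the vector [enorm x *: y - (dot x y / enorm x) *: x] has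
    squared norm [(enorm x * enorm y) ^+ 2 - dot x y ^+ 2]. *)
Lemma dot_le_enorm x y : dot x y <= enorm x * enorm y.
Proof.
have [x0|x0] := eqVneq (enorm x) 0.
  have dx0 : dot x x = 0 by rewrite -sqr_enorm x0 expr0n.
  have xi i : x 0 i = 0.
    have := dx0; rewrite /dot => /eqP; rewrite psumr_eq0; last first.
      by move=> j _; rewrite -expr2 sqr_ge0.
    by move=> /allP/(_ i); rewrite mem_index_enum mulf_eq0 orbb => /(_ isT)/eqP.
  by rewrite x0 mul0r /dot big1// => i _; rewrite xi mul0r.
have xp : 0 < enorm x by rewrite lt_neqAle eq_sym x0 enorm_ge0.
have := dot_ge0 (enorm x *: y - (dot x y / enorm x) *: x).
rewrite -scaleNr !(dotDl, dotDr, dotZl, dotZr) (dotC y x) -!sqr_enorm => h.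
have h1 : dot x y ^+ 2 <= (enorm x * enorm y) ^+ 2.
  rewrite -subr_ge0; apply: le_trans h _; rewrite le_eqVlt; apply/orP; left.
  by apply/eqP; field.
apply: le_trans (ler_norm _) _.
rewrite -[leRHS]ger0_norm ?mulr_ge0 ?enorm_ge0//.
by rewrite -!sqrtr_sqr ler_wsqrtr.
Qed.

Lemma enormD x y : enorm (x + y) <= enorm x + enorm y.
Proof.
rewrite -[leRHS]ger0_norm ?addr_ge0 ?enorm_ge0// -sqrtr_sqr ler_wsqrtr//.
rewrite !(dotDl, dotDr) (dotC y x) sqrrD !sqr_enorm.
by have := dot_le_enorm x y; lra.
Qed.

Lemma enorm_dist x y z : enorm (x - y) <= enorm (x - z) + enorm (z - y).
Proof. by have := enormD (x - z) (z - y); rewrite addrA subrK. Qed.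

Lemma ler_dist_enorm x y : `|enorm x - enorm y| <= enorm (x - y).
Proof.
rewrite ler_norml; apply/andP; split.
  by have := enormD (y - x) x; rewrite subrK enormB; lra.
by have := enormD (x - y) y; rewrite subrK; lra.
Qed.

Lemma coord_le_enorm x i : `|x 0 i| <= enorm x.
Proof.
rewrite -sqrtr_sqr ler_wsqrtr// /dot (bigD1 i)//= -expr2 lerDl.
by apply: sumr_ge0 => j _; rewrite -expr2 sqr_ge0.
Qed.

Lemma coord_le_norm x i : `|x 0 i| <= `|x|.
Proof.
by rewrite [leRHS]/Num.norm/= mx_normrE; apply/bigmax_geP; right; exists (0, i).
Qed.

Lemma norm_le_coord x (r : R) : 0 <= r -> (forall i, `|x 0 i| <= r) -> `|x| <= r.
Proof.
move=> r0 h; rewrite [leLHS]/Num.norm/= mx_normrE; apply/bigmax_leP; split => //.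
by move=> [i j] _ /=; rewrite ord1.
Qed.

Lemma norm_le_enorm x : `|x| <= enorm x.
Proof. by apply: norm_le_coord (enorm_ge0 _) (coord_le_enorm x). Qed.

Lemma enorm_le_sum x : enorm x <= \sum_i `|x 0 i|.
Proof.
rewrite {1}(row_sum_delta x).
have -> : \sum_i `|x 0 i| = \sum_i enorm (x 0 i *: (delta_mx 0 i : 'rV[R]_d)).
  apply: eq_bigr => i _; rewrite enormZ.
  suff -> : enorm (delta_mx 0 i : 'rV[R]_d) = 1 by rewrite mulr1.
  rewrite /enorm /dot (bigD1 i)//= big1 ?addr0; last first.
    by move=> j ji; rewrite mxE eqxx (negbTE ji) mul0r.
  by rewrite mxE !eqxx mulr1 sqrtr1.
elim/big_ind2 : _ => //; first by rewrite enorm0.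
by move=> a b a' b' h h'; apply: le_trans (enormD _ _) _; apply: lerD.
Qed.

Lemma enorm_le_norm x : enorm x <= d%:R * `|x|.
Proof.
apply: le_trans (enorm_le_sum x) _.
have -> : d%:R * `|x| = \sum_(i < d) `|x|.
  by rewrite sumr_const card_ord mulr_natl.
by apply: ler_sum => i _; apply: coord_le_norm.
Qed.

Lemma continuous_enorm : continuous (@enorm R d).
Proof.
move=> x; apply/(@cvgrPdist_le _ _ _ (nbhs x) (nbhs_filter x)) => e e0.
have h y : `|enorm x - enorm y| <= d%:R * `|x - y|.
  exact: le_trans (ler_dist_enorm _ _) (enorm_le_norm _).
have [d0|d0] := eqVneq (d%:R : R) 0.
  by near=> y; rewrite (le_trans (h y))// d0 mul0r ltW.
have dp : 0 < (d%:R : R) by rewrite lt_neqAle eq_sym d0 ler0n.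
near=> y; rewrite (le_trans (h y))// mulrC -ler_pdivlMr//; near: y.
apply/nbhs_ballP; exists (e / d%:R); first exact: divr_gt0.
by move=> y; rewrite -ball_normE /= => /ltW.
Unshelve. all: by end_near. Qed.

Lemma open_eball x (r : R) : open (eball x r).
Proof.
have -> : eball x r = (fun y => enorm (y - x)) @^-1` [set t | t < r] by [].
apply: open_comp; last exact: open_lt.
move=> y _; apply: (@continuous_comp _ _ _ (fun y => y - x)); last exact: continuous_enorm.
  exact: (@cvgB _ _ _ (nbhs y) (nbhs_filter y) id (cst x) y x (@cvg_id _ _) (@cvg_cst _ _ _ _ _)).
Qed.

Lemma eball_center x (r : R) : 0 < r -> eball x r x.
Proof. by move=> r0; rewrite /eball/= subrr enorm0. Qed.

Lemma nbhs_eball x (r : R) : 0 < r -> nbhs x (eball x r).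
Proof.
by move=> r0; apply: open_nbhs_nbhs; split; [exact: open_eball|exact: eball_center].
Qed.

Lemma nbhs_eballP x (A : set 'rV[R]_d) :
  nbhs x A -> exists2 r : R, 0 < r & eball x r `<=` A.
Proof.
move=> /nbhs_ballP[r /= r0 h]; exists r => // y xy; apply: h.
by rewrite -ball_normE /=; apply: le_lt_trans (norm_le_enorm _) _; rewrite enormB.
Qed.

Lemma bounded_enorm (A : set 'rV[R]_d) : bounded_set A ->
  exists2 M : R, 0 < M & forall x, A x -> enorm x <= M.
Proof.
move=> [M [_ h]]; pose N := Num.max M 0 + 1.
have N0 : 0 <= N by rewrite addr_ge0// le_max lexx orbT.
exists (d%:R * N + 1) => [|x Ax]; first by rewrite ltr_wpDl// mulr_ge0.
apply: le_trans (enorm_le_norm _) _; apply: (@le_trans _ _ (d%:R * N)).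
  by rewrite ler_wpM2l//; apply: (h N) => //; rewrite ltr_pwDr// le_max lexx.
by rewrite lerDl.
Qed.

End enorm_theory.

(** * Outer measures defined by covers *)

Section cover_outer_theory.
Context {R : realType} {T : pointedType}.
Local Open Scope ereal_scope.
Variables (C : set (set T)) (tau : set T -> \bar R).

Lemma cover_outer_le_gauge X : cover_outer C tau X <= cover_gauge C tau X.
Proof.
pose F (n : nat) := if n is 0%N then X else set0.
apply: ereal_inf_lbound; exists F; first by split => // x Xx; exists 0%N.
rewrite nneseries_recl//; last by move=> n _; exact: cover_gauge_ge0.
rewrite [X in _ + X]eseries0 ?adde0//.
by case=> // n _ _; exact: cover_gauge0.
Qed.

(** Maximality of [mu_ext]: along any cover, subadditivity bounds [nu X] by the sum of the gauges.
    Every lower bound for a cover measure below goes through this. *)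
Lemma cover_outer_glb (nu : set T -> \bar R) :
  (forall A, 0 <= nu A) -> {homo nu : A B / A `<=` B >-> A <= B} ->
  sigma_subadditive nu -> (forall A, nu A <= cover_gauge C tau A) ->
  forall X, nu X <= cover_outer C tau X.
Proof.
move=> nu0 le_nu nuS le_gauge X; apply: le_ereal_inf_tmp => _ [F [_ XF] <-].
apply: (le_trans (le_nu _ _ XF)); apply: (le_trans (nuS F)).
by apply: lee_nneseries => n _ //.
Qed.

Lemma cover_outer_le (A : set T) : C A -> cover_outer C tau A <= `|tau A|.
Proof.
move=> CA; apply: (le_trans (cover_outer_le_gauge A)); rewrite /cover_gauge.
by case: ifP => [_|_]; [exact: abse_ge0 | rewrite asboolT].
Qed.

End cover_outer_theory.

Lemma outer_measure_finU (R : realType) (T : Type) (I : Type) (r : seq I)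
    (mu : {outer_measure set T -> \bar R}) (F : I -> set T) :
  (mu (\big[setU/set0]_(i <- r) F i) <= \sum_(i <- r) mu (F i))%E.
Proof.
elim: r => [|i r ih]; first by rewrite !big_nil outer_measure0.
rewrite !big_cons; apply: (le_trans (outer_measureU2 _ _ _)).
exact: leeD.
Qed.

(** * Lebesgue outer measure: boxes, half-spaces, open sets *)

Section boxes.
Context {R : realType} {d : nat}.
Implicit Types (a b x : 'rV[R]_d).

Lemma box_image_coord a b i : (forall i, a 0 i <= b 0 i) ->
  [set x 0 i | x in box a b] = `[a 0 i, b 0 i]%classic.
Proof.
move=> ab; apply/seteqP; split => [_ [x hx <-]|t].
  by rewrite /= in_itv /=; apply: hx.
rewrite /= in_itv /= => ht; exists (\row_j if j == i then t else a 0 j).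
  by move=> j; rewrite mxE; case: eqP => [->//|_]; rewrite lexx ab.
by rewrite mxE eqxx.
Qed.

Lemma box_volumeE a b : (forall i, a 0 i <= b 0 i) ->
  box_volume (box a b) = (\prod_i (b 0 i - a 0 i))%:E.
Proof.
move=> ab; congr EFin; apply: eq_bigr => i _; rewrite box_image_coord//.
by rewrite sup_itvcc ?inf_itvcc.
Qed.

Lemma leb_box_le a b : (forall i, a 0 i <= b 0 i) ->
  (leb_outer R d (box a b) <= (\prod_i (b 0 i - a 0 i))%:E)%E.
Proof.
move=> ab; apply: le_trans (cover_outer_le _ _) _; first by exists a, b.
by rewrite box_volumeE//= ger0_norm// prodr_ge0// => i _; rewrite subr_ge0.
Qed.

Lemma leb_outer_glb (nu : set 'rV[R]_d -> \bar R) :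
  (forall A, (0 <= nu A)%E) -> {homo nu : A B / A `<=` B >-> (A <= B)%E} ->
  sigma_subadditive nu -> nu set0 = 0%E ->
  (forall a b, (forall i, a 0 i <= b 0 i) ->
    (nu (box a b) <= (\prod_i (b 0 i - a 0 i))%:E)%E) ->
  forall X, (nu X <= leb_outer R d X)%E.
Proof.
move=> nu0 le_nu nuS nu00 le_box; apply: cover_outer_glb => // A.
rewrite /cover_gauge; case: asboolP => [->|A0]; first by rewrite nu00.
case: asboolP => [[a [b [ab ->]]]|_]; last exact: leey.
apply: (le_trans (le_box _ _ ab)).
by rewrite box_volumeE//= ger0_norm// prodr_ge0// => i _; rewrite subr_ge0.
Qed.

End boxes.

Section measurable_sets.
Context {R : realType} {d : nat}.
Implicit Types (a b x : 'rV[R]_d) (A : set 'rV[R]_d).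
Local Notation T := (caratheodory_type (leb_outer R d)).

(** Caratheodory's criterion asks that X |-> mu(X [&] H) + mu(X [\] H) be at most mu. This function
    is an outer measure, so by maximality it suffices to compare on boxes, where a coordinate
    hyperplane cuts a box into two boxes with the same total volume. *)
Lemma measurable_halfspace (i : 'I_d) (c : R) :
  measurable ([set x : 'rV[R]_d | x 0 i <= c] : set T).
Proof.
set H : set 'rV[R]_d := [set x | _]; apply: le_caratheodory_measurable.
pose mu : {outer_measure set 'rV[R]_d -> \bar R} := leb_outer R d.
apply: leb_outer_glb.
- by move=> A; rewrite adde_ge0 ?outer_measure_ge0.
- by move=> A B AB; apply: leeD; apply: le_outer_measure; apply: setSI.
- move=> F; rewrite nneseriesD; try by move=> *; exact: outer_measure_ge0.
  by apply: leeD; rewrite setI_bigcupl; exact: outer_measure_sigma_subadditive.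
- by rewrite !set0I outer_measure0 adde0.
move=> a b ab.
have mu_box (l u : 'rV[R]_d) : (forall j, l 0 j <= u 0 j) ->
    (mu (box l u) <= (\prod_j (u 0 j - l 0 j))%:E)%E by exact: leb_box_le.
have [ca|ac] := ltP c (a 0 i).
  have -> : box a b `&` H = set0.
    apply/seteqP; split => // x [/(_ i)/andP[h _]] /=.
    by move=> /(le_trans h); rewrite leNgt ca.
  rewrite outer_measure0 add0e; apply: le_trans (mu_box _ _ ab).
  by apply: le_outer_measure => x [].
have [bc|cb] := leP (b 0 i) c.
  have -> : box a b `&` ~` H = set0.
    apply/seteqP; split => // x [/(_ i)/andP[_ h]] /=; apply.
    exact: le_trans bc.
  rewrite outer_measure0 adde0; apply: le_trans (mu_box _ _ ab).
  by apply: le_outer_measure => x [].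
(* The hyperplane crosses the box: [box a b'] and [box a' b] are its two closed halves, which share
   the face x_i = c. *)
pose b' := \row_j (if j == i then c else b 0 j).
pose a' := \row_j (if j == i then c else a 0 j).
have ab' j : a 0 j <= b' 0 j by rewrite mxE; case: eqP => [->|].
have a'b j : a' 0 j <= b 0 j by rewrite mxE; case: eqP => [->|//]; exact: ltW.
apply: (@le_trans _ _ (mu (box a b') + mu (box a' b))%E).
  apply: leeD; apply: le_outer_measure => x [hx /= xc] j; rewrite ?mxE.
    by case: eqP => [->|_]; [rewrite xc andbT; case/andP: (hx i)|exact: hx].
  case: eqP => [->|_]; last exact: hx.
  by move: xc => /negP; rewrite -ltNge => /ltW ->; case/andP: (hx i).
apply: le_trans (leeD (mu_box _ _ ab') (mu_box _ _ a'b)) _.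
rewrite -EFinD lee_fin (bigD1 i)//= [X in _ + X](bigD1 i)//= [leRHS](bigD1 i)//=.
rewrite !mxE eqxx.
rewrite (eq_bigr (fun j => b 0 j - a 0 j)); last first.
  by move=> j ji; rewrite mxE (negbTE ji).
rewrite [X in _ + _ * X](eq_bigr (fun j => b 0 j - a 0 j)); last first.
  by move=> j ji; rewrite mxE (negbTE ji).
by rewrite -mulrDl addrC subrKA.
Qed.

Lemma measurable_cell a b :
  measurable ([set x : 'rV[R]_d | forall i, a 0 i < x 0 i <= b 0 i] : set T).
Proof.
have -> : [set x : 'rV[R]_d | forall i, a 0 i < x 0 i <= b 0 i] =
  \bigcap_(i in [set: 'I_d]) (~` [set x : 'rV[R]_d | x 0 i <= a 0 i]
    `&` [set x : 'rV[R]_d | x 0 i <= b 0 i]).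
  apply/seteqP; split => x /= h i; first move=> _ /=.
    by have /andP[h1 h2] := h i; split => //; apply/negP; rewrite -ltNge.
  by have [/negP] := h i I; rewrite -ltNge => -> ->.
apply: (@fin_bigcap_measurable _ T) => [|i _]; first exact: finite_finset.
by apply: measurableI; [apply: measurableC|]; exact: measurable_halfspace.
Qed.

(** An open set is the countable union of the half-open grid cells, of all mesh sizes 1/(n+1), that
    it contains. *)
Lemma open_measurable_leb A : open A -> measurable (A : set T).
Proof.
move=> oA; rewrite openE in oA.
pose cell (p : nat * 'rV[int]_d) : set 'rV[R]_d :=
  [set x | forall i, (p.2 0 i)%:~R / p.1.+1%:R < x 0 i <= ((p.2 0 i)%:~R + 1) / p.1.+1%:R].
have mcell p : measurable (cell p : set T).
  have := measurable_cell (\row_i ((p.2 0 i)%:~R / p.1.+1%:R))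
    (\row_i (((p.2 0 i)%:~R + 1) / p.1.+1%:R)).
  by congr (measurable _); apply/seteqP; split => x /= h i; move: (h i); rewrite !mxE.
have -> : A = \bigcup_(p : nat * 'rV[int]_d) (if `[< cell p `<=` A >] then cell p else set0).
  apply/seteqP; split => [x Ax|x [p _]]; last by case: asboolP => // h /h.
  have /nbhs_ballP[r /= r0 rA] := oA _ Ax.
  have [n nr] : exists n : nat, n.+1%:R^-1 < r.
    exists (Num.truncn r^-1).
    by rewrite -[ltRHS]invrK ltf_pV2 ?posrE ?invr_gt0// truncnS_gt.
  have n0 : (0 : R) < n.+1%:R by [].
  (* Cells are open on the left and closed on the right, hence the ceiling minus one instead of the
     floor. *)
  exists (n, \row_i (Num.ceil (x 0 i * n.+1%:R) - 1)) => //.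
  rewrite asboolT /cell /=.
    move=> i; rewrite mxE intrD mulrNz subrK ltr_pdivrMr// ler_pdivlMr//.
    by rewrite ceil_ge andbT ltrBlDr; have := ceilB1_lt (x 0 i * n.+1%:R); lra.
  move=> y hy; apply: rA; split => // j i; rewrite ord1 {j}.
  have := hy i; rewrite mxE intrD mulrNz subrK ltr_pdivrMr// ler_pdivlMr//.
  move=> /andP[h1 h2]; apply: lt_trans nr.
  have -> : n.+1%:R^-1 = 1 / n.+1%:R :> R by rewrite mul1r.
  have e : `|x 0 i - y 0 i| * n.+1%:R = `|x 0 i * n.+1%:R - y 0 i * n.+1%:R|.
    by rewrite -mulrBl normrM (gtr0_norm n0).
  rewrite ltr_pdivlMr// e.
  have := ceil_ge (x 0 i * n.+1%:R); have := ceilB1_lt (x 0 i * n.+1%:R).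
  by rewrite ltr_norml => h3 h4; apply/andP; move: h1 h3; rewrite intrD; split; lra.
apply: countable_bigcupT_measurable => [|p].
  exact: countableP.
by case: ifP => // _; exact: mcell.
Qed.

End measurable_sets.

(** * Lebesgue outer measure under affine maps, and the measure of balls *)

Section leb_scaling.
Context {R : realType} {d : nat}.
Implicit Types (a b x : 'rV[R]_d) (A : set 'rV[R]_d).

Definition affine (c : 'rV[R]_d) (t : R) x := c + t *: x.

Lemma affine_box c t a b : 0 < t ->
  affine c t @` box a b = box (affine c t a) (affine c t b).
Proof.
move=> t0; apply/seteqP; split => [_ [x hx <-] i|x hx].
  by rewrite !mxE !lerD2l !ler_pM2l//; exact: hx.
exists (t^-1 *: (x - c)); last first.
  by rewrite /affine scalerA divff ?gt_eqF// scale1r addrC subrK.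
move=> i; have := hx i; rewrite !mxE => /andP[h1 h2].
by rewrite mulrC ler_pdivlMr// ler_pdivrMr//; apply/andP; split; lra.
Qed.

(** By maximality again: A |-> t^-d mu(affine image of A) is an outer measure, and on boxes it is at
    most the volume. *)
Lemma leb_affine_le c t A : 0 < t ->
  (leb_outer R d (affine c t @` A) <= (t ^+ d)%:E * leb_outer R d A)%E.
Proof.
move=> t0; have td0 : 0 < t ^+ d by rewrite exprn_gt0.
pose nu A := ((t ^+ d)^-1%:E * leb_outer R d (affine c t @` A))%E.
suff h : (nu A <= leb_outer R d A)%E.
  rewrite -[leLHS]mul1e -(divff (lt0r_neq0 td0)) EFinM -muleA.
  by rewrite lee_wpmul2l// lee_fin ltW.
have itd0 : 0 <= (t ^+ d)^-1 by rewrite invr_ge0 ltW.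
apply: leb_outer_glb => [B|B C BC|F||a b ab].
- by rewrite mule_ge0 ?lee_fin ?outer_measure_ge0.
- by rewrite lee_wpmul2l ?lee_fin// le_outer_measure//; exact: image_subset.
- rewrite nneseriesZl; last by move=> *; exact: outer_measure_ge0.
  rewrite lee_wpmul2l ?lee_fin// image_bigcup.
  exact: outer_measure_sigma_subadditive.
- by rewrite /nu image_set0 outer_measure0 mule0.
have abt i : affine c t a 0 i <= affine c t b 0 i.
  by rewrite !mxE lerD2l ler_pM2l.
rewrite /nu affine_box//; apply: le_trans.
  by apply: lee_wpmul2l (leb_box_le abt); rewrite lee_fin.
rewrite -EFinM lee_fin ler_pdivrMl//.
rewrite -[d in t ^+ d]card_ord -prodr_const -big_split/=.
by rewrite le_eqVlt; apply/orP; left; apply/eqP/eq_bigr => i _; rewrite !mxE; ring.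
Qed.

Lemma affineK c t : 0 < t -> cancel (affine c t) (affine (- (t^-1 *: c)) t^-1).
Proof.
move=> t0 x; rewrite /affine scalerDr scalerA mulVf ?gt_eqF// scale1r.
by rewrite addrA addNr add0r.
Qed.

Lemma leb_translate c A : leb_outer R d (affine c 1 @` A) = leb_outer R d A.
Proof.
apply/eqP; rewrite eq_le; apply/andP; split.
  by have := @leb_affine_le c 1 A ltr01; rewrite expr1n mul1e.
have := @leb_affine_le (- (1^-1 *: c)) 1^-1 (affine c 1 @` A).
rewrite invr1 expr1n mul1e => /(_ ltr01); apply: le_trans.
apply: le_outer_measure => x Ax; exists (affine c 1 x); first by exists x.
by have := affineK c ltr01 x; rewrite invr1.
Qed.

Definition unit_box : set 'rV[R]_d := box 0 (const_mx 1).

Lemma leb_unit_box_le1 : (leb_outer R d unit_box <= 1)%E.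
Proof.
apply: le_trans (leb_box_le _) _ => [i|]; first by rewrite !mxE ler01.
by rewrite lee_fin big1// => i _; rewrite !mxE subr0.
Qed.

Lemma cube_affine (M : R) : 0 < M -> forall A,
  (forall x, A x -> `|x| <= M) ->
  A `<=` affine (const_mx (- M)) (2 * M) @` unit_box.
Proof.
move=> M0 A h; have M20 : 0 < 2 * M by rewrite mulr_gt0.
rewrite affine_box// => x Ax i; rewrite !mxE mulr0 mulr1.
have := le_trans (coord_le_norm x i) (h _ Ax); rewrite ler_norml => /andP[? ?].
by apply/andP; split; lra.
Qed.

Lemma leb_bounded_lty A : bounded_set A -> (leb_outer R d A < +oo)%E.
Proof.
move=> /bounded_enorm[M M0 h].
have hn x : A x -> `|x| <= M by move=> /h; exact: le_trans (norm_le_enorm x).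
have M20 : 0 < 2 * M by rewrite mulr_gt0.
apply: le_lt_trans (le_outer_measure (leb_outer R d) _ _ (cube_affine M0 hn)) _.
apply: le_lt_trans (leb_affine_le _ _ M20) _.
have td : 0 <= (2 * M) ^+ d by rewrite exprn_ge0// ltW.
apply: (@le_lt_trans _ _ ((2 * M) ^+ d)%:E); last exact: ltry.
by rewrite -[leRHS]mule1 lee_wpmul2l ?lee_fin// leb_unit_box_le1.
Qed.

(** Every bounded set lies in an affine image of the unit box, and the space is a countable union of
    bounded sets. Hence a single set of positive measure shows that the unit box has positive
    measure. *)
Lemma leb_degenerate : leb_outer R d unit_box = 0%E ->
  forall A, leb_outer R d A = 0%E.
Proof.
move=> u0 A; apply/eqP; rewrite eq_le outer_measure_ge0 andbT.
pose F (n : nat) := [set x : 'rV[R]_d | `|x| <= n.+1%:R].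
have F0 n : leb_outer R d (F n) = 0%E.
  apply/eqP; rewrite eq_le outer_measure_ge0 andbT.
  have n0 : (0 : R) < n.+1%:R by [].
  apply: le_trans (le_outer_measure (leb_outer R d) _ _ (cube_affine n0 (fun x h => h))) _.
  apply: le_trans (leb_affine_le _ _ _) _; first by rewrite mulr_gt0.
  by rewrite u0 mule0.
have AF : A `<=` \bigcup_n F n.
  move=> x _; exists (Num.truncn `|x|) => //.
  by rewrite /F/= ltW// truncnS_gt.
apply: le_trans (le_outer_measure (leb_outer R d) _ _ AF) _.
apply: le_trans (outer_measure_sigma_subadditive (leb_outer R d) F) _.
by rewrite eseries0.
Qed.

(* The Lebesgue measure of the unit box is 1, but only its positivity matters. *)
Lemma leb_eball_ge (c : R) : leb_outer R d unit_box = c%:E ->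
  forall x e, 0 < e ->
  ((c / (d.+1%:R) ^+ d * e ^+ d)%:E <= leb_outer R d (eball x e))%E.
Proof.
(* A box of side t with corner x stays within distance t d of x, and t d < e for t = e/(d+1). *)
move=> hc x e e0; pose t := e / d.+1%:R.
have t0 : 0 < t by rewrite divr_gt0.
have sub : affine x t @` unit_box `<=` eball x e.
  move=> _ [y hy <-]; rewrite /eball/= /affine addrC addKr enormZ gtr0_norm//.
  apply: (@le_lt_trans _ _ (t * d%:R)).
    rewrite ler_pM2l//; apply: le_trans (enorm_le_norm _) _.
    rewrite -[leRHS]mulr1 ler_wpM2l//; apply: norm_le_coord => // i.
    by have := hy i; rewrite !mxE => /andP[h1 h2]; rewrite ger0_norm.
  by rewrite /t mulrAC -mulrA gtr_pMr// ltr_pdivrMr// mul1r ltr_nat.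
apply: le_trans (le_outer_measure (leb_outer R d) _ _ sub).
have t'0 : 0 < t^-1 by rewrite invr_gt0.
have := leb_affine_le (- (t^-1 *: x)) (affine x t @` unit_box) t'0.
rewrite image_comp (_ : _ \o _ = id); last first.
  by apply/funext => y /=; rewrite affineK.
rewrite image_id hc => h.
have -> : c / d.+1%:R ^+ d * e ^+ d = t ^+ d * c.
  by rewrite /t expr_div_n [RHS]mulrC mulrA mulrAC.
have td : 0 < t ^+ d by rewrite exprn_gt0.
rewrite EFinM; apply: le_trans.
  by apply: lee_wpmul2l h; rewrite lee_fin ltW.
by rewrite muleA -EFinM exprVn divff ?gt_eqF// mul1e.
Qed.

End leb_scaling.

(** * Integral estimates for functions not known to be measurable *)

Section integral_upper_bounds.
Context {R : realType} {T : pointedType}.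
Variable mu : {outer_measure set T -> \bar R}.
Local Notation cT := (caratheodory_type mu).
Local Notation cmu := (mu : {measure set cT -> \bar R}).
Import HBNNSimple.
Local Open Scope ereal_scope.

(* No measurability is assumed on f or A: the simple functions below f are
   supported in measurable subsets of A. *)
Lemma integralT_le_outer (f : cT -> \bar R) (A : set T) (M : \bar R) :
  (0 <= M) -> (forall x, 0 <= f x <= M) -> (forall x, ~ A x -> f x = 0) ->
  \int[cmu]_x f x <= M * mu A.
Proof.
move=> M0 f0M fA; rewrite ge0_integralTE; last by move=> x; case/andP: (f0M x).
have fM x : f x <= M by case/andP: (f0M x).
apply: ge_ereal_sup => _ /= [h hf <-].
pose S : set cT := [set x | h x != 0%R].
have mS : measurable S.
  have -> : S = ~` (h @^-1` [set 0%R]).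
    by apply/seteqP; split => x /= /eqP.
  by apply: measurableC; apply: measurable_sfunP.
have SA : S `<=` A.
  move=> x /eqP hx; apply: contrapT => /fA fx; apply: hx.
  apply/eqP; rewrite eq_le fun_ge0 andbT -lee_fin.
  by have := hf x; rewrite fx.
have hS : (h : cT -> R) = h \_ S.
  apply/funext => x; rewrite patchE; case: ifPn => //.
  by rewrite notin_setE /S/= => /negP; rewrite negbK => /eqP.
rewrite -integralT_nnsfun.
have -> : \int[cmu]_x (h x)%:E = \int[cmu]_(x in S) (h x)%:E.
  rewrite [RHS]integral_mkcond; apply: eq_integral => x _.
  by rewrite [in LHS]hS !patchE; case: ifP.
apply: (@le_trans _ _ (\int[cmu]_(x in S) cst M x)).
  apply: ge0_le_integral => //.
  - by move=> x _; rewrite lee_fin.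
  - by apply/measurable_EFinP; exact: measurable_funTS.
  - by move=> x _; exact: le_trans (hf x) (fM x).
rewrite integral_cst//; apply: lee_wpmul2l => //.
exact: (le_outer_measure mu).
Qed.

Lemma integral_le_outer (f : cT -> \bar R) (A : set T) (M : \bar R) : 0 <= M ->
  (forall x, A x -> 0 <= f x <= M) -> \int[cmu]_(x in A) f x <= M * mu A.
Proof.
move=> M0 fM; rewrite integral_mkcond; apply: integralT_le_outer => // x.
  by rewrite patchE; case: ifPn => [/set_mem/fM//|]; rewrite lexx M0.
by rewrite patchE => Ax; case: ifPn => // /set_mem.
Qed.

(** The integral is by definition the difference of those of the positive and negative parts. Each
    lies in [0, M m], hence so does the absolute value of the difference. *)
Lemma abs_integral_le_outer (f : cT -> R) (A : set T) (M m : R) : (0 <= M)%R ->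
  mu A <= m%:E -> (forall x, A x -> `|f x| <= M)%R ->
  (`|\int[cmu]_(x in A) f x| <= M * m)%R.
Proof.
move=> M0 muA fM.
have m0 : (0 <= m)%R by rewrite -lee_fin (le_trans _ muA)// outer_measure_ge0.
have bnd (g : cT -> \bar R) : (forall x, A x -> 0 <= g x <= M%:E) ->
    0 <= \int[cmu]_(x in A) g x <= (M * m)%:E.
  move=> gM; apply/andP; split; first by apply: integral_ge0 => x /gM/andP[].
  apply: (le_trans (integral_le_outer _ gM)); rewrite ?lee_fin//.
  by rewrite EFinM lee_wpmul2l// lee_fin.
rewrite /Rintegral integralE.
have /andP[p0 pM] : 0 <= \int[cmu]_(x in A) (fun x => (f x)%:E)^\+ x <= (M * m)%:E.
  apply: bnd => x Ax; rewrite funepos_ge0/= funeposE ge_max !lee_fin M0 andbT.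
  by rewrite (le_trans (ler_norm _))// fM.
have /andP[n0 nM] : 0 <= \int[cmu]_(x in A) (fun x => (f x)%:E)^\- x <= (M * m)%:E.
  apply: bnd => x Ax; rewrite funeneg_ge0/= funenegE ge_max !lee_fin M0 andbT.
  by rewrite (le_trans (ler_norm _))// normrN fM.
set p := \int[_]_(_ in _) _ in p0 pM *; set n := \int[_]_(_ in _) _ in n0 nM *.
have pf : p \is a fin_num by rewrite ge0_fin_numE// (le_lt_trans pM) ?ltry.
have nf : n \is a fin_num by rewrite ge0_fin_numE// (le_lt_trans nM) ?ltry.
move: p0 pM n0 nM; rewrite -(fineK pf) -(fineK nf) !lee_fin => p0 pM n0 nM.
by rewrite /= ler_norml; apply/andP; split; lra.
Qed.

Lemma Rintegral_negligible (f : cT -> R) (A : set T) : mu A = 0 ->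
  (forall x, ~ A x -> f x = 0%R) -> (\int[cmu]_x f x = 0)%R.
Proof.
move=> A0 fA; rewrite /Rintegral integralE.
(* The bound [M = +oo] is legitimate here because [+oo * 0 = 0]. *)
have nn (g : cT -> \bar R) : (forall x, 0 <= g x) -> (forall x, ~ A x -> g x = 0) ->
    \int[cmu]_x g x = 0.
  move=> g0 gA; apply/eqP; rewrite eq_le integral_ge0// andbT.
  rewrite (le_trans (integralT_le_outer (M := +oo) (A := A) _ _ _))//.
  - by move=> x; rewrite g0 leey.
  - by rewrite A0 mule0.
rewrite !nn ?sube0// => x; rewrite ?funepos_ge0 ?funeneg_ge0//.
- by move/fA => fx; rewrite funenegE fx oppe0 maxxx.
- by move/fA => fx; rewrite funeposE fx maxxx.
Qed.

End integral_upper_bounds.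

(** * Measurability and translation invariance for the Lebesgue measure *)

Section leb_integration.
Context {R : realType} {d : nat}.
Local Notation T := (caratheodory_type (leb_outer R d)).
Implicit Types (f : 'rV[R]_d -> R) (A : set 'rV[R]_d).

Lemma continuous_measurable_leb A f : open A ->
  (forall x, A x -> {for x, continuous f}) -> measurable_fun (A : set T) (f : T -> R).
Proof.
move=> oA cf; apply: (measurability _ (RGenOpens.measurableE R)).
move=> _ [_ [a [b ->] <-]]; apply: open_measurable_leb.
rewrite openE => x [Ax fx] /=.
apply: filterI; first exact: open_nbhs_nbhs.
by apply: (cf x Ax); apply: open_nbhs_nbhs; split => //; exact: interval_open.
Qed.

Lemma leb_integral_translate f (c : 'rV[R]_d) : continuous f ->
  (forall x, 0 <= f x) ->
  (\int[leb R d]_x (f (x - c))%:E = \int[leb R d]_x (f x)%:E)%E.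
Proof.
move=> cf f0; pose phi : T -> T := fun x : 'rV[R]_d => x - c.
have pre A : phi @^-1` A = affine c 1 @` A.
  apply/seteqP; split => [x Ax|_ [x Ax <-]].
    by exists (x - c) => //; rewrite /affine scale1r addrC subrK.
  by rewrite /preimage/= /phi/affine scale1r addrC addKr.
have mphi : measurable_fun setT phi.
  move=> _ A mA; rewrite setTI.
  have {}mA : caratheodory_measurable (leb_outer R d) A := mA.
  suff : caratheodory_measurable (leb_outer R d) (phi @^-1` A) by [].
  move=> X.
  have e B : leb_outer R d B = leb_outer R d (affine (- c) 1 @` B).
    by rewrite leb_translate.
  rewrite e mA; congr (_ + _)%E; rewrite [RHS]e; congr (leb_outer R d _).
    apply/seteqP; split => [_ [[x Xx <-] Ax]|_ [x [Xx Ax] <-]].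
      exists x => //; split => //; move: Ax.
      by rewrite /preimage/=/phi/affine scale1r addrC.
    split; first by exists x.
    by move: Ax; rewrite /preimage/=/phi/affine scale1r addrC.
  apply/seteqP; split => [_ [[x Xx <-] Ax]|_ [x [Xx Ax] <-]].
    exists x => //; split => //; move: Ax.
    by rewrite /preimage/=/phi/affine scale1r addrC.
  split; first by exists x.
  by move: Ax; rewrite /preimage/=/phi/affine scale1r addrC.
have mf : measurable_fun (setT : set T) (fun x : T => (f x)%:E).
  apply/measurable_EFinP; apply: (continuous_measurable_leb openT) => x _.
  exact: cf.
have := @ge0_integral_pushforward _ _ T T R phi mphi (leb R d) setT _ measurableT mf.
rewrite preimage_setT => /(_ _)/esym h.
rewrite h; last by move=> x _; rewrite lee_fin.
apply: eq_measure_integral => A mA _.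
have h2 : leb_outer R d (phi @^-1` A) = leb_outer R d A.
  by rewrite pre leb_translate.
exact: h2.
Qed.

Lemma measurable_leb_eballs (f : 'rV[R]_d -> R) :
  (forall r : R, measurable_fun (eball 0 r : set T) (f : T -> R)) ->
  measurable_fun (setT : set T) (f : T -> R).
Proof.
move=> h; have -> : (setT : set T) = \bigcup_n (eball 0 n%:R : set T).
  apply/seteqP; split => // x _; exists (Num.truncn (enorm (x : 'rV[R]_d))).+1 => //.
  by rewrite /eball/= subr0 truncnS_gt.
apply/measurable_fun_bigcup => n; last exact: h.
exact/open_measurable_leb/open_eball.
Qed.

End leb_integration.

(** * Directional derivatives reduced to one variable *)

Section directional_derivatives.
Context {R : realType} {V : normedModType R}.
Implicit Types (f g : V -> R) (x v : V).

Lemma derive_lineE f x v :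
  'D_v f x = 'D_1 (fun t : R => f (t *: v + x)) 0.
Proof.
rewrite /derive; suff -> : (fun h : R => h^-1 *: ((f \o shift x) (h *: v) - f x)) =
  (fun h => h^-1 *: (((fun t : R => f (t *: v + x)) \o shift 0) (h *: 1)
                      - f (0 *: v + x))) by [].
apply/funext => h /=.
by rewrite scale0r add0r addr0 [h *: 1]/GRing.scale/= mulr1.
Qed.

Lemma is_derive_line f x v (l : R) :
  is_derive x v f l <-> is_derive (0 : R) 1 (fun t : R => f (t *: v + x)) l.
Proof.
split=> -[h e]; split.
- exact: (derivable1P f x v).1 h.
- by rewrite -derive_lineE.
- exact: (derivable1P f x v).2 h.
- by rewrite derive_lineE.
Qed.

Lemma is_derive_comp (F : R -> R) f x v (l m : R) :
  is_derive x v f l -> is_derive (f x) 1 F m ->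
  is_derive x v (F \o f) (m * l).
Proof.
move=> /is_derive_line hf hF; apply/is_derive_line.
apply: (@is_derive1_comp _ F (fun t : R => f (t *: v + x))).
by rewrite scale0r add0r.
Qed.

(* When the difference quotient does not converge, 'D_v f x is 0. *)
Lemma derive_le_lipschitz f x v (L r : R) : 0 <= L -> 0 < r ->
  (forall t : R, `|t| < r -> `|f (t *: v + x) - f x| <= L * `|t|) ->
  `|'D_v f x| <= L.
Proof.
move=> L0 r0 h; have [df|ndf] := pselect (derivable f x v); last first.
  by rewrite /derive dvgP// normr0.
have := df; rewrite /derivable => /cvg_norm/cvg_lim <-//.
apply: limr_le; first by apply: is_cvg_norm.
near=> t.
have t0 : t != 0 by near: t; exact: nbhs_dnbhs_neq.
rewrite normrM normfV ler_pdivrMl ?normr_gt0// mulrC; apply: h.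
near: t; apply: nbhs_dnbhs; apply/nbhs_ballP; exists r => // t.
by rewrite -ball_normE /= sub0r normrN.
Unshelve. all: by end_near. Qed.

(** The mean value inequality, stated with [Num.min] and [Num.max] because the end points will be
    distances whose order is unknown. *)
Lemma lipschitz_of_derive (F F' : R -> R) (M a b : R) : 0 <= M ->
  (forall t, Num.min a b <= t <= Num.max a b -> is_derive t 1 F (F' t)) ->
  (forall t, Num.min a b <= t <= Num.max a b -> `|F' t| <= M) ->
  `|F a - F b| <= M * `|a - b|.
Proof.
move=> M0; wlog ab : a b / a <= b.
  move=> H dF bF; have [/H->//|/ltW ba] := leP a b.
  by rewrite distrC [X in _ * X]distrC; apply: H => //; rewrite minC maxC.
rewrite (min_idPl ab) (max_idPr ab) => dF bF.
have [c hc e] : exists2 c, c \in `[a, b]%R & F b - F a = F' c * (b - a).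
  apply: MVT_segment => // [t|].
    by rewrite in_itv/= => /andP[/ltW h1 /ltW h2]; apply: dF; rewrite h1.
  apply: derivable_within_continuous => t; rewrite in_itv/= => tab.
  by have [] := dF t tab.
rewrite distrC e normrM [X in _ * X]distrC ler_wpM2r//; apply: bF.
by move: hc; rewrite in_itv.
Qed.

Lemma is_derive_eqr f x v (a b : R) :
  is_derive x v f a -> a = b -> is_derive x v f b.
Proof. by move=> h <-. Qed.

Lemma is_derive_fmul f g x v (a b : R) :
  is_derive x v f a -> is_derive x v g b ->
  is_derive x v (fun y => f y * g y) (a * g x + f x * b).
Proof.
move=> hf hg; apply: (is_derive_eqr (is_deriveM hf hg)).
rewrite /GRing.scale/=; ring.
Qed.

Lemma is_derive_fadd f g x v (a b : R) :
  is_derive x v f a -> is_derive x v g b ->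
  is_derive x v (fun y => f y + g y) (a + b).
Proof. by move=> hf hg; exact: is_deriveD. Qed.

Lemma is_derive_fopp f x v (a : R) :
  is_derive x v f a -> is_derive x v (fun y => - f y) (- a).
Proof. by move=> hf; exact: is_deriveN. Qed.

Lemma is_derive_fsub f g x v (a b : R) :
  is_derive x v f a -> is_derive x v g b ->
  is_derive x v (fun y => f y - g y) (a - b).
Proof. by move=> hf hg; exact: is_deriveB. Qed.

Lemma is_derive_fcst x v (c : R) : is_derive x v (fun=> c) 0.
Proof. exact: is_derive_cst. Qed.

Lemma is_derive_fscale (c : R) f x v (a : R) :
  is_derive x v f a -> is_derive x v (fun y => c * f y) (c * a).
Proof.
move=> hf; have := is_derive_fmul (is_derive_fcst x v c) hf.
by rewrite mul0r add0r.
Qed.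

Lemma is_derive_unique f x v (a b : R) :
  is_derive x v f a -> is_derive x v f b -> a = b.
Proof. by move=> [_ <-] [_ <-]. Qed.

End directional_derivatives.

Lemma is_derive1_id {R : realType} (x : R) : is_derive x 1 (fun y => y) 1.
Proof. exact: is_derive_id. Qed.

Lemma is_derive1_sqr {R : realType} (x : R) :
  is_derive x 1 (fun y => y ^+ 2) (2 * x).
Proof.
apply: (is_derive_eqr (is_derive_fmul (is_derive1_id x) (is_derive1_id x))).
by rewrite mulrDl !mul1r mulr1.
Qed.

Lemma is_derive1_inv {R : realType} (x : R) : x != 0 ->
  is_derive x 1 (fun y => y^-1) (- (x ^- 2)).
Proof.
move=> x0; apply: (is_derive_eqr (@is_deriveV R id x 1 1 x0 (is_derive1_id x))).
by rewrite /GRing.scale/= mulr1.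
Qed.

Lemma is_derive1_continuous {R : realType} (f : R -> R) (x a : R) :
  is_derive x 1 f a -> {for x, continuous f}.
Proof. by case=> /derivable1_diffP /differentiable_continuous. Qed.

(** * Entire series and the Bessel functions of order zero *)

Section entire_series.
Context {R : realType}.
Implicit Types (c : nat -> R) (s : R).

Definition psum c s : R := limn (pseries c s).

(** Domination by the exponential series. This bound is stable under termwise differentiation, so it
    yields convergence everywhere for the series and for all its derivatives. *)
Definition fact_bounded c := forall i, `|c i| <= (i`!%:R)^-1.

Lemma is_cvg_pseries_fact c s : fact_bounded c -> cvgn (pseries c s).
Proof.
move=> hc; apply: normed_cvg.
apply: (@series_le_cvg _ _ (exp_coeff `|s|)) => [i|i|i|].
- exact: normr_ge0.
- by rewrite exp_coeff_ge0.
- by rewrite /= normrM normrX /exp_coeff/= mulrC ler_wpM2l ?exprn_ge0.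
exact: is_cvg_series_exp_coeff.
Qed.

Lemma fact_bounded_diffs c : fact_bounded c -> fact_bounded (pseries_diffs c).
Proof.
move=> hc i; rewrite /pseries_diffs normrM gtr0_norm//.
apply: le_trans (ler_wpM2l _ (hc _)) _ => //.
by rewrite factS natrM invfM mulrA divff// mul1r.
Qed.

Lemma is_derive_psum c s : fact_bounded c ->
  is_derive s 1 (psum c) (psum (pseries_diffs c) s).
Proof.
move=> hc; apply: (@pseries_snd_diffs _ c (`|s| + 1)).
- exact: is_cvg_pseries_fact.
- exact/is_cvg_pseries_fact/fact_bounded_diffs.
- exact/is_cvg_pseries_fact/fact_bounded_diffs/fact_bounded_diffs.
by rewrite [ltRHS]ger0_norm ?addr_ge0// ltrDl.
Qed.

Definition shift_coef c i := if i is j.+1 then c j else 0.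

Lemma psum_shift c s : cvgn (pseries c s) ->
  pseries (shift_coef c) s @ \oo --> s * psum c s.
Proof.
move=> hc; rewrite -cvg_shiftS /=.
suff -> : (fun n => pseries (shift_coef c) s n.+1) = s *: pseries c s.
  exact: cvgZr hc.
apply/funext => n; rewrite /pseries /series/= big_nat_recl//= mul0r add0r.
rewrite -[RHS]/(s * \sum_(0 <= i < n) c i * s ^+ i) mulr_sumr; apply: eq_bigr => i _.
by rewrite exprS mulrCA.
Qed.

Lemma cvg_psum c s : fact_bounded c -> pseries c s @ \oo --> psum c s.
Proof. by move=> /is_cvg_pseries_fact; apply. Qed.

(* Term by term, s S'' + S' + S has coefficients (i+1)^2 c_(i+1) + c_i. *)
Lemma psum_bessel_ode c e s : fact_bounded c -> fact_bounded e ->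
  (forall i, i.+1%:R ^+ 2 * c i.+1 + c i = e i) ->
  s * psum (pseries_diffs (pseries_diffs c)) s + psum (pseries_diffs c) s
    + psum c s = psum e s.
Proof.
move=> hc he hce; have hc1 := fact_bounded_diffs hc.
have hc2 := fact_bounded_diffs hc1.
have := cvgD (cvgD (psum_shift (@is_cvg_pseries_fact _ s hc2)) (@cvg_psum _ s hc1))
  (@cvg_psum _ s hc).
move=> h; apply: (@cvg_unique _ (@norm_hausdorff R R) (pseries e s @ \oo)); last exact: cvg_psum.
suff -> : pseries e s = pseries (shift_coef (pseries_diffs (pseries_diffs c))) s
    + pseries (pseries_diffs c) s + pseries c s by exact: h.
apply/funext => n; rewrite /pseries /series.
rewrite -[RHS]/(\sum_(0 <= i < n) shift_coef (pseries_diffs (pseries_diffs c)) i * s ^+ i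
  + \sum_(0 <= i < n) pseries_diffs c i * s ^+ i + \sum_(0 <= i < n) c i * s ^+ i).
rewrite -!big_split/=.
apply: eq_bigr => -[|i] _; rewrite -hce /pseries_diffs/=; ring.
Qed.

End entire_series.

Section bessel.
Context {R : realType}.
Implicit Types (t : R).

(** Coefficients of J0 as a series S in s = t^2/4. In this variable the equation f'' + f'/t + f = 0
    becomes s S'' + S' + S = 0, which is a recursion on coefficients. *)
Definition J0_coef (m : nat) : R := (-1) ^+ m / m`!%:R ^+ 2.
Definition Y0_coef (m : nat) : R := series harmonic m * J0_coef m.

Lemma series_harmonicS m :
  series harmonic m.+1 = series harmonic m + m.+1%:R^-1 :> R.
Proof. by rewrite /series/= big_nat_recr. Qed.

Lemma series_harmonic_ge0 m : 0 <= series harmonic m :> R.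
Proof. by rewrite /series/= sumr_ge0// => i _; rewrite harmonic_ge0. Qed.

Lemma series_harmonic_le m : series harmonic m <= m%:R :> R.
Proof.
elim: m => [|m ih]; first by rewrite /series/= big_geq.
by rewrite series_harmonicS -[leRHS]natr1 lerD// invf_le1// ler1n.
Qed.

Lemma fact_ge1 m : 1 <= m`!%:R :> R.
Proof. by rewrite ler1n fact_gt0. Qed.

Lemma J0_coef_norm m : `|J0_coef m| = (m`!%:R ^+ 2)^-1.
Proof.
by rewrite normrM normrX normrN1 expr1n mul1r normfV ger0_norm// exprn_ge0.
Qed.

Lemma fact_bounded_J0 : fact_bounded J0_coef.
Proof.
move=> m; rewrite J0_coef_norm lef_pV2 ?posrE ?exprn_gt0 ?ltr0n ?fact_gt0//.
by rewrite expr2 ler_peMr// fact_ge1.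
Qed.

Lemma fact_bounded_Y0 : fact_bounded Y0_coef.
Proof.
move=> m; rewrite normrM J0_coef_norm ger0_norm ?series_harmonic_ge0//.
have m0 : (0 : R) < m`!%:R by rewrite ltr0n fact_gt0.
rewrite expr2 invfM mulrA ler_piMl ?invr_ge0// ler_pdivrMr// mul1r.
apply: le_trans (series_harmonic_le m) _; rewrite ler_nat.
by case: m {m0} => // m; rewrite factS leq_pmulr// fact_gt0.
Qed.

Lemma J0_coefS m : m.+1%:R ^+ 2 * J0_coef m.+1 = - J0_coef m.
Proof.
have h1 : m.+1%:R != 0 :> R by rewrite pnatr_eq0.
have h2 : m`!%:R != 0 :> R by rewrite pnatr_eq0 -lt0n fact_gt0.
rewrite /J0_coef factS natrM [(-1) ^+ m.+1]exprS.
by move: (m.+1%:R : R) (m`!%:R : R) h1 h2 => a b a0 b0; field; rewrite a0 b0.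
Qed.

Lemma J0_coef_rec m : m.+1%:R ^+ 2 * J0_coef m.+1 + J0_coef m = 0.
Proof. by rewrite J0_coefS addNr. Qed.

(** Consecutive harmonic numbers differ by 1/(m+1), so the recursion of J0 leaves the defect
    [- J0_coef m / m.+1%:R], which is the m-th coefficient of the derived J0 series. *)
Lemma Y0_coef_rec m :
  m.+1%:R ^+ 2 * Y0_coef m.+1 + Y0_coef m = pseries_diffs J0_coef m.
Proof.
rewrite /Y0_coef mulrCA J0_coefS series_harmonicS /pseries_diffs.
have h : m.+1%:R != 0 :> R by rewrite pnatr_eq0.
have -> : m.+1%:R * J0_coef m.+1 = - J0_coef m / m.+1%:R.
  by rewrite -J0_coefS; move: (m.+1%:R : R) h => a a0; field.
by move: (m.+1%:R : R) h => a a0; ring.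
Qed.

Lemma psum0 s : psum (fun=> 0 : R) s = 0.
Proof.
rewrite /psum (_ : pseries _ _ = cst 0) ?lim_cst//; last first.
  by apply/funext => n; rewrite /pseries/series/= big1// => i _; rewrite mul0r.
Qed.

Let A := @psum R J0_coef.
Let A1 := @psum R (pseries_diffs J0_coef).
Let A2 := @psum R (pseries_diffs (pseries_diffs J0_coef)).
Let B := @psum R Y0_coef.
Let B1 := @psum R (pseries_diffs Y0_coef).
Let B2 := @psum R (pseries_diffs (pseries_diffs Y0_coef)).

Lemma psum_J0_ode s : s * A2 s + A1 s + A s = 0.
Proof.
rewrite -[RHS](psum0 s); apply: psum_bessel_ode J0_coef_rec.
  exact: fact_bounded_J0.
by move=> i; rewrite normr0 invr_ge0.
Qed.

Lemma psum_Y0_ode s : s * B2 s + B1 s + B s = A1 s.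
Proof.
apply: psum_bessel_ode Y0_coef_rec; first exact: fact_bounded_Y0.
exact/fact_bounded_diffs/fact_bounded_J0.
Qed.

Lemma half_expr_double t m : (t / 2) ^+ m.*2 = (t ^+ 2 / 4) ^+ m.
Proof. by rewrite -muln2 mulnC exprM expr_div_n -natrX. Qed.

Lemma besselJ0E t : besselJ0 t = A (t ^+ 2 / 4).
Proof.
rewrite /besselJ0 /A /psum; congr (limn (series _)); apply/funext => m.
by rewrite /= half_expr_double /J0_coef mulrAC.
Qed.

Lemma besselY0E t : besselY0 t =
  2 / pi * ((ln (t / 2) + euler_gamma) * A (t ^+ 2 / 4) - B (t ^+ 2 / 4)).
Proof.
rewrite /besselY0 besselJ0E; congr (_ * (_ - _)).
rewrite /B /psum; congr (limn (series _)).
apply/funext => m; rewrite /= half_expr_double /Y0_coef /J0_coef.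
by rewrite [(-1) ^+ m * _]mulrC mulrAC !mulrA.
Qed.

Definition bessel_sol (f f1 : R -> R) := exists f2 : R -> R, forall t, 0 < t ->
  [/\ is_derive t 1 f (f1 t), is_derive t 1 f1 (f2 t) &
      f2 t + f1 t / t + f t = 0].

Let is_derive_quarter t : is_derive t 1 (fun t => t ^+ 2 / 4) (t / 2).
Proof.
apply: (is_derive_eqr (is_derive_fmul (is_derive1_sqr t) (is_derive_fcst _ _ _))).
by lra.
Qed.

Let is_derive_half t : is_derive t 1 (fun t => t / 2) (2^-1 : R).
Proof.
apply: (is_derive_eqr (is_derive_fmul (is_derive1_id t) (is_derive_fcst _ _ _))).
by lra.
Qed.

Let is_derive_psum_quarter (c : nat -> R) t : fact_bounded c ->
  is_derive t 1 (fun t => psum c (t ^+ 2 / 4))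
    (psum (pseries_diffs c) (t ^+ 2 / 4) * (t / 2)).
Proof. by move=> hc; exact: is_derive_comp (is_derive_quarter t) (is_derive_psum _ hc). Qed.

Lemma bessel_sol_J0 : exists f1, bessel_sol besselJ0 f1.
Proof.
exists (fun t => A1 (t ^+ 2 / 4) * (t / 2)).
exists (fun t => A2 (t ^+ 2 / 4) * (t ^+ 2 / 4) + A1 (t ^+ 2 / 4) / 2) => t t0; split.
- have -> : besselJ0 = fun t => A (t ^+ 2 / 4).
    by apply/funext => x; exact: besselJ0E.
  exact: is_derive_psum_quarter fact_bounded_J0.
- have h1 := is_derive_psum_quarter t (fact_bounded_diffs fact_bounded_J0).
  apply: (is_derive_eqr (is_derive_fmul h1 (is_derive_half t))).
  by rewrite -/A1 -/A2; field.
- have := psum_J0_ode (t ^+ 2 / 4); rewrite besselJ0E.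
  have tn : t != 0 by rewrite gt_eqF.
  by move: (A _) (A1 _) (A2 _) => a a1 a2 h; rewrite -[RHS]h; field.
Qed.

(** With l = ln(t/2) + euler_gamma one has l'' + l'/t = 0. The Bessel operator therefore sends l J0
    to the cross term 2 l' J0', which is [A1] at t^2/4, and it sends the harmonic series [B] to the
    same [A1]: the two cancel in g. *)
Lemma bessel_sol_Y0 : exists f1, bessel_sol besselY0 f1.
Proof.
pose q t : R := t ^+ 2 / 4; pose l t : R := ln (t / 2) + euler_gamma.
pose g t := l t * A (q t) - B (q t).
pose g1 t := t^-1 * A (q t) + l t * (A1 (q t) * (t / 2)) - B1 (q t) * (t / 2).
pose g2 t := - (A (q t) / t ^+ 2) + A1 (q t)
  + l t * (A2 (q t) * q t + A1 (q t) / 2) - (B2 (q t) * q t + B1 (q t) / 2).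
have dl t : 0 < t -> is_derive t 1 l t^-1.
  move=> t0; have t20 : 0 < t / 2 by rewrite divr_gt0.
  apply: (is_derive_eqr (is_derive_fadd (is_derive_comp (is_derive_half t)
    (is_derive1_ln t20)) (is_derive_fcst _ _ _))).
  by rewrite addr0; field; rewrite gt_eqF.
have dA t : is_derive t 1 (A \o q) (A1 (q t) * (t / 2)).
  exact: is_derive_psum_quarter fact_bounded_J0.
have dA1 t : is_derive t 1 (A1 \o q) (A2 (q t) * (t / 2)).
  exact: is_derive_psum_quarter (fact_bounded_diffs fact_bounded_J0).
have dB t : is_derive t 1 (B \o q) (B1 (q t) * (t / 2)).
  exact: is_derive_psum_quarter fact_bounded_Y0.
have dB1 t : is_derive t 1 (B1 \o q) (B2 (q t) * (t / 2)).
  exact: is_derive_psum_quarter (fact_bounded_diffs fact_bounded_Y0).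
have dg t : 0 < t -> is_derive t 1 g (g1 t).
  by move=> t0; exact: is_derive_fsub (is_derive_fmul (dl t t0) (dA t)) (dB t).
have dg1 t : 0 < t -> is_derive t 1 g1 (g2 t).
  move=> t0; have tn : t != 0 by rewrite gt_eqF.
  apply: (is_derive_eqr (is_derive_fsub (is_derive_fadd
     (is_derive_fmul (is_derive1_inv tn) (dA t))
     (is_derive_fmul (dl t t0) (is_derive_fmul (dA1 t) (is_derive_half t))))
     (is_derive_fmul (dB1 t) (is_derive_half t)))).
  by rewrite /g2 /= /q; field.
exists (fun t => 2 / pi * g1 t), (fun t => 2 / pi * g2 t) => t t0; split.
- rewrite (_ : besselY0 = fun t => 2 / pi * g t); last first.
    by apply/funext => x; exact: besselY0E.
  exact: is_derive_fscale (dg t t0).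
- exact: is_derive_fscale (dg1 t t0).
have tn : t != 0 by rewrite gt_eqF.
rewrite besselY0E -[ln _ + _]/(l t) -/(q t).
suff h : g2 t + g1 t / t + g t = 0.
  by rewrite -/(g t) -(mulrA _ (g1 t)) -!mulrDr h mulr0.
have h1 := psum_J0_ode (q t); have h2 := psum_Y0_ode (q t).
have -> : g2 t + g1 t / t + g t = l t * (q t * A2 (q t) + A1 (q t) + A (q t))
    - (q t * B2 (q t) + B1 (q t) + B (q t)) + A1 (q t).
  by rewrite /g2 /g1 /g; field.
by rewrite h1 h2; lra.
Qed.

(* For w = sqrt t * f the equation reads w'' + (1 + 1 / (4 t^2)) w = 0, whose
   energy w'^2 + (1 + 1 / (4 t^2)) w^2 = E is nonincreasing. *)
Lemma bessel_sol_decay (f f1 : R -> R) : bessel_sol f f1 ->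
  exists2 C : R, 0 < C & forall t, 1 <= t ->
    `|f t| <= C / Num.sqrt t /\ `|f1 t| <= C / Num.sqrt t.
Proof.
move=> [f2 H].
pose E t := t * (f t * f t + f1 t * f1 t) + f t * f1 t + f t * f t * (2^-1 * t^-1).
have dE t : 0 < t -> is_derive t 1 E (- (f t ^+ 2 / (2 * t ^+ 2))).
  move=> t0; have [df df1 e] := H t t0; have tn : t != 0 by rewrite gt_eqF.
  apply: (is_derive_eqr (is_derive_fadd (is_derive_fadd
    (is_derive_fmul (is_derive1_id t)
       (is_derive_fadd (is_derive_fmul df df) (is_derive_fmul df1 df1)))
    (is_derive_fmul df df1))
    (is_derive_fmul (is_derive_fmul df df)
       (is_derive_fscale 2^-1 (is_derive1_inv tn))))).
  have -> : f2 t = - (f1 t / t) - f t by lra.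
  by field.
have Ele t : 1 <= t -> E t <= E 1.
  move=> t1; apply: (@ler0_derive1_nincry _ E 1) => // [x|x|].
  - by rewrite in_itv/= andbT => x1; have [] := dE x (lt_trans ltr01 x1).
  - rewrite in_itv/= andbT => x1; have x0 := lt_trans ltr01 x1.
    rewrite derive1E; have [_ ->] := dE x x0.
    by rewrite oppr_le0 divr_ge0 ?sqr_ge0// mulr_ge0// sqr_ge0.
  - apply: derivable_within_continuous => x; rewrite in_itv/= andbT => x1.
    by have [] := dE x (lt_le_trans ltr01 x1).
(* For t >= 1 the cross term is absorbed: f f1 >= - (f^2 + f1^2)/2 >= - t (f^2 + f1^2)/2. *)
have Ege t : 1 <= t -> t / 2 * (f t ^+ 2 + f1 t ^+ 2) <= E t.
  move=> t1; have t0 := lt_le_trans ltr01 t1.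
  have h1 : 0 <= f t * f t * (2^-1 * t^-1).
    by rewrite mulr_ge0 -?expr2 ?sqr_ge0// mulr_ge0 ?invr_ge0// ltW.
  have h2 := sqr_ge0 (f t + f1 t).
  have h3 : 0 <= (t - 1) * (f t ^+ 2 + f1 t ^+ 2).
    by rewrite mulr_ge0 ?subr_ge0// addr_ge0 ?sqr_ge0.
  rewrite /E; lra.
have E0 : 0 <= E 1.
  apply: le_trans (Ege 1 (lexx _)).
  by rewrite mulr_ge0 ?divr_ge0// addr_ge0 ?sqr_ge0.
(* The added 1 keeps the constant positive when the energy at 1 vanishes. *)
exists (Num.sqrt (2 * E 1 + 1)) => [|t t1]; first by rewrite sqrtr_gt0; lra.
have t0 := lt_le_trans ltr01 t1.
have bnd (a b : R) : t / 2 * (a ^+ 2 + b ^+ 2) <= E 1 ->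
    `|a| <= Num.sqrt (2 * E 1 + 1) / Num.sqrt t.
  move=> h; rewrite -sqrtr_sqr ler_pdivlMr ?sqrtr_gt0// -sqrtrM ?sqr_ge0//.
  rewrite ler_wsqrtr//; have := mulr_ge0 (ltW t0) (sqr_ge0 b).
  lra.
have h := le_trans (Ege t t1) (Ele t t1); split; first exact: bnd h.
by apply: (bnd _ (f t)); rewrite addrC.
Qed.

End bessel.

(** * Closure properties of smooth functions, in several variables and in one *)

Section Ck_theory.
Context {R : realType} {d : nat}.
Implicit Types (f g : 'rV[R]_d -> R).

Lemma CkS n f : Ck setT n.+1 f -> Ck setT n f.
Proof.
elim: n f => [|n ih] f [cf H]; first by split.
by split => // i; have [dfi Hi] := H i; split => //; exact: ih.
Qed.

Lemma Ck_continuous n f : Ck setT n f -> continuous f.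
Proof. by case: n => [|n] [cf _] x; exact: cf. Qed.

Lemma Ck_cst n (c : R) : Ck setT n (fun _ : 'rV[R]_d => c).
Proof.
elim: n c => [|n ih] c; split => //.
- by move=> x _; exact: cst_continuous.
- by move=> x _; exact: cst_continuous.
move=> i; split => [x _|]; first exact: derivable_cst.
suff -> : 'D_(Defs.basis i) (fun _ : 'rV[R]_d => c) = (fun=> 0) by exact: ih.
by apply/funext => x; exact: derive_cst.
Qed.

Lemma CkSP n f (g : 'I_d -> 'rV[R]_d -> R) :
  continuous f -> (forall i x, is_derive x (Defs.basis i) f (g i x)) ->
  (forall i, Ck setT n (g i)) -> Ck setT n.+1 f.
Proof.
move=> cf dfg Cg; split => [x _|i]; first exact: cf.
split => [x _|]; first by have [] := dfg i x.
suff -> : 'D_(Defs.basis i) f = g i by exact: Cg.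
by apply/funext => x; have [_] := dfg i x.
Qed.

Lemma CkS_derive n f i x : Ck setT n.+1 f -> is_derive x (Defs.basis i) f ('D_(Defs.basis i) f x).
Proof. by move=> [_ /(_ i)[h _]]; exact/derivableP/h. Qed.

Lemma Ck_derive n f i : Ck setT n.+1 f -> Ck setT n (fun x => 'D_(Defs.basis i) f x).
Proof. by move=> [_ /(_ i)[]]. Qed.

Lemma Ck_add n f g : Ck setT n f -> Ck setT n g -> Ck setT n (fun x => f x + g x).
Proof.
elim: n f g => [|n ih] f g Cf Cg.
  split => // x _; apply: continuousD; first exact: (Ck_continuous Cf).
  exact: (Ck_continuous Cg).
apply: (@CkSP _ _ (fun i x => 'D_(Defs.basis i) f x + 'D_(Defs.basis i) g x)).
- move=> x; apply: continuousD; first exact: (Ck_continuous Cf).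
  exact: (Ck_continuous Cg).
- by move=> i x; apply: is_derive_fadd; apply: CkS_derive; eassumption.
- by move=> i; apply: ih; apply: Ck_derive.
Qed.

Lemma Ck_mul n f g : Ck setT n f -> Ck setT n g -> Ck setT n (fun x => f x * g x).
Proof.
elim: n f g => [|n ih] f g Cf Cg.
  split => // x _; apply: continuousM; first exact: (Ck_continuous Cf).
  exact: (Ck_continuous Cg).
apply: (@CkSP _ _ (fun i x => 'D_(Defs.basis i) f x * g x + f x * 'D_(Defs.basis i) g x)).
- move=> x; apply: continuousM; first exact: (Ck_continuous Cf).
  exact: (Ck_continuous Cg).
- by move=> i x; apply: is_derive_fmul; apply: CkS_derive; eassumption.
- by move=> i; apply: Ck_add; apply: ih; do ?[exact: Ck_derive | exact: CkS].
Qed.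

Lemma continuous_coord (i : 'I_d) : continuous (fun x : 'rV[R]_d => x 0 i).
Proof. exact: coord_continuous. Qed.

Lemma is_derive_coord (i j : 'I_d) (x : 'rV[R]_d) :
  is_derive x (Defs.basis j) (fun y => y 0 i) (j == i)%:R.
Proof.
apply/is_derive_line.
rewrite (_ : (fun t : R => _) = (fun t => (j == i)%:R * t + x 0 i)); last first.
  by apply/funext => t; rewrite !mxE eqxx/= mulrC eq_sym.
apply: (is_derive_eqr (is_derive_fadd (is_derive_fscale _ (is_derive1_id _))
  (is_derive_fcst _ _ _))).
by rewrite mulr1 addr0.
Qed.

Lemma Ck_coord n (i : 'I_d) : Ck setT n (fun x : 'rV[R]_d => x 0 i).
Proof.
case: n => [|n]; first by split => // x _; exact: continuous_coord.
apply: (@CkSP _ _ (fun j _ => (j == i)%:R)).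
- exact: continuous_coord.
- by move=> j x; exact: is_derive_coord.
- by move=> j; exact: Ck_cst.
Qed.

Lemma Ck_sum n (I : Type) (r : seq I) (F : I -> 'rV[R]_d -> R) :
  (forall i, Ck setT n (F i)) -> Ck setT n (fun x => \sum_(i <- r) F i x).
Proof.
move=> CF; elim: r => [|i r ih].
  by under eq_fun do rewrite big_nil; exact: Ck_cst.
by under eq_fun do rewrite big_cons; exact: Ck_add.
Qed.

End Ck_theory.

Section smooth1.
Context {R : realType}.
Implicit Types (U : set R) (F G : R -> R).

(** Class C^n on [U] with an existential derivative: explicit formulas for F' that are correct only
    on [U] can then be supplied, without computing ['D_1 F] elsewhere. *)
Fixpoint smooth1 U (n : nat) F : Prop :=
  if n is n'.+1 then exists F' : R -> R,
    (forall t, U t -> is_derive t 1 F (F' t)) /\ smooth1 U n' F'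
  else forall t, U t -> {for t, continuous F}.

Lemma smooth1S U n F : smooth1 U n.+1 F -> smooth1 U n F.
Proof.
elim: n F => [|n ih] F [F' [dF sF]]; first by move=> t /dF/is_derive1_continuous.
by exists F'; split => //; exact: ih.
Qed.

Lemma smooth1_continuous U n F : smooth1 U n F -> forall t, U t -> {for t, continuous F}.
Proof. by elim: n F => [|n ih] F // /smooth1S/ih. Qed.

Lemma smooth1_sub U W n F : W `<=` U -> smooth1 U n F -> smooth1 W n F.
Proof.
move=> WU; elim: n F => [|n ih] F /=; first by move=> h t /WU; exact: h.
by move=> [F' [h1 h2]]; exists F'; split; [move=> t /WU; exact: h1|exact: ih].
Qed.

Lemma smooth1_cst U n (c : R) : smooth1 U n (fun=> c).
Proof.
elim: n c => [|n ih] c /=; first by move=> t _; exact: cst_continuous.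
by exists (fun=> 0); split => // t _; exact: is_derive_fcst.
Qed.

Lemma smooth1_id U n : smooth1 U n (fun t => t).
Proof.
case: n => [|n] /=; first by move=> t _; exact: cvg_id.
by exists (fun=> 1); split; [move=> t _; exact: is_derive1_id|exact: smooth1_cst].
Qed.

Lemma smooth1_add U n F G : smooth1 U n F -> smooth1 U n G ->
  smooth1 U n (fun t => F t + G t).
Proof.
elim: n F G => [|n ih] F G /=.
  by move=> h1 h2 t Ut; apply: continuousD; [exact: h1|exact: h2].
move=> [F' [h1 h2]] [G' [h3 h4]]; exists (fun t => F' t + G' t); split.
  by move=> t Ut; apply: is_derive_fadd; [exact: h1|exact: h3].
exact: ih.
Qed.

Lemma smooth1_mul U n F G : smooth1 U n F -> smooth1 U n G ->
  smooth1 U n (fun t => F t * G t).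
Proof.
elim: n F G => [|n ih] F G.
  by move=> h1 h2 t Ut; apply: continuousM; [exact: h1|exact: h2].
move=> hF hG; have [F' [h1 h2]] := hF; have [G' [h3 h4]] := hG.
exists (fun t => F' t * G t + F t * G' t); split.
  by move=> t Ut; apply: is_derive_fmul; [exact: h1|exact: h3].
by apply: smooth1_add; apply: ih => //; exact: smooth1S.
Qed.

Lemma smooth1_comp U W n F G : (forall t, U t -> W (G t)) ->
  smooth1 W n F -> smooth1 U n G -> smooth1 U n (fun t => F (G t)).
Proof.
move=> UW; elim: n F => [|n ih] F.
  by move=> h1 h2 t Ut; apply: continuous_comp; [exact: h2|exact/h1/UW].
move=> [F' [h1 h2]] hG; have [G' [h3 h4]] := hG.
exists (fun t => F' (G t) * G' t); split.
  move=> t Ut; apply: (@is_derive_comp _ _ F G); first exact: h3.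
  exact/h1/UW.
by apply: smooth1_mul => //; apply: ih => //; exact: smooth1S.
Qed.

Lemma smooth1_inv n : smooth1 [set t | 0 < t] n (fun t => t^-1).
Proof.
elim: n => [|n ih] /=.
  by move=> t t0; apply: inv_continuous; rewrite gt_eqF.
exists (fun t => -1 * (t^-1 * t^-1)); split.
  move=> t /= t0; have tn : t != 0 by rewrite gt_eqF.
  by apply: (is_derive_eqr (is_derive1_inv tn)); rewrite mulN1r -invfM -expr2.
by apply: smooth1_mul; [exact: smooth1_cst|exact: smooth1_mul].
Qed.

Lemma is_derive1_invsqrt (t : R) : 0 < t ->
  is_derive t 1 (fun t => (Num.sqrt t)^-1) (- 2^-1 * (Num.sqrt t) ^- 3).
Proof.
move=> t0; have st0 : Num.sqrt t != 0 by rewrite gt_eqF// sqrtr_gt0.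
have := is_derive_comp (is_derive1_sqrt t0) (is_derive1_inv st0).
move/is_derive_eqr; apply; by field.
Qed.

Lemma smooth1_invsqrt n : smooth1 [set t | 0 < t] n (fun t => (Num.sqrt t)^-1).
Proof.
elim: n => [|n ih].
  by move=> t /= t0; exact: is_derive1_continuous (is_derive1_invsqrt t0).
exists (fun t => - 2^-1 * ((Num.sqrt t)^-1 * ((Num.sqrt t)^-1 * (Num.sqrt t)^-1))).
split; last first.
  by apply: smooth1_mul; [exact: smooth1_cst|do 2 apply: smooth1_mul => //].
move=> t /= t0; apply: (is_derive_eqr (is_derive1_invsqrt t0)).
have st0 : Num.sqrt t != 0 by rewrite gt_eqF// sqrtr_gt0.
by field.
Qed.

Lemma Ck_comp {d : nat} U n F (f : 'rV[R]_d -> R) : (forall x, U (f x)) ->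
  smooth1 U n F -> Ck setT n f -> Ck setT n (fun x => F (f x)).
Proof.
move=> Uf; elim: n F => [|n ih] F.
  move=> sF Cf; split => // x _.
  by apply: continuous_comp; [exact: (Ck_continuous Cf)|exact: sF].
move=> sF Cf; have [F' [dF sF']] := sF.
apply: (@CkSP _ _ _ _ (fun i x => F' (f x) * 'D_(Defs.basis i) f x)).
- move=> x; apply: continuous_comp; first exact: (Ck_continuous Cf).
  exact: (smooth1_continuous sF).
- move=> i x; apply: (@is_derive_comp _ _ F f); last exact: dF.
  exact: CkS_derive Cf.
- move=> i; apply: Ck_mul; first by apply: ih => //; exact: CkS.
  exact: Ck_derive.
Qed.

End smooth1.

(** * Smooth cutoff functions *)

Section cutoff.
Context {R : realType}.
Implicit Types (t a b : R).

Lemma is_derive_quadratic (f : R -> R) (C : R) : 0 < C ->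
  (forall t, `|f t - f 0| <= C * t ^+ 2) -> is_derive (0 : R) 1 f 0.
Proof.
move=> C0 hf.
have h : (fun h : R => h^-1 *: ((f \o shift 0) (h *: (1 : R)) - f 0)) @ 0^' --> (0 : R).
  apply/cvgr0Pnorm_le => e e0; near=> t.
  have t0 : t != 0 by near: t; exact: nbhs_dnbhs_neq.
  rewrite /= /GRing.scale/= mulr1 addr0 normrM normfV ler_pdivrMl ?normr_gt0//.
  apply: le_trans (hf t) _.
  rewrite -[t ^+ 2]ger0_norm ?sqr_ge0// normrX expr2 mulrCA ler_pM2l ?normr_gt0//.
  rewrite mulrC -ler_pdivlMr//; near: t; apply: nbhs_dnbhs.
  apply/nbhs_ballP; exists (e / C); first exact: divr_gt0.
  by move=> t; rewrite -ball_normE /= sub0r normrN => /ltW.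
split; first by apply/cvg_ex; exists 0.
exact: cvg_lim h.
Unshelve. all: by end_near. Qed.

(** The powers t^-n are included because the family t^-n exp(-1/t) is closed under differentiation
    up to linear combinations, so smoothness follows by induction for all n at once. *)
Definition flat (n : nat) t : R := if 0 < t then t^-1 ^+ n * expR (- t^-1) else 0.

Lemma flat_ge0 n t : 0 <= flat n t.
Proof.
rewrite /flat; case: ifP => // t0.
by rewrite mulr_ge0 ?expR_ge0// exprn_ge0// invr_ge0 ltW.
Qed.

Lemma flat_le0 n t : t <= 0 -> flat n t = 0.
Proof. by move=> t0; rewrite /flat ltNge t0. Qed.

(** One term of the exponential series gives t^-(n+2) <= (n+2)! exp(1/t). The resulting quadratic
    bound makes the derivative at 0 vanish. *)
Lemma flat_quadratic n t : flat n t <= n.+2`!%:R * t ^+ 2.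
Proof.
rewrite /flat; case: ifP => [t0|_]; last by rewrite mulr_ge0// sqr_ge0.
have y0 : 0 <= t^-1 by rewrite invr_ge0 ltW.
have h : t^-1 ^+ n.+2 <= n.+2`!%:R * expR t^-1.
  rewrite -ler_pdivrMl ?ltr0n ?fact_gt0// mulrC.
  by apply: le_trans (expR_ge1Dxn n.+1 y0); rewrite lerDr.
rewrite expRN ler_pdivrMr ?expR_gt0//.
apply: (@le_trans _ _ (t^-1 ^+ n.+2 * t ^+ 2)); last first.
  by rewrite [leRHS]mulrAC ler_wpM2r ?sqr_ge0.
rewrite -[n.+2]addn2 exprD -mulrA -exprMn mulVf ?gt_eqF//.
by rewrite expr1n mulr1.
Qed.

Lemma is_derive_flat n t :
  is_derive t 1 (flat n) (flat n.+2 t - n%:R * flat n.+1 t).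
Proof.
have [t0|t0|->] := ltgtP t 0.
- rewrite !flat_le0 ?ltW// mulr0 subr0.
  have h : \near t, cst 0 t = flat n t.
    by near=> s; rewrite flat_le0// ltW//; near: s; exact: lt_nbhsl.
  exact: near_eq_is_derive h (is_derive_fcst _ _ _).
- have tn : t != 0 by rewrite gt_eqF.
  have h : \near t, (fun t => t^-1 ^+ n * expR (- t^-1)) t = flat n t.
    by near=> s; rewrite /flat ifT//; near: s; exact: lt_nbhsr.
  apply: (near_eq_is_derive h).
  have dX : is_derive t 1 (fun t => t^-1 ^+ n) (n%:R * t^-1 ^+ n.-1 * - (t ^- 2)).
    apply: (@is_derive_comp _ _ (fun y => y ^+ n) (fun t => t^-1)).
      exact: is_derive1_inv.
    by split; [exact: exprn_derivable|rewrite exp_derive /GRing.scale/= mulr1].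
  have dE : is_derive t 1 (fun t => expR (- t^-1)) (expR (- t^-1) * (t ^- 2)).
    apply: (is_derive_eqr (is_derive_comp (is_derive_fopp (is_derive1_inv tn))
      (is_derive_expR _))).
    by rewrite opprK.
  apply: (is_derive_eqr (is_derive_fmul dX dE)).
  rewrite /flat t0 -!exprVn; move: (t^-1) (expR _) => y E.
  case: n {h dX} => [|m]; first by rewrite !mul0r expr0; ring.
  by rewrite /= [y ^+ m.+3]exprS [y ^+ m.+2]exprS [y ^+ m.+1]exprS; ring.
- rewrite !flat_le0// mulr0 subr0.
  apply: (@is_derive_quadratic _ n.+2`!%:R); first by rewrite ltr0n fact_gt0.
  by move=> s; rewrite [flat n 0]flat_le0// subr0 ger0_norm ?flat_ge0// flat_quadratic.
Unshelve. all: by end_near. Qed.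

Lemma smooth1_flat m n : smooth1 setT m (flat n).
Proof.
elim: m n => [|m ih] n /=.
  by move=> t _; exact: is_derive1_continuous (is_derive_flat n t).
exists (fun t => flat n.+2 t + (- n%:R) * flat n.+1 t); split.
  by move=> t _; apply: (is_derive_eqr (is_derive_flat n t)); rewrite mulNr.
by apply: smooth1_add => //; apply: smooth1_mul => //; exact: smooth1_cst.
Qed.

Lemma flat_gt0 t : 0 < t -> 0 < flat 0 t.
Proof. by move=> t0; rewrite /flat t0 mul1r expR_gt0. Qed.

(** The quotient p/(p + q), with p positive exactly for t < b and q positive exactly for t > a; as a
    < b, the denominator never vanishes. *)
Lemma smooth_cutoff a b : a < b -> exists chi : R -> R,
  [/\ forall n, smooth1 setT n chi, forall t, 0 <= chi t <= 1,
      forall t, t <= a -> chi t = 1 & forall t, b <= t -> chi t = 0].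
Proof.
move=> ab; pose p t := flat 0 (b + (-1) * t); pose q t := flat 0 (t + (- a)).
have pq t : 0 < p t + q t.
  have [h|h] := ltP t b.
    by rewrite ltr_pwDl ?flat_ge0// flat_gt0//; lra.
  by rewrite ltr_wpDl ?flat_ge0// flat_gt0//; lra.
exists (fun t => p t * (p t + q t)^-1); split.
- move=> n.
  have sp : smooth1 setT n p.
    apply: (@smooth1_comp _ _ setT) (smooth1_flat n 0) _ => //.
    apply: smooth1_add; first exact: smooth1_cst.
    by apply: smooth1_mul; [exact: smooth1_cst|exact: smooth1_id].
  have sq : smooth1 setT n q.
    apply: (@smooth1_comp _ _ setT) (smooth1_flat n 0) _ => //.
    by apply: smooth1_add; [exact: smooth1_id|exact: smooth1_cst].
  apply: smooth1_mul => //.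
  apply: (@smooth1_comp _ _ [set t | 0 < t] _ (fun y => y^-1) (fun t => p t + q t)).
  + by move=> t _; exact: pq.
  + exact: smooth1_inv.
  + exact: smooth1_add.
- move=> t; apply/andP; split.
    by rewrite mulr_ge0 ?flat_ge0// invr_ge0 ltW.
  by rewrite ler_pdivrMr// mul1r lerDl flat_ge0.
- move=> t ta; have qt : q t = 0 by rewrite /q flat_le0//; lra.
  by have := pq t; rewrite qt addr0 => /lt0r_neq0/divff.
- by move=> t bt; rewrite /p flat_le0 ?mul0r//; lra.
Qed.

End cutoff.

(** * Radial functions of the squared distance *)

Section radial.
Context {R : realType} {d : nat}.
Implicit Types (x y : 'rV[R]_d) (F : R -> R).

(** The squared distance is a polynomial, hence smooth even at the centre [y]; a smooth profile
    composed with it is smooth on the whole space. It is unrelated to the exponent [rho] of the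
    theorem. *)
Definition rho y x : R := dot (x - y) (x - y).

Lemma rhoE y x : rho y x = enorm (x - y) ^+ 2.
Proof. by rewrite sqr_enorm. Qed.

Lemma rho_ge0 y x : 0 <= rho y x.
Proof. exact: dot_ge0. Qed.

Lemma sqrt_rho y x : Num.sqrt (rho y x) = enorm (x - y).
Proof. by []. Qed.

Lemma Ck_rho y n : Ck setT n (rho y).
Proof.
rewrite /rho /dot; apply: Ck_sum => i; rewrite (_ : (fun x => _) =
  fun x : 'rV[R]_d => (x 0 i + (- y 0 i)) * (x 0 i + (- y 0 i))); last first.
  by apply/funext => x; rewrite !mxE.
by apply: Ck_mul; apply: Ck_add; do ?[exact: Ck_coord|exact: Ck_cst].
Qed.

Lemma continuous_rho y : continuous (rho y).
Proof. exact: Ck_continuous (Ck_rho y 0). Qed.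

Lemma is_derive_rho y x (i : 'I_d) :
  is_derive x (Defs.basis i) (rho y) (2 * (x - y) 0 i).
Proof.
apply/is_derive_line.
rewrite (_ : (fun t : R => _) = fun t => t * t + (2 * (x - y) 0 i) * t + rho y x).
  apply: (is_derive_eqr (is_derive_fadd (is_derive_fadd
    (is_derive_fmul (is_derive1_id _) (is_derive1_id _))
    (is_derive_fscale _ (is_derive1_id _))) (is_derive_fcst _ _ _))).
  by ring.
have e (z : 'rV[R]_d) : dot (Defs.basis i) z = z 0 i.
  rewrite /dot (bigD1 i)//= big1 ?addr0; last first.
    by move=> j ji; rewrite mxE eqxx (negbTE ji) mul0r.
  by rewrite mxE !eqxx mul1r.
apply/funext => t; rewrite /rho -addrA !(dotDl _ (x - y), dotDr _ (x - y)).
rewrite !(dotZl, dotZr) (dotC (x - y) (Defs.basis i)) !e.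
have -> : Defs.basis i 0 i = 1 :> R by rewrite mxE !eqxx.
by ring.
Qed.

Section radial_derivatives.
Variables (F F1 F2 : R -> R) (e : R).
Hypothesis e0 : 0 < e.
Hypothesis dF : forall t, - e < t -> is_derive t 1 F (F1 t).
Hypothesis dF1 : forall t, - e < t -> is_derive t 1 F1 (F2 t).

Let rho_gt y x : - e < rho y x.
Proof. by rewrite (lt_le_trans _ (rho_ge0 y x))// oppr_lt0. Qed.

Lemma radial_derive y x (i : 'I_d) : is_derive x (Defs.basis i) (fun x => F (rho y x))
  (F1 (rho y x) * (2 * (x - y) 0 i)).
Proof. exact: is_derive_comp (is_derive_rho y x i) (dF (rho_gt y x)). Qed.

Lemma radial_laplacian y x : laplacian (fun x => F (rho y x)) x =
  4 * rho y x * F2 (rho y x) + 2 * d%:R * F1 (rho y x).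
Proof.
rewrite /laplacian.
have e1 (i : 'I_d) : 'D_(Defs.basis i) (fun x => F (rho y x)) =
    fun x => F1 (rho y x) * (2 * (x - y) 0 i).
  by apply/funext => z; have [_] := radial_derive y z i.
rewrite (eq_bigr (fun i => 4 * F2 (rho y x) * ((x - y) 0 i * (x - y) 0 i)
    + 2 * F1 (rho y x))); last first.
  move=> i _; rewrite e1.
  have h : is_derive x (Defs.basis i) (fun x => 2 * (x - y) 0 i) 2.
    rewrite (_ : (fun x : 'rV[R]_d => _) = fun x => 2 * (x 0 i - y 0 i)); last first.
      by apply/funext => z; rewrite !mxE.
    apply: (is_derive_eqr (is_derive_fscale 2 (is_derive_fsub (is_derive_coord i i x)
      (is_derive_fcst _ _ _)))).
    by rewrite eqxx subr0 mulr1.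
  have := is_derive_fmul (is_derive_comp (is_derive_rho y x i) (dF1 (rho_gt y x))) h.
  move=> [_ ->] /=; ring.
rewrite big_split/= -mulr_sumr -/(dot (x - y) (x - y)) -/(rho y x).
by rewrite sumr_const card_ord -mulr_natr; ring.
Qed.

Lemma radial_test_function y (r : R) :
  (forall n, smooth1 [set t | - e < t] n F) -> 0 <= r ->
  (forall t, r ^+ 2 <= t -> F t = 0) -> test_function (fun x => F (rho y x)).
Proof.
move=> sF r0 F0; split.
  move=> n; apply: Ck_comp (sF n) (Ck_rho y n).
  by move=> x; exact: rho_gt.
exists (enorm y + r) => x hx; apply: F0; rewrite rhoE ler_sqr ?nnegrE ?enorm_ge0//.
by have := enormD (x - y) y; rewrite subrK; lra.
Qed.

End radial_derivatives.

End radial.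

(** * Regularised and truncated fundamental solutions *)

Section green_profiles.
Context {R : realType}.
Implicit Types (k s t : R).

(* With sigma = |x|^2 + eps^2, the function f(sigma) satisfies
   (Laplace + k^2) f(sigma) = kappa(sigma) - 4 eps^2 f2(sigma): a bounded part
   minus an approximate identity. *)
Definition green_profile (d : nat) k (f f1 f2 kappa : R -> R) : Prop :=
  [/\ forall t, 0 < t -> is_derive t 1 f (f1 t) /\ is_derive t 1 f1 (f2 t),
      forall n, smooth1 [set t | 0 < t] n f2,
      forall t, 0 < t -> 4 * t * f2 t + 2 * d%:R * f1 t + k ^+ 2 * f t = kappa t,
      (forall s t, 0 < s -> s <= t -> 0 <= f2 t <= f2 s) /\
      (exists2 c : R, 0 < c & forall e, 0 < e ->
         c / e ^+ d <= 4 * e ^+ 2 * f2 (2 * e ^+ 2)) &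
      forall S, exists M : R, forall s t, 0 < s <= S -> 0 < t <= S ->
        `|kappa (s ^+ 2)| <= M /\ `|kappa (s ^+ 2) - kappa (t ^+ 2)| <= M * `|s - t| ].

(** In the variable t = r^2, f consists of the first two terms of - ln t J0(k r), namely - ln t (1 -
    k^2 t/4). The leading term is harmonic away from 0, and the second cancels the unbounded part -
    k^2 ln t of what remains. *)
Lemma green_profile2 k : exists f f1 f2 kappa, green_profile 2 k f f1 f2 kappa.
Proof.
pose f t : R := k ^+ 2 / 4 * (t * ln t) - ln t.
pose f1 t : R := k ^+ 2 / 4 * (ln t + 1) - t^-1.
pose f2 t : R := k ^+ 2 / 4 * t^-1 + t^-1 * t^-1.
pose kappa t : R := 2 * k ^+ 2 + k ^+ 4 / 4 * (t * ln t).
exists f, f1, f2, kappa; split.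
- move=> t t0; have tn : t != 0 by rewrite gt_eqF.
  split.
    apply: (is_derive_eqr (is_derive_fsub (is_derive_fscale _
      (is_derive_fmul (is_derive1_id t) (is_derive1_ln t0))) (is_derive1_ln t0))).
    by rewrite /f1 divff// mul1r.
  apply: (is_derive_eqr (is_derive_fsub (is_derive_fscale _
    (is_derive_fadd (is_derive1_ln t0) (is_derive_fcst _ _ _))) (is_derive1_inv tn))).
  by rewrite /f2 addr0 opprK -exprVn expr2.
- move=> n; apply: smooth1_add; apply: smooth1_mul;
    do ?[exact: smooth1_inv|exact: smooth1_cst].
- by move=> t t0; rewrite /f /f1 /f2 /kappa; field; rewrite gt_eqF.
- split; last first.
    exists 1 => // e e0; have en : e != 0 by rewrite gt_eqF.
    have h : 0 <= k ^+ 2 / 2 by rewrite divr_ge0 ?sqr_ge0.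
    have -> : 4 * e ^+ 2 * f2 (2 * e ^+ 2) = k ^+ 2 / 2 + 1 / e ^+ 2.
      by rewrite /f2; field.
    by rewrite lerDr.
  move=> s t s0 st; have t0 := lt_le_trans s0 st.
  have i0 : 0 <= t^-1 by rewrite invr_ge0 ltW.
  have j0 : 0 <= s^-1 by rewrite invr_ge0 ltW.
  have ij : t^-1 <= s^-1 by rewrite lef_pV2.
  have k0 : 0 <= k ^+ 2 / 4 by rewrite divr_ge0 ?sqr_ge0.
  apply/andP; split; first by rewrite addr_ge0// mulr_ge0.
  by rewrite lerD// ?ler_wpM2l// ler_pM.
move=> S.
(* For s >= 1 use ln s <= s; for s < 1 use - ln s <= 1/s. *)
have aux s : 0 < s <= S -> `|s * ln s| <= 1 + S ^+ 2.
  move=> /andP[s0 sS]; have S2 := sqr_ge0 S; have [s1|s1] := leP 1 s.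
    have l0 := ln_ge0 s1.
    rewrite ger0_norm; last by apply: mulr_ge0 => //; exact: ltW.
    have lS : ln s <= S by apply: le_trans (ltW (ln_sublinear s0)) sS.
    have : s * ln s <= S * S by apply: ler_pM => //; exact: ltW.
    by rewrite -expr2; lra.
  have l0 : ln s <= 0 by apply: ln_le0; exact: ltW.
  have := ln_sublinear (_ : 0 < s^-1); rewrite invr_gt0 => /(_ s0).
  rewrite lnV ?posrE// => h; rewrite normrM gtr0_norm// ler0_norm//.
  have : s * - ln s <= s * s^-1 by rewrite ler_pM2l//; exact: ltW.
  by rewrite divff ?gt_eqF//; lra.
(* [M1] bounds 2 s ln s + s, the derivative of s^2 ln s, on ]0, S]; up to constants, this is the
   only varying term of kappa(s^2). *)
pose M1 := 2 * (1 + S ^+ 2) + `|S|.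
pose M := 2 * k ^+ 2 + k ^+ 4 / 2 * (M1 + `|S| * M1).
have k2 := sqr_ge0 k.
have k4 : 0 <= k ^+ 4 by rewrite exprn_even_ge0.
have M10 : 0 <= M1 by rewrite addr_ge0// mulr_ge0// addr_ge0// sqr_ge0.
have SM : 0 <= `|S| * M1 by rewrite mulr_ge0.
have ln2 s : 0 < s -> ln (s ^+ 2) = 2 * ln s.
  by move=> s0; rewrite lnXn// mulr2n; lra.
have S20 := sqr_ge0 S; have S0 := normr_ge0 S.
have ke s : 0 < s -> kappa (s ^+ 2) = 2 * k ^+ 2 + k ^+ 4 / 2 * (s * (s * ln s)).
  by move=> s0; rewrite /kappa ln2//; field.
exists M => s t sS tS.
have /andP[s0 sS'] := sS; have /andP[t0 tS'] := tS.
split.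
  rewrite ke//; apply: le_trans (ler_normD _ _) _.
  rewrite ger0_norm; last by lra.
  rewrite lerD2l normrM ger0_norm ?divr_ge0//; apply: ler_wpM2l; first by lra.
  rewrite normrM (gtr0_norm s0).
  apply: (@le_trans _ _ (`|S| * (1 + S ^+ 2))).
    by apply: ler_pM => //; [exact: ltW|exact: le_trans (ler_norm _)|exact: aux].
  have : `|S| * (1 + S ^+ 2) <= `|S| * M1 by rewrite ler_wpM2l// /M1; lra.
  lra.
rewrite !ke// opprD addrACA subrr add0r -mulrBr normrM ger0_norm ?divr_ge0//.
apply: (@le_trans _ _ (k ^+ 4 / 2 * (M1 * `|s - t|))); last first.
  rewrite mulrA; apply: ler_wpM2r => //; rewrite /M [X in _ <= _ + X]mulrDr.
  have : 0 <= k ^+ 4 / 2 * (`|S| * M1) by rewrite mulr_ge0// divr_ge0.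
  lra.
rewrite ler_wpM2l ?divr_ge0//.
apply: (@lipschitz_of_derive _ (fun s => s * (s * ln s))
  (fun s => 2 * (s * ln s) + s)) => // u hu.
  have u0 : 0 < u.
    by case/andP: hu => + _; apply: lt_le_trans; rewrite lt_min s0.
  apply: (is_derive_eqr (is_derive_fmul (is_derive1_id u)
    (is_derive_fmul (is_derive1_id u) (is_derive1_ln u0)))).
  by rewrite divff ?gt_eqF//; ring.
have uS : 0 < u <= S.
  case/andP: hu => h1 h2; apply/andP; split.
    by apply: lt_le_trans h1; rewrite lt_min s0.
  by apply: le_trans h2 _; rewrite ge_max sS'.
apply: le_trans (ler_normD _ _) _; rewrite normrM ger0_norm// /M1.
apply: lerD; first by rewrite ler_pM2l// aux.
by case/andP: uS => u0 uS; rewrite gtr0_norm// (le_trans uS)// ler_norm.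
Qed.

(** With r = sqrt t, f = 1/r - k^2 r/2 consists of the first two terms of cos(k r)/r, and the
    remainder kappa is - k^4 r/2. *)
Lemma green_profile3 k : exists f f1 f2 kappa, green_profile 3 k f f1 f2 kappa.
Proof.
pose u t : R := (Num.sqrt t)^-1.
pose f t := u t - k ^+ 2 / 2 * (t * u t).
pose f1 t := - 2^-1 * (u t) ^+ 3 - k ^+ 2 / 4 * u t.
pose f2 t := 3 / 4 * (u t) ^+ 5 + k ^+ 2 / 8 * (u t) ^+ 3.
pose kappa t := - (k ^+ 4 / 2) * (t * u t).
have u2 t : 0 < t -> t * (u t * u t) = 1.
  move=> t0; rewrite /u -invfM -expr2 sqr_sqrtr ?ltW//.
  by rewrite divff// gt_eqF.
have du t : 0 < t -> is_derive t 1 u (- 2^-1 * u t ^+ 3).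
  by move=> t0; apply: (is_derive_eqr (is_derive1_invsqrt t0)); rewrite /u exprVn.
have dX n t : 0 < t -> is_derive t 1 (fun t => u t ^+ n.+1)
    (n.+1%:R * u t ^+ n * (- 2^-1 * u t ^+ 3)).
  move=> t0; apply: (@is_derive_comp _ _ (fun y => y ^+ n.+1) u) (du t t0) _.
  by split; [exact: exprn_derivable|rewrite exp_derive /GRing.scale/= mulr1].
have u0 t : 0 <= u t by rewrite invr_ge0 sqrtr_ge0.
have k2 : 0 <= k ^+ 2 / 8 by rewrite divr_ge0 ?sqr_ge0.
exists f, f1, f2, kappa; split.
- move=> t t0; split.
    apply: (is_derive_eqr (is_derive_fsub (du t t0) (is_derive_fscale _
      (is_derive_fmul (is_derive1_id t) (du t t0))))).
    have -> : t * (- 2^-1 * u t ^+ 3) = - 2^-1 * u t * (t * (u t * u t)) by ring.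
    by rewrite u2// /f1; field.
  apply: (is_derive_eqr (is_derive_fsub (is_derive_fscale _ (dX 2%N t t0))
    (is_derive_fscale _ (du t t0)))).
  by rewrite /f2; field.
- move=> n; have su := @smooth1_invsqrt R n.
  have sX m : smooth1 [set t | 0 < t] n (fun t => u t ^+ m).
    elim: m => [|m ih].
      rewrite (_ : (fun t => _) = fun=> 1); first exact: smooth1_cst.
      by apply/funext => t; rewrite expr0.
    rewrite (_ : (fun t => _) = fun t => u t * u t ^+ m); first exact: smooth1_mul.
    by apply/funext => t; rewrite exprS.
  by apply: smooth1_add; apply: smooth1_mul; do ?[exact: sX|exact: smooth1_cst].
- move=> t t0; rewrite /f /f1 /f2 /kappa.
  have h := u2 t t0; move: (u t) h => v h.
  have -> : 4 * t * (3 / 4 * v ^+ 5 + k ^+ 2 / 8 * v ^+ 3) =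
    (t * (v * v)) * (3 * v ^+ 3 + k ^+ 2 / 2 * v) by field.
  by rewrite h; field.
- split; last first.
    (* Since sqrt(2 e^2) <= 2 e, the leading term of f2 alone gives 4 e^2 (3/4) (2 e)^-5 = (3/32)
       e^-3. *)
    exists (3 / 32) => [|e e0]; first by lra.
    have en : e != 0 by rewrite gt_eqF.
    have ue : (2 * e)^-1 <= u (2 * e ^+ 2).
      rewrite lef_pV2 ?posrE ?sqrtr_gt0 ?mulr_gt0 ?exprn_gt0//.
      have -> : 2 * e = Num.sqrt ((2 * e) ^+ 2).
        by rewrite sqrtr_sqr gtr0_norm// mulr_gt0.
      by rewrite ler_wsqrtr//; have := sqr_ge0 e; lra.
    have i0 : 0 <= (2 * e)^-1 by rewrite invr_ge0 mulr_ge0 ?ltW.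
    have h : (2 * e)^-1 ^+ 5 <= u (2 * e ^+ 2) ^+ 5.
      by rewrite lerXn2r ?nnegrE// (le_trans i0).
    apply: (@le_trans _ _ (4 * e ^+ 2 * (3 / 4 * (2 * e)^-1 ^+ 5))).
      by rewrite le_eqVlt; apply/orP; left; apply/eqP; field.
    rewrite ler_pM2l ?mulr_gt0 ?exprn_gt0// /f2.
    apply: (@le_trans _ _ (3 / 4 * u (2 * e ^+ 2) ^+ 5)); first by rewrite ler_pM2l//; lra.
    by rewrite lerDl mulr_ge0// exprn_ge0.
  move=> s t s0 st; have t0 := lt_le_trans s0 st.
  have ust : u t <= u s by rewrite lef_pV2 ?posrE ?sqrtr_gt0// ler_wsqrtr.
  apply/andP; split.
    by rewrite addr_ge0// mulr_ge0 ?exprn_ge0//; lra.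
  rewrite lerD// ler_wpM2l//; do ?lra; rewrite lerXn2r ?nnegrE//.
move=> S; pose M := k ^+ 4 / 2 * (1 + `|S|).
have k4 : 0 <= k ^+ 4 / 2 by rewrite divr_ge0// exprn_even_ge0.
have ke s : 0 < s -> kappa (s ^+ 2) = - (k ^+ 4 / 2) * s.
  move=> s0; rewrite /kappa /u sqrtr_sqr gtr0_norm// expr2 mulfK//.
  by rewrite gt_eqF.
exists M => s t /andP[s0 sS] /andP[t0 tS]; rewrite !ke//.
rewrite -mulrBr !normrM normrN (ger0_norm k4) (gtr0_norm s0) /M.
split.
  apply: ler_wpM2l => //; apply: le_trans sS _.
  by apply: le_trans (ler_norm S) _; rewrite lerDr.
by rewrite -mulrA ler_wpM2l// ler_peMl// lerDl.
Qed.

End green_profiles.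

Section bounded_lipschitz.
Context {R : realType} {I : Type}.
Implicit Types (P : set I) (A : set R) (g h : I -> R -> R).

(** The index [i] will be the regularisation parameter e: the point of the definition is that one
    constant serves all e. *)
Definition bounded_lipschitz P A g := exists2 M : R, 0 <= M & forall i r r', P i -> A r -> A r' ->
  `|g i r| <= M /\ `|g i r - g i r'| <= M * `|r - r'|.

Lemma bounded_lipschitz_add P A g h : bounded_lipschitz P A g -> bounded_lipschitz P A h ->
  bounded_lipschitz P A (fun i r => g i r + h i r).
Proof.
move=> [M M0 HM] [N N0 HN]; exists (M + N); first exact: addr_ge0.
move=> i r r' Pi Ar Ar'; have [h1 h2] := HM i r r' Pi Ar Ar'.
have [h3 h4] := HN i r r' Pi Ar Ar'; split.
  by apply: le_trans (ler_normD _ _) _; apply: lerD.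
rewrite opprD addrACA mulrDl; apply: le_trans (ler_normD _ _) _; exact: lerD.
Qed.

(** Made for a derivative of the cutoff (g, vanishing off B) times a profile that is singular at the
    centre (h, controlled on B only). If x is in B and y is not, then g x h x - g y h y = (g x - g
    y) h x, so the values of h off B never enter. *)
Lemma bounded_lipschitz_mul_support P A B g h : B `<=` A -> bounded_lipschitz P A g ->
  (forall i r, P i -> A r -> ~ B r -> g i r = 0) ->
  bounded_lipschitz P B h -> bounded_lipschitz P A (fun i r => g i r * h i r).
Proof.
move=> BA [M M0 HM] gB [N N0 HN]; exists (M * N + M * N).
  by rewrite addr_ge0// mulr_ge0.
move=> i r r' Pi Ar Ar'.
have MN : 0 <= M * N by rewrite mulr_ge0.
have d0 : 0 <= M * N * `|r - r'| by rewrite mulr_ge0.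
have sup x y : A x -> A y -> B x -> ~ B y ->
    `|g i x * h i x - g i y * h i y| <= M * N * `|x - y|.
  move=> Ax Ay Bx By; rewrite (gB i y)// mul0r subr0 normrM.
  have [_ h1] := HM i x y Pi Ax Ay; rewrite (gB i y)// subr0 in h1.
  have [h2 _] := HN i x x Pi Bx Bx.
  by apply: le_trans (ler_pM _ _ h1 h2) _ => //; rewrite mulrAC.
have [Br|Br] := pselect (B r); last first.
  rewrite (gB i r)// mul0r normr0; split; first exact: addr_ge0.
  have [Br'|Br'] := pselect (B r'); last first.
    by rewrite (gB i r')// mul0r subr0 normr0 mulr_ge0// addr_ge0.
  have := sup r' r Ar' Ar Br' Br; rewrite (gB i r Pi Ar Br) mul0r.
  by rewrite distrC [`|r' - r|]distrC mulrDl; lra.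
split.
  have [h1 _] := HM i r r Pi Ar Ar; have [h2 _] := HN i r r Pi Br Br.
  by rewrite normrM; apply: le_trans (ler_pM _ _ h1 h2) _ => //; lra.
have [Br'|Br'] := pselect (B r'); last first.
  by apply: le_trans (sup r r' Ar Ar' Br Br') _; rewrite mulrDl; lra.
have [h1 h2] := HM i r r' Pi Ar Ar'; have [h3 h4] := HN i r r' Pi Br Br'.
have [h5 _] := HN i r' r' Pi Br' Br'.
have -> : g i r * h i r - g i r' * h i r' =
    g i r * (h i r - h i r') + (g i r - g i r') * h i r' by ring.
apply: le_trans (ler_normD _ _) _; rewrite !normrM mulrDl; apply: lerD.
  by rewrite -mulrA; apply: ler_pM.
by apply: le_trans (ler_pM _ _ h2 h5) _ => //; rewrite mulrAC.
Qed.

Lemma bounded_lipschitz_mul P A g h : bounded_lipschitz P A g -> bounded_lipschitz P A h ->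
  bounded_lipschitz P A (fun i r => g i r * h i r).
Proof. by move=> hg hh; apply: (@bounded_lipschitz_mul_support P A A). Qed.

Lemma bounded_lipschitz_sub P A B g : B `<=` A ->
  bounded_lipschitz P A g -> bounded_lipschitz P B g.
Proof.
by move=> BA [M M0 H]; exists M => // i r r' Pi /BA Ar /BA Ar'; exact: H.
Qed.

Lemma bounded_lipschitz_eq P A g h : (forall i r, P i -> A r -> g i r = h i r) ->
  bounded_lipschitz P A g -> bounded_lipschitz P A h.
Proof.
move=> gh [M M0 H]; exists M => // i r r' Pi Ar Ar'.
by rewrite -!gh//; exact: H.
Qed.

Lemma continuous_bounded_segment (F : R -> R) (a b : R) :
  (forall t, a <= t <= b -> {for t, continuous F}) ->
  exists2 M : R, 0 <= M & forall t, a <= t <= b -> `|F t| <= M.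
Proof.
move=> cF; have [ab|ba] := leP a b; last first.
  exists 0 => // t /andP[h1 h2].
  by have := le_trans h1 h2; rewrite leNgt ba.
have cN : {within `[a, b], continuous (fun t => `|F t|)}.
  apply: (@continuous_in_subspaceT _ _ `[a, b]%classic) => t.
  rewrite inE/= in_itv/= => tab; apply: continuous_comp; first exact: cF.
  exact: norm_continuous.
have [c _ H] := EVT_max ab cN.
by exists `|F c| => // t tab; apply: H; rewrite in_itv.
Qed.

Lemma bounded_lipschitz_C1 P (a b : R) (s : I -> R -> R) (F F' : R -> R) :
  (forall t, a <= t <= b -> is_derive t 1 F (F' t)) ->
  (forall t, a <= t <= b -> {for t, continuous F'}) ->
  forall A, bounded_lipschitz P A s -> (forall i r, P i -> A r -> a <= s i r <= b) ->
  bounded_lipschitz P A (fun i r => F (s i r)).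
Proof.
move=> dF cF' A [M M0 HM] sab.
have [N N0 HN] : exists2 M : R, 0 <= M & forall t, a <= t <= b -> `|F t| <= M.
  apply: continuous_bounded_segment => t /dF; exact: is_derive1_continuous.
have [N' N'0 HN'] := continuous_bounded_segment cF'.
have NM : 0 <= N' * M by rewrite mulr_ge0.
exists (N + N' * M); first exact: addr_ge0.
move=> i r r' Pi Ar Ar'; split.
  by apply: le_trans (HN _ (sab i r Pi Ar)) _; rewrite lerDl.
have [_ h] := HM i r r' Pi Ar Ar'.
have mem t : Num.min (s i r) (s i r') <= t <= Num.max (s i r) (s i r') -> a <= t <= b.
  have /andP[h1 h2] := sab i r Pi Ar; have /andP[h3 h4] := sab i r' Pi Ar'.
  by rewrite ge_min le_max => /andP[/orP[h5|h5] /orP[h6|h6]]; apply/andP; split; lra.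
apply: (@le_trans _ _ (N' * `|s i r - s i r'|)).
  apply: (@lipschitz_of_derive _ F F') => // t /mem tab; first exact: dF.
  exact: HN'.
apply: le_trans (ler_wpM2l N'0 h) _; rewrite mulrDl mulrA.
by rewrite lerDr mulr_ge0.
Qed.

Lemma bounded_lipschitz_shifted_sqr P (e : I -> R) (S : R) : (forall i, P i -> 0 <= e i <= 1) ->
  0 <= S -> bounded_lipschitz P [set r | 0 <= r <= S] (fun i r => r ^+ 2 + e i ^+ 2).
Proof.
move=> e01 S0; exists (S ^+ 2 + 1 + 2 * S).
  by rewrite addr_ge0 ?mulr_ge0// addr_ge0// sqr_ge0.
move=> i r r' /e01/andP[e0 e1] /= /andP[r0 rS] /andP[r'0 r'S]; split.
  rewrite ger0_norm; last by rewrite addr_ge0 ?sqr_ge0.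
  have h1 : r ^+ 2 <= S ^+ 2 by rewrite lerXn2r ?nnegrE//; exact: le_trans rS.
  have h2 : e i ^+ 2 <= 1 by rewrite expr_le1.
  lra.
rewrite opprD addrACA subrr addr0 subr_sqr normrM mulrC; apply: ler_wpM2r => //.
rewrite ger0_norm ?addr_ge0//.
have := sqr_ge0 S; lra.
Qed.

End bounded_lipschitz.

Section helmholtz_kernel.
Context {R : realType}.

Lemma sqrt_shift_lipschitz (e r r' : R) : 0 < e -> 0 <= r -> 0 <= r' ->
  `|Num.sqrt (r ^+ 2 + e ^+ 2) - Num.sqrt (r' ^+ 2 + e ^+ 2)| <= `|r - r'|.
Proof.
move=> e0 r0 r'0; set s := Num.sqrt _; set s' := Num.sqrt _.
have e2 : 0 < e ^+ 2 by rewrite exprn_gt0.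
have h (x : R) : 0 <= x -> x <= Num.sqrt (x ^+ 2 + e ^+ 2).
  move=> x0; rewrite -[leLHS](ger0_norm x0) -sqrtr_sqr ler_wsqrtr//.
  by rewrite lerDl ltW.
have hs : 0 < s by rewrite sqrtr_gt0 ltr_wpDl ?sqr_ge0.
have hs' : 0 <= s' by rewrite sqrtr_ge0.
have ss : 0 < s + s' by rewrite ltr_pwDl.
rewrite -(ler_pM2r ss) -{1}(gtr0_norm ss) -normrM -subr_sqr !sqr_sqrtr; last 2 first.
- by rewrite addr_ge0 ?sqr_ge0.
- by rewrite addr_ge0 ?sqr_ge0.
rewrite opprD addrACA subrr addr0 subr_sqr normrM (ger0_norm (addr_ge0 r0 r'0)).
by apply: ler_wpM2l => //; apply: lerD; apply: h.
Qed.

Lemma is_derive_locally_cst (F F1 : R -> R) (c : R) (U : set R) : open U ->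
  (forall t : R, is_derive t 1 F (F1 t)) -> (forall t, U t -> F t = c) ->
  forall t, U t -> F1 t = 0.
Proof.
move=> oU dF FU t Ut.
have h : \near t, F t = cst c t.
  by near=> s; apply: FU; near: s; exact: open_nbhs_nbhs.
exact: is_derive_unique (near_eq_is_derive h (dF t)) (is_derive_fcst _ _ _).
Unshelve. all: by end_near. Qed.

Lemma bounded_lipschitz_smooth_sqr {I : Type} (P : set I) (S : R) (F : R -> R) : 0 <= S ->
  smooth1 setT 1 F -> bounded_lipschitz P [set r | 0 <= r <= S] (fun _ r => F (r ^+ 2)).
Proof.
move=> S0 [F' [dF cF']].
apply: (@bounded_lipschitz_C1 _ _ P 0 (S ^+ 2) (fun _ r => r ^+ 2) F F').
- by move=> t _; exact: dF.
- by move=> t _; exact: cF'.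
- have := @bounded_lipschitz_shifted_sqr R I P (fun=> 0) S _ S0.
  move=> h; apply: bounded_lipschitz_eq (h _) => [i r _ _|i _].
    by rewrite expr0n/= addr0.
  by rewrite lexx ler01.
- move=> i r _ /andP[r0 rS]; rewrite sqr_ge0/= lerXn2r ?nnegrE//.
Qed.

(** The test function is chi(t) f(t + e^2) with t the squared distance. By the product rule and the
    equation of the profile, the Helmholtz operator gives chi kappa plus terms with derivatives of
    chi, collected in K, minus delta = 4 e^2 chi f2(t + e^2). Derivatives of chi live away from the
    centre, so K is controlled uniformly in e. As f2 is nonincreasing, delta is of size at least
    e^-d on the ball of radius e and O(e^2) away from the centre. *)
Lemma helmholtz_kernel (d : nat) (k b : R) : d = 2%N \/ d = 3%N -> 0 < b ->
  exists c M : R, exists Ceta : R -> R, [/\ 0 < c, 0 <= M &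
  forall e, 0 < e -> e ^+ 2 <= b / 2 -> e <= 1 -> exists F delta K : R -> R,
  [/\ forall y : 'rV[R]_d, test_function (fun x => F (rho y x)) /\
        forall x, laplacian (fun x => F (rho y x)) x + k ^+ 2 * F (rho y x) =
          K (rho y x) - delta (rho y x),
      forall t, 0 <= t -> {for t, continuous delta} /\ {for t, continuous K},
      forall t, b <= t -> [/\ F t = 0, delta t = 0 & K t = 0],
      [/\ forall t, 0 <= t -> 0 <= delta t,
          forall t, 0 <= t <= e ^+ 2 -> c / e ^+ d <= delta t &
          forall eta t, 0 < eta -> eta ^+ 2 <= t -> delta t <= Ceta eta * e ^+ 2] &
      forall r r', 0 <= r -> 0 <= r' ->
        `|K (r ^+ 2)| <= M /\ `|K (r ^+ 2) - K (r' ^+ 2)| <= M * `|r - r'| ]].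
Proof.
move=> hd b0.
have [f [f1 [f2 [kappa [dff sf2 fode [f2mono [c c0 hc]] hkappa]]]]] :
    exists f f1 f2 kappa, green_profile d k f f1 f2 kappa.
  by case: hd => ->; [exact: green_profile2|exact: green_profile3].
(* The cutoff is 1 up to b/2, which covers t <= e^2, and already 0 from 3b/4 on: its derivatives
   then vanish on an open set containing every t >= b. *)
have [|chi [schi chi01 chi1 chi0]] := @smooth_cutoff R (b / 2) (3 / 4 * b).
  by lra.
have [x1 [dx1 [x2 [dx2 _]]]] := schi 2%N.
(* Each [schi n] provides its own derivatives; uniqueness of derivatives identifies them with [x1]
   and [x2]. *)
have sx2 n : smooth1 setT n x2.
  have [y1 [dy1 [y2 [dy2 sy2]]]] := schi n.+2.
  have e1 : y1 = x1 by apply/funext => t; exact: is_derive_unique (dy1 t I) (dx1 t I).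
  have e2 : y2 = x2.
    apply/funext => t; apply: is_derive_unique (dy2 t I) _.
    by rewrite e1; exact: dx2.
  by rewrite -e2.
have sx1 n : smooth1 setT n x1.
  by case: n => [|n]; [move=> t _; exact: is_derive1_continuous (dx2 t I)|exists x2].
pose A t := 4 * (t * x2 t) + (2 * d%:R) * x1 t.
pose B t := 8 * (t * x1 t).
have sA n : smooth1 setT n A.
  apply: smooth1_add; apply: smooth1_mul; do ?[exact: smooth1_cst|exact: sx1].
  by apply: smooth1_mul; [exact: smooth1_id|exact: sx2].
have sB n : smooth1 setT n B.
  apply: smooth1_mul; first exact: smooth1_cst.
  by apply: smooth1_mul; [exact: smooth1_id|exact: sx1].
have x1a t : t < b / 2 -> x1 t = 0.
  apply: (@is_derive_locally_cst chi x1 1 [set t | t < b / 2]) => //.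
  - by move=> {}t; exact: dx1.
  - by move=> {}t /= /ltW; exact: chi1.
have x2a t : t < b / 2 -> x2 t = 0.
  apply: (@is_derive_locally_cst x1 x2 0 [set t | t < b / 2]) => //.
  - by move=> {}t; exact: dx2.
have x1b t : 3 / 4 * b < t -> x1 t = 0.
  apply: (@is_derive_locally_cst chi x1 0 [set t | 3 / 4 * b < t]) => //.
  - by move=> {}t; exact: dx1.
  - by move=> {}t /= /ltW; exact: chi0.
have x2b t : 3 / 4 * b < t -> x2 t = 0.
  apply: (@is_derive_locally_cst x1 x2 0 [set t | 3 / 4 * b < t]) => //.
  - by move=> {}t; exact: dx2.
pose K e t := A t * f (t + e ^+ 2) + B t * f1 (t + e ^+ 2) +
  chi t * (4 * (t + e ^+ 2) * f2 (t + e ^+ 2) + 2 * d%:R * f1 (t + e ^+ 2)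
           + k ^+ 2 * f (t + e ^+ 2)).
have b34 : 3 / 4 * b < b by lra.
have Kb e t : b <= t -> K e t = 0.
  move=> bt; have bt' := lt_le_trans b34 bt.
  by rewrite /K /A /B x1b// x2b// chi0 ?ltW//; ring.
(* With S = b + 1 one has b <= S^2, so K(r^2) vanishes for r >= S and [0, S] is the only range to
   treat. *)
pose S := b + 1; have S0 : 0 <= S by rewrite /S; lra.
have bS : b <= S ^+ 2.
  rewrite /S sqrrD expr1n mulr1; have := sqr_ge0 b; lra.
pose P : set R := [set e | 0 < e <= 1].
have P01 e : P e -> 0 <= e <= 1 by move=> /andP[e0 e1]; rewrite ltW.
have [M M0 HM] : bounded_lipschitz P [set r | 0 <= r <= S] (fun e r => K e (r ^+ 2)).
  (* The radii at which derivatives of the cutoff may be nonzero; there r^2 + e^2 stays in a compact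
     interval away from the singularity at 0. *)
  pose Sb : set R := [set r | 0 <= r <= S] `&` [set r | b / 2 <= r ^+ 2].
  have SbS : Sb `<=` [set r | 0 <= r <= S] by move=> r [].
  have rng e r : P e -> Sb r -> b / 2 <= r ^+ 2 + e ^+ 2 <= S ^+ 2 + 1.
    move=> /P01/andP[e0 e1] [/= /andP[r0 rS] br].
    have h1 : r ^+ 2 <= S ^+ 2 by rewrite lerXn2r ?nnegrE.
    have h2 : e ^+ 2 <= 1 by rewrite expr_le1.
    by have := sqr_ge0 e; move=> h3; apply/andP; split; lra.
  have bshift := bounded_lipschitz_sub SbS (bounded_lipschitz_shifted_sqr P01 S0).
  have pos t : b / 2 <= t <= S ^+ 2 + 1 -> 0 < t by move=> /andP[+ _]; lra.
  have df t : b / 2 <= t <= S ^+ 2 + 1 -> is_derive t 1 f (f1 t).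
    by move=> /pos/dff[].
  have df1 t : b / 2 <= t <= S ^+ 2 + 1 -> is_derive t 1 f1 (f2 t).
    by move=> /pos/dff[].
  have cf1 t : b / 2 <= t <= S ^+ 2 + 1 -> {for t, continuous f1}.
    by move=> /df1; exact: is_derive1_continuous.
  have cf2 t : b / 2 <= t <= S ^+ 2 + 1 -> {for t, continuous f2}.
    by move=> /pos; exact: (sf2 0%N).
  apply: (@bounded_lipschitz_eq _ _ _ _ (fun e r => A (r ^+ 2) * f (r ^+ 2 + e ^+ 2) +
     B (r ^+ 2) * f1 (r ^+ 2 + e ^+ 2) + chi (r ^+ 2) * kappa (r ^+ 2 + e ^+ 2))).
    move=> e r /andP[e0 _] _; rewrite /K fode// ltr_wpDl ?sqr_ge0// exprn_gt0//.
  apply: bounded_lipschitz_add; first apply: bounded_lipschitz_add.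
  - apply: (@bounded_lipschitz_mul_support _ _ _ _ Sb (fun _ r => A (r ^+ 2))
      (fun e r => f (r ^+ 2 + e ^+ 2))) => //.
    + exact: bounded_lipschitz_smooth_sqr.
    + move=> e r _ Sr nSr; rewrite /A x1a ?x2a; first by ring.
        by rewrite ltNge; apply/negP => h; apply: nSr.
      by rewrite ltNge; apply/negP => h; apply: nSr.
    + apply: (bounded_lipschitz_C1 df cf1 bshift rng).
  - apply: (@bounded_lipschitz_mul_support _ _ _ _ Sb (fun _ r => B (r ^+ 2))
      (fun e r => f1 (r ^+ 2 + e ^+ 2))) => //.
    + exact: bounded_lipschitz_smooth_sqr.
    + move=> e r _ Sr nSr; rewrite /B x1a; first by ring.
      by rewrite ltNge; apply/negP => h; apply: nSr.
    + apply: (bounded_lipschitz_C1 df1 cf2 bshift rng).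
  (* The term chi kappa reaches the centre. There kappa is Lipschitz in the square root of its
     argument, and r |-> sqrt(r^2 + e^2) is 1-Lipschitz for every e. *)
  - apply: bounded_lipschitz_mul; first exact: bounded_lipschitz_smooth_sqr.
    have [M HM] := hkappa (S + 1).
    have sq e r : P e -> 0 <= r <= S -> 0 < Num.sqrt (r ^+ 2 + e ^+ 2) <= S + 1.
      move=> /andP[e0 e1] /andP[r0 rS]; apply/andP; split.
        by rewrite sqrtr_gt0 ltr_wpDl ?sqr_ge0// exprn_gt0.
      have S1 : 0 <= S + 1 by lra.
      rewrite -[leRHS](ger0_norm S1) -sqrtr_sqr ler_wsqrtr//.
      have h1 : r ^+ 2 <= S ^+ 2 by rewrite lerXn2r ?nnegrE.
      have h2 : e ^+ 2 <= 1 by rewrite expr_le1// ltW.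
      by rewrite sqrrD expr1n mulr1; lra.
    exists `|M| => // e r r' Pe Sr Sr'.
    have [h1 h2] := HM _ _ (sq e r Pe Sr) (sq e r' Pe Sr').
    rewrite !sqr_sqrtr ?addr_ge0 ?sqr_ge0// in h1 h2.
    split; first exact: le_trans h1 (ler_norm _).
    apply: le_trans h2 _; apply: (@le_trans _ _ (`|M| *
       `|Num.sqrt (r ^+ 2 + e ^+ 2) - Num.sqrt (r' ^+ 2 + e ^+ 2)|)).
      by apply: ler_wpM2r => //; exact: ler_norm.
    apply: ler_wpM2l => //.
    have /andP[e0 _] := Pe; have /andP[r0 _] := Sr; have /andP[r'0 _] := Sr'.
    exact: sqrt_shift_lipschitz.
exists c, M, (fun eta => 4 * f2 (eta ^+ 2)); split => // e e0 eb e1.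
have Pe : P e by rewrite /P/= e0.
have e2 : 0 < e ^+ 2 by rewrite exprn_gt0.
pose delta t := 4 * e ^+ 2 * (chi t * f2 (t + e ^+ 2)).
exists (fun t => chi t * f (t + e ^+ 2)), delta, (K e).
pose U : set R := [set t | - e ^+ 2 < t].
have Upos t : U t -> 0 < t + e ^+ 2 by rewrite /U/=; lra.
have shf n (g : R -> R) : smooth1 [set t | 0 < t] n g ->
    smooth1 U n (fun t => g (t + e ^+ 2)).
  move=> sg; apply: (smooth1_comp Upos sg).
  by apply: smooth1_add; [exact: smooth1_id|exact: smooth1_cst].
have sf1 n : smooth1 [set t | 0 < t] n f1.
  apply: smooth1S; exists f2; split; last exact: sf2.
  by move=> t /dff[].
have sf n : smooth1 [set t | 0 < t] n f.
  apply: smooth1S; exists f1; split; last exact: sf1.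
  by move=> t /dff[].
have toU n g : smooth1 setT n g -> smooth1 U n g by apply: smooth1_sub.
have dsh (g g1 : R -> R) (t : R) : (forall t : R, 0 < t -> is_derive t 1 g (g1 t)) -> U t ->
    is_derive t 1 (fun t => g (t + e ^+ 2)) (g1 (t + e ^+ 2)).
  move=> dg /Upos tp; apply: (is_derive_eqr (is_derive_comp
    (is_derive_fadd (is_derive1_id t) (is_derive_fcst _ _ _)) (dg _ tp))).
  by rewrite addr0 mulr1.
have delta0 t : b <= t -> delta t = 0.
  by move=> bt; rewrite /delta chi0; [ring|lra].
(* Extends the estimate from [0, S] to the half-line: if r <= S < r', replace r' by S, where K
   vanishes as well and which is closer to r. *)
have Lip r r' : 0 <= r -> 0 <= r' -> r <= r' ->
    `|K e (r ^+ 2)| <= M /\ `|K e (r ^+ 2) - K e (r' ^+ 2)| <= M * `|r - r'|.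
  move=> r0 r'0 rr'.
  have far s : S < s -> K e (s ^+ 2) = 0.
    move=> Ss; apply: Kb; apply: le_trans bS _.
    by rewrite lerXn2r ?nnegrE//; lra.
  have SS : [set r | 0 <= r <= S] S by rewrite /= S0 lexx.
  have KS : K e (S ^+ 2) = 0 by exact: Kb.
  have [rS|Sr] := leP r S; last first.
    rewrite !far//; last exact: lt_le_trans rr'.
    by rewrite subrr normr0 mulr_ge0.
  have Ar : [set r | 0 <= r <= S] r by rewrite /= r0.
  have [r'S|Sr'] := leP r' S.
    by apply: HM => //=; rewrite r'0.
  have [h1 h2] := HM e r S Pe Ar SS; split => //.
  rewrite (far r')//; rewrite KS in h2; apply: le_trans h2 _.
  apply: ler_wpM2l => //; rewrite ler0_norm ?subr_le0// ler0_norm ?subr_le0//.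
  by lra.
split.
- move=> y.
  have dF t : - e ^+ 2 < t -> is_derive t 1 (fun t => chi t * f (t + e ^+ 2))
      (x1 t * f (t + e ^+ 2) + chi t * f1 (t + e ^+ 2)).
    move=> Ut; apply: is_derive_fmul (dx1 t I) _.
    by apply: (dsh f f1) => // s /dff[].
  have dF1 t : - e ^+ 2 < t -> is_derive t 1
      (fun t => x1 t * f (t + e ^+ 2) + chi t * f1 (t + e ^+ 2))
      (x2 t * f (t + e ^+ 2) + 2 * x1 t * f1 (t + e ^+ 2) + chi t * f2 (t + e ^+ 2)).
    move=> Ut; have d1 : is_derive t 1 (fun t => f (t + e ^+ 2)) (f1 (t + e ^+ 2)).
      by apply: (dsh f f1) => // s /dff[].
    have d2 : is_derive t 1 (fun t => f1 (t + e ^+ 2)) (f2 (t + e ^+ 2)).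
      by apply: (dsh f1 f2) => // s /dff[].
    apply: (is_derive_eqr (is_derive_fadd (is_derive_fmul (dx2 t I) d1)
      (is_derive_fmul (dx1 t I) d2))).
    by ring.
  split.
    have sF n : smooth1 U n (fun t => chi t * f (t + e ^+ 2)).
      by apply: smooth1_mul; [exact: toU|exact: shf].
    have F0 t : Num.sqrt b ^+ 2 <= t -> chi t * f (t + e ^+ 2) = 0.
      rewrite (sqr_sqrtr (ltW b0)) => bt.
      by rewrite chi0 ?mul0r//; lra.
    exact: (radial_test_function e2 y sF (sqrtr_ge0 b) F0).
  move=> x; rewrite (radial_laplacian e2 dF dF1) /K /delta /A /B.
  by move: (rho y x) => t; ring.
- move=> t t0; have Ut : U t by rewrite /U/=; lra.
  split.
    apply: (@smooth1_continuous _ U 0) Ut.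
    apply: smooth1_mul; first exact: smooth1_cst.
    by apply: smooth1_mul; [exact: toU|exact: shf].
  apply: (@smooth1_continuous _ U 0) Ut; apply: smooth1_add; first apply: smooth1_add.
  + by apply: smooth1_mul; [exact/toU/sA|exact: shf].
  + by apply: smooth1_mul; [exact/toU/sB|exact: shf].
  + apply: smooth1_mul; first exact: toU.
    apply: smooth1_add; first apply: smooth1_add; apply: smooth1_mul;
      do ?[exact: smooth1_cst|exact: shf].
    apply: smooth1_mul; first exact: smooth1_cst.
    by apply: smooth1_add; [exact: smooth1_id|exact: smooth1_cst].
- by move=> t bt; split; [rewrite chi0 ?mul0r//; lra|exact: delta0|exact: Kb].
- have f2pos t : 0 <= t -> 0 <= f2 (t + e ^+ 2).
    move=> t0; have tp : 0 < t + e ^+ 2 by lra.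
    by have /andP[] := f2mono _ _ tp (lexx _).
  split.
  + move=> t t0; have /andP[c1 _] := chi01 t.
    apply: mulr_ge0; first by rewrite mulr_ge0// ltW.
    by apply: mulr_ge0 => //; exact: f2pos.
  + move=> t /andP[t0 te]; rewrite /delta chi1 ?mul1r; last by lra.
    apply: le_trans (hc e e0) _; apply: ler_wpM2l; first by lra.
    have tp : 0 < t + e ^+ 2 by lra.
    have le2 : t + e ^+ 2 <= 2 * e ^+ 2 by lra.
    by have /andP[] := f2mono _ _ tp le2.
  + move=> eta t eta0 et; have eta2 : 0 < eta ^+ 2 by rewrite exprn_gt0.
    have t0 : 0 <= t by lra.
    rewrite /delta [leRHS]mulrAC; apply: ler_wpM2l; first by rewrite mulr_ge0// ltW.
    have /andP[c1 c2] := chi01 t.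
    apply: (@le_trans _ _ (f2 (t + e ^+ 2))).
      by apply: ler_piMl => //; exact: f2pos.
    have le2 : eta ^+ 2 <= t + e ^+ 2 by lra.
    by have /andP[] := f2mono _ _ eta2 le2.
- move=> r r' r0 r'0; have [rr'|/ltW r'r] := leP r r'; first exact: Lip.
  have [_ h] := Lip r' r r'0 r0 r'r; have [h1 _] := Lip r r r0 r0 (lexx _).
  by split => //; rewrite distrC [`|r - r'|]distrC.
Qed.

End helmholtz_kernel.

(** * Approximate identities and the interior estimate *)

Section approximate_identity.
Context {disp : measure_display} {X : measurableType disp} {R : realType}.
Variable mu : {measure set X -> \bar R}.
Implicit Types (f w W H : X -> R) (B V : set X).

Lemma dominated_Rintegral f W (M : R) : 0 <= M ->
  mu.-integrable setT (EFin \o W) -> measurable_fun setT f ->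
  (forall y, `|f y| <= M * W y) ->
  mu.-integrable setT (EFin \o f) /\
  `|\int[mu]_y f y| <= M * \int[mu]_y W y.
Proof.
move=> M0 iW mf fW.
have iMW : mu.-integrable setT (EFin \o (fun y => M * W y)).
  exact: eq_integrable (integrableZl measurableT M iW).
have fi : mu.-integrable setT (EFin \o f).
  apply: le_integrable iMW => //; first exact/measurable_EFinP.
  by move=> y _; rewrite /= lee_fin; apply: le_trans (fW y) (ler_norm _).
split => //.
rewrite -RintegralZl//; apply: le_trans (le_normr_Rintegral _ fi) _ => //.
by apply: le_Rintegral => //; exact: (integrable_norm fi).
Qed.

Variables (w W : X -> R) (B : set X).
Hypothesis mw : measurable_fun setT w.
Hypothesis iW : mu.-integrable setT (EFin \o W).
Hypothesis W0 : forall y, 0 <= W y.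
Hypothesis wW : forall y, B y -> `|w y| <= W y /\ 1 <= W y.

(** As W dominates both |w| and 1 on B, the same integrable function controls w H and H. *)
Lemma weighted_integrable H (L : R) : measurable_fun setT H ->
  (forall y, `|H y| <= L) -> (forall y, ~ B y -> H y = 0) ->
  [/\ mu.-integrable setT (EFin \o H),
      mu.-integrable setT (EFin \o (fun y => w y * H y)) &
      `|\int[mu]_y (w y * H y)| <= L * \int[mu]_y W y].
Proof.
move=> mH HL HB.
have L0 : 0 <= L := le_trans (normr_ge0 _) (HL point).
have h1 y : `|H y| <= L * W y.
  have [By|By] := pselect (B y).
    apply: le_trans (HL _) _.
    by rewrite ler_peMr//; have [] := wW By.
  by rewrite HB ?normr0 ?mulr_ge0.
have h2 y : `|w y * H y| <= L * W y.
  have [By|By] := pselect (B y).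
    by rewrite normrM mulrC; apply: ler_pM => //; have [] := wW By.
  by rewrite HB ?mulr0 ?normr0 ?mulr_ge0.
have [i1 _] := dominated_Rintegral L0 iW mH h1.
have [i2 i3] := dominated_Rintegral L0 iW (measurable_funM mw mH) h2.
by [].
Qed.

(** Near the point, on V, w oscillates by at most omega. Off V the kernel is at most L, and |w - wx|
    <= (1 + |wx|) W on B, outside of which H vanishes. *)
Lemma average_approximation H V (wx omega L L' : R) : measurable_fun setT H ->
  (forall y, `|H y| <= L') -> (forall y, ~ B y -> H y = 0) ->
  (forall y, 0 <= H y) -> 0 <= omega -> 0 <= L ->
  (forall y, ~ V y -> H y <= L) -> (forall y, V y -> `|w y - wx| <= omega) ->
  `|\int[mu]_y (w y * H y) - wx * \int[mu]_y H y| <=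
    omega * \int[mu]_y H y + L * (1 + `|wx|) * \int[mu]_y W y.
Proof.
move=> mH HL' HB H0 om0 L0 HV wV.
have [ih iwh _] := weighted_integrable mH HL' HB.
have iZ (c : R) (g : X -> R) : mu.-integrable setT (EFin \o g) ->
    mu.-integrable setT (EFin \o (fun y => c * g y)).
  by move=> ig; exact: eq_integrable (integrableZl measurableT c ig).
rewrite -RintegralZl// -RintegralB//; last exact: iZ.
have iWL := iZ (L * (1 + `|wx|)) _ iW; have ioh := iZ omega _ ih.
rewrite -[X in _ <= X + _]RintegralZl// -[X in _ <= _ + X]RintegralZl//.
rewrite -RintegralD//.
have isub : mu.-integrable setT (EFin \o (fun y => w y * H y - wx * H y)).
  exact: eq_integrable (integrableB measurableT iwh (iZ wx _ ih)).
apply: le_trans (le_normr_Rintegral _ isub) _ => //.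
apply: le_Rintegral => //.
- exact: (integrable_norm isub).
- exact: eq_integrable (integrableD measurableT ioh iWL).
move=> y _; rewrite -mulrBl normrM (ger0_norm (H0 _)).
have LW : 0 <= L * (1 + `|wx|) * W y by rewrite !mulr_ge0// addr_ge0.
have [Vy|Vy] := pselect (V y).
  apply: (@le_trans _ _ (omega * H y)); last by rewrite lerDl.
  by apply: ler_wpM2r (wV _ Vy).
apply: (@le_trans _ _ (L * (1 + `|wx|) * W y)); last by rewrite lerDr mulr_ge0.
have [By|By] := pselect (B y); last by rewrite (HB _ By) mulr0.
rewrite mulrC -mulrA; apply: ler_pM => //; first exact: HV.
have [h1 h2] := wW By.
apply: le_trans (ler_normB _ _) _; rewrite mulrDl mul1r; apply: lerD => //.
by rewrite ler_peMr.
Qed.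

End approximate_identity.

Section radial_averages.
Context {R : realType} {d : nat}.
Local Notation T := (caratheodory_type (leb_outer R d)).
Local Notation mu := (leb R d).
Implicit Types (x y : 'rV[R]_d) (B : set 'rV[R]_d).

Lemma measurable_rho (h : R -> R) x : (forall t, 0 <= t -> {for t, continuous h}) ->
  measurable_fun (setT : set T) ((fun y => h (rho x y)) : T -> R).
Proof.
move=> ch; apply: (continuous_measurable_leb openT) => y _.
apply: continuous_comp; first exact: continuous_rho.
exact/ch/rho_ge0.
Qed.

Lemma rho_ge_notin (b : R) x B y : 0 <= b -> eball x (Num.sqrt b) `<=` B ->
  ~ B y -> b <= rho x y.
Proof.
move=> b0 sB By; rewrite leNgt; apply/negP => yb; apply/By/sB.
by rewrite /eball/= -sqrt_rho ltr_sqrt ?(le_lt_trans (rho_ge0 _ _) yb).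
Qed.

Lemma bounded_profile (h : R -> R) (b : R) :
  (forall t, 0 <= t -> {for t, continuous h}) -> (forall t, b <= t -> h t = 0) ->
  exists2 L : R, 0 <= L & forall t, 0 <= t -> `|h t| <= L.
Proof.
move=> ch hb; have [|L L0 HL] := @continuous_bounded_segment _ h 0 b.
  by move=> t /andP[t0 _]; exact: ch.
exists L => // t t0; have [tb|bt] := leP t b; first by apply: HL; rewrite t0.
by rewrite hb ?normr0// ltW.
Qed.

Lemma radial_mass_translate (h : R -> R) x :
  (forall t, 0 <= t -> {for t, continuous h}) -> (forall t, 0 <= t -> 0 <= h t) ->
  \int[mu]_y h (rho x y) = \int[mu]_y h (rho 0 y).
Proof.
move=> ch h0.
have c0 : continuous (fun y : 'rV[R]_d => h (rho 0 y)).
  move=> y; apply: continuous_comp; first exact: continuous_rho.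
  exact/ch/rho_ge0.
have p0 y : 0 <= h (rho 0 y) by exact/h0/rho_ge0.
rewrite /Rintegral -(leb_integral_translate x c0 p0).
by congr fine; apply: eq_integral => y _; rewrite /rho subr0.
Qed.

Lemma radial_mass_ge (h : R -> R) x (c e m : R) : 0 < e ->
  (forall t, 0 <= t -> {for t, continuous h}) -> (forall t, 0 <= t -> 0 <= h t) ->
  (forall t, 0 <= t <= e ^+ 2 -> m <= h t) -> 0 <= m ->
  leb_outer R d unit_box = c%:E ->
  mu.-integrable setT (EFin \o (fun y => h (rho x y)) : T -> \bar R) ->
  m * (c / d.+1%:R ^+ d * e ^+ d) <= \int[mu]_y h (rho x y).
Proof.
move=> e0 ch h0 hm m0 hc ih.
have mB : measurable (eball x e : set T) by exact/open_measurable_leb/open_eball.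
have fin : (\int[mu]_y (h (rho x y))%:E)%E \is a fin_num.
  exact: integrable_fin_num ih.
rewrite -lee_fin /Rintegral fineK//.
apply: (@le_trans _ _ (\int[mu]_(y in (eball x e : set T)) m%:E)%E).
  rewrite integral_cst// EFinM; apply: lee_wpmul2l; first by rewrite lee_fin.
  exact: leb_eball_ge.
apply: (@le_trans _ _ (\int[mu]_(y in (eball x e : set T)) (h (rho x y))%:E)%E).
  apply: ge0_le_integral => //.
  - apply/measurable_EFinP; apply: measurable_funTS; exact: measurable_rho.
  - move=> y yx; rewrite lee_fin; apply: hm.
    by rewrite rho_ge0/= rhoE lerXn2r ?nnegrE ?enorm_ge0 ?ltW.
apply: ge0_subset_integral => //.
- by apply/measurable_EFinP; exact: measurable_rho.
- by move=> y _; rewrite lee_fin; exact/h0/rho_ge0.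
Qed.

End radial_averages.

Section interior_bound.
Context {R : realType} {d : nat}.
Local Notation T := (caratheodory_type (leb_outer R d)).
Local Notation mu := (leb R d).

(* Tested against the truncated fundamental solution, the equation reads
   int w delta = int w K with delta an approximate identity and K a bounded
   Lipschitz function. *)
Lemma helmholtz_interior_bound (k b c : R) : d = 2%N \/ d = 3%N -> 0 < b ->
  leb_outer R d unit_box = c%:E -> 0 < c ->
  exists2 C : R, 0 <= C &
  forall (w W : 'rV[R]_d -> R) (B : set 'rV[R]_d) (x x' : 'rV[R]_d),
  measurable_fun (setT : set T) (w : T -> R) ->
  mu.-integrable setT (EFin \o W : T -> \bar R) ->
  (forall y, 0 <= W y) -> (forall y, B y -> `|w y| <= W y /\ 1 <= W y) ->
  (forall z, z = x \/ z = x' -> [/\ eball z (Num.sqrt b) `<=` B,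
     {for z, continuous w} & forall phi, test_function phi ->
       (forall y, Num.sqrt b <= enorm (y - z) -> phi y = 0) ->
       \int[mu]_y (w y * (laplacian phi y + k ^+ 2 * phi y)) = 0]) ->
  `|w x| <= C * \int[mu]_y W y /\
  `|w x - w x'| <= C * \int[mu]_y W y * enorm (x - x').
Proof.
move=> hd b0 hc c0.
have [c1 [M [Ceta [c10 M0 Hker]]]] := @helmholtz_kernel R d k b hd b0.
(* The powers of e cancel: delta is at least c1/e^d on a ball of volume at least c e^d/(d+1)^d, so
   [m0] bounds its mass below for every e. *)
pose m0 := c1 * (c / d.+1%:R ^+ d).
have m00 : 0 < m0 by rewrite mulr_gt0// divr_gt0// exprn_gt0.
exists (M / m0); first by rewrite divr_ge0// ltW.
move=> w W B x x' mw iW W0 wW Hz; set N := \int[mu]_y W y.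
have N0 : 0 <= N by apply: Rintegral_ge0 => y _.
have [xB cx ex] := Hz x (or_introl erefl); have [xB' cx' ex'] := Hz x' (or_intror erefl).
suff H (tau : R) : 0 < tau -> `|w x| <= M * N / m0 + tau /\
    `|w x - w x'| <= M * enorm (x - x') * N / m0 + (tau + tau).
  split; apply/ler_addgt0Pr => t t0.
    by have [h _] := H t t0; rewrite mulrAC.
  have t20 : 0 < t / 2 by rewrite divr_gt0.
  have [_] := H (t / 2) t20; rewrite -splitr => h.
  by apply: le_trans h _; rewrite lerD2r le_eqVlt; apply/orP; left; apply/eqP; ring.
move=> tau0.
have near_ball z : {for z, continuous w} -> exists2 eta : R, 0 < eta &
    forall y, enorm (y - z) < eta -> `|w y - w z| <= tau / 2.
  move=> cw; have t20 : 0 < tau / 2 by rewrite divr_gt0.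
  have [eta eta0 h] := nbhs_eballP (cw _ (nbhsx_ballx (w z) (tau / 2) t20)).
  by exists eta => // y /h; rewrite /ball/= distrC => /ltW.
have [eta eta0 Heta] := near_ball x cx; have [eta' eta'0 Heta'] := near_ball x' cx'.
pose r := Num.min eta eta'.
have r0 : 0 < r by rewrite lt_min eta0.
pose Q := `|Ceta r|.
pose Z := Q * (1 + `|w x| + `|w x'|) * N + 1.
have wx0 := normr_ge0 (w x); have wx'0 := normr_ge0 (w x').
have Z0 : 0 < Z.
  rewrite /Z ltr_pwDr//; apply: mulr_ge0 => //; apply: mulr_ge0; first exact: normr_ge0.
  by rewrite !addr_ge0.
(* The last entry makes the contribution of delta from outside the r-balls at most tau m0/2. [Z]
   contains both |w x| and |w x'|, so one e serves the two points. *)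
pose e := Num.min 1 (Num.min (b / 2) (tau * m0 / (2 * Z))).
have e0 : 0 < e.
  by rewrite !lt_min ltr01/= !divr_gt0// ?mulr_gt0.
have e1 : e <= 1 by rewrite ge_min lexx.
have e2e : e ^+ 2 <= e by rewrite expr2 ler_piMr// ltW.
have eb : e ^+ 2 <= b / 2.
  by apply: le_trans e2e _; rewrite /e !ge_min lexx orbT.
have eZ : e ^+ 2 * Z <= tau * m0 / 2.
  rewrite -ler_pdivlMr//; apply: le_trans e2e _.
  rewrite /e !ge_min; apply/orP; right; apply/orP; right.
  by rewrite le_eqVlt invfM mulrA eqxx.
have [F [delta [K [Htest Hc Hb [d0 dge dle] HK]]]] := Hker e e0 eb e1.
have cd t : 0 <= t -> {for t, continuous delta} by move=> /Hc[].
have cK t : 0 <= t -> {for t, continuous K} by move=> /Hc[].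
have db t : b <= t -> delta t = 0 by move=> /Hb[].
have Kb t : b <= t -> K t = 0 by move=> /Hb[].
have [L L0 HL] := bounded_profile cd db.
have KM (z y : 'rV[R]_d) : `|K (rho z y)| <= M.
  rewrite rhoE.
  by have [] := HK (enorm (y - z)) (enorm (y - z)) (enorm_ge0 _) (enorm_ge0 _).
pose m := \int[mu]_y delta (rho 0 y).
have mE (z : 'rV[R]_d) : \int[mu]_y delta (rho z y) = m by exact: radial_mass_translate.
have Hdelta z := @weighted_integrable _ T R mu w W B mw iW W0 wW
   (fun y => delta (rho z y)) L (measurable_rho z cd) (fun y => HL _ (rho_ge0 z y)).
have HKz z := @weighted_integrable _ T R mu w W B mw iW W0 wW
   (fun y => K (rho z y)) M (measurable_rho z cK) (KM z).
have out (z : 'rV[R]_d) : eball z (Num.sqrt b) `<=` B ->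
    forall h : R -> R, (forall t, b <= t -> h t = 0) ->
    forall y, ~ B y -> h (rho z y) = 0.
  by move=> zB h hb y By; apply: hb; exact: rho_ge_notin (ltW b0) zB By.
have mge : m0 <= m.
  have [id _ _] := Hdelta x (out x xB _ db).
  have c1e : 0 <= c1 / e ^+ d by rewrite divr_ge0 ?exprn_ge0// ltW.
  have := radial_mass_ge e0 cd d0 dge c1e hc id; rewrite mE; apply: le_trans.
  rewrite le_eqVlt; apply/orP; left; apply/eqP; rewrite /m0.
  have en : e ^+ d != 0 by rewrite expf_neq0// gt_eqF.
  have dn : (d.+1%:R : R) ^+ d != 0 by rewrite expf_neq0// pnatr_eq0.
  by move: (e ^+ d) (d.+1%:R ^+ d) en dn => p p' pn pn'; field; rewrite pn pn'.
have mp := lt_le_trans m00 mge.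
have ident (z : 'rV[R]_d) : eball z (Num.sqrt b) `<=` B -> (forall phi, test_function phi ->
       (forall y, Num.sqrt b <= enorm (y - z) -> phi y = 0) ->
       \int[mu]_y (w y * (laplacian phi y + k ^+ 2 * phi y)) = 0) ->
    \int[mu]_y (w y * delta (rho z y)) = \int[mu]_y (w y * K (rho z y)).
  move=> zB /(_ (fun y => F (rho z y))); have [tF lF] := Htest z.
  move=> /(_ tF) h.
  have [_ iwd _] := Hdelta z (out z zB _ db); have [_ iwK _] := HKz z (out z zB _ Kb).
  apply/eqP; rewrite -subr_eq0 -opprB oppr_eq0 -RintegralB//; apply/eqP.
  rewrite -[RHS]h; last first.
    move=> y yz; suff bz : b <= rho z y by have [] := Hb _ bz.
    rewrite rhoE -[leLHS](sqr_sqrtr (ltW b0)) lerXn2r ?nnegrE ?sqrtr_ge0 ?enorm_ge0//.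
  by apply: eq_Rintegral => y _; rewrite lF mulrBr.
have approx (z : 'rV[R]_d) : eball z (Num.sqrt b) `<=` B ->
    (forall y, enorm (y - z) < r -> `|w y - w z| <= tau / 2) ->
    `|w z| <= `|w x| + `|w x'| ->
    `|\int[mu]_y (w y * delta (rho z y)) - w z * m| <= tau * m.
  move=> zB wz wzx.
  have := @average_approximation _ T R mu w W B mw iW W0 wW
    (fun y => delta (rho z y)) [set y | enorm (y - z) < r] (w z) (tau / 2)
    (Q * e ^+ 2) L (measurable_rho z cd) (fun y => HL _ (rho_ge0 z y)) (out z zB _ db)
    (fun y => d0 _ (rho_ge0 z y)) _ _ _ wz.
  rewrite mE => h; apply: le_trans (h _ _ _) _.
  - by rewrite divr_ge0// ltW.
  - by apply: mulr_ge0; [exact: normr_ge0|exact: sqr_ge0].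
  - move=> y /= /negP; rewrite -leNgt => ry.
    apply: le_trans (dle r (rho z y) r0 _) _.
      by rewrite rhoE lerXn2r ?nnegrE ?enorm_ge0// ltW.
    by apply: ler_wpM2r; [exact: sqr_ge0|exact: ler_norm].
  have h1 : Q * e ^+ 2 * (1 + `|w z|) * N <= e ^+ 2 * Z.
    have -> : e ^+ 2 * Z = e ^+ 2 * (Q * (1 + `|w x| + `|w x'|) * N) + e ^+ 2.
      by rewrite /Z; ring.
    rewrite -[leLHS]addr0; apply: lerD; last exact: sqr_ge0.
    have -> : Q * e ^+ 2 * (1 + `|w z|) * N = e ^+ 2 * (Q * (1 + `|w z|) * N) by ring.
    apply: ler_wpM2l; first exact: sqr_ge0.
    apply: ler_wpM2r => //; apply: ler_wpM2l; first exact: normr_ge0.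
    by rewrite -addrA lerD2l.
  have h2 : tau * m0 / 2 <= tau * m / 2.
    by rewrite ler_wpM2r// ler_wpM2l// ltW.
  apply: le_trans (lerD (lexx _) (le_trans h1 (le_trans eZ h2))) _.
  by rewrite le_eqVlt; apply/orP; left; apply/eqP; field.
have rle (y z : 'rV[R]_d) (s : R) : r <= s -> enorm (y - z) < r -> enorm (y - z) < s.
  by move=> rs h; exact: lt_le_trans rs.
have ax := approx x xB _ _; have ax' := approx x' xB' _ _.
have {}ax : `|\int[mu]_y (w y * delta (rho x y)) - w x * m| <= tau * m.
  apply: ax; last by rewrite lerDl.
  by move=> y h; apply: Heta; apply: (rle _ _ eta _ h); rewrite ge_min lexx.
have {}ax' : `|\int[mu]_y (w y * delta (rho x' y)) - w x' * m| <= tau * m.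
  apply: ax'; last by rewrite lerDr.
  by move=> y h; apply: Heta'; apply: (rle _ _ eta' _ h); rewrite ge_min lexx orbT.
rewrite (ident x xB ex) in ax; rewrite (ident x' xB' ex') in ax'.
have [_ iwK bK] := HKz x (out x xB _ Kb); have [_ iwK' _] := HKz x' (out x' xB' _ Kb).
(* The mass m depends on e and is only bounded below. The error is therefore kept as tau m, and only
   the main term q is divided by [m0]; the case A <= tau is immediate. *)
have divm (A q : R) : 0 <= q -> A * m <= q + tau * m -> A <= q / m0 + tau.
  move=> q0 h; rewrite -lerBlDr ler_pdivlMr//.
  have [s0|s0] := leP (A - tau) 0.
    by apply: le_trans q0; rewrite mulr_le0_ge0// ltW.
  apply: (@le_trans _ _ ((A - tau) * m)); first by rewrite ler_wpM2l// ltW.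
  by rewrite mulrBl lerBlDr.
split.
  apply: divm; first by rewrite mulr_ge0.
  rewrite -{1}(gtr0_norm mp) -normrM.
  rewrite -[w x * m](subrK (\int[mu]_y (w y * K (rho x y)))) addrC.
  by apply: le_trans (ler_normD _ _) _; rewrite [`|w x * m - _|]distrC; exact: lerD.
set tau2 := tau + tau.
have divm2 (A q : R) : 0 <= q -> A * m <= q + tau2 * m -> A <= q / m0 + tau2.
  move=> q0 h; rewrite -lerBlDr ler_pdivlMr//.
  have [s0|s0] := leP (A - tau2) 0.
    by apply: le_trans q0; rewrite mulr_le0_ge0// ltW.
  apply: (@le_trans _ _ ((A - tau2) * m)); first by rewrite ler_wpM2l// ltW.
  by rewrite mulrBl lerBlDr.
have q0 : 0 <= M * enorm (x - x') * N by rewrite !mulr_ge0// enorm_ge0.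
apply: divm2 => //.
have bKK : `|\int[mu]_y (w y * K (rho x y)) - \int[mu]_y (w y * K (rho x' y))| <=
    M * enorm (x - x') * N.
  rewrite -RintegralB//.
  have mKK : measurable_fun (setT : set T)
      ((fun y => K (rho x y) - K (rho x' y)) : T -> R).
    by apply: measurable_funB; exact: measurable_rho.
  have KL (y : 'rV[R]_d) : `|K (rho x y) - K (rho x' y)| <= M * enorm (x - x').
    rewrite !rhoE.
    have [_ h] := HK (enorm (y - x)) (enorm (y - x')) (enorm_ge0 _) (enorm_ge0 _).
    apply: le_trans h _; apply: ler_wpM2l => //.
    apply: le_trans (ler_dist_enorm _ _) _.
    by rewrite opprB addrC addrA subrK enormB.
  have KK0 (y : 'rV[R]_d) : ~ B y -> K (rho x y) - K (rho x' y) = 0.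
    by move=> By; rewrite (out x xB _ Kb)// (out x' xB' _ Kb)// subrr.
  have [_ _] := @weighted_integrable _ T R mu w W B mw iW W0 wW
     (fun y => K (rho x y) - K (rho x' y)) _ mKK KL KK0.
  rewrite -/N; apply: le_trans.
  by under [in leRHS]eq_Rintegral do rewrite mulrBr.
rewrite -{1}(gtr0_norm mp) -normrM mulrBl.
set I1 := Rintegral _ _ _ in ax bKK; set I2 := Rintegral _ _ _ in ax' bKK.
have -> : w x * m - w x' * m = (I1 - I2) + (w x * m - I1) + (I2 - w x' * m) by ring.
apply: le_trans (ler_normD _ _) _; rewrite /tau2 mulrDl [leRHS]addrA.
apply: lerD => //; apply: le_trans (ler_normD _ _) _.
by apply: lerD; rewrite // distrC.
Qed.

End interior_bound.

(** * Finite surface measure of a bounded C^2 boundary *)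

Section hausdorff_finite.
Context {R : realType}.
Local Open Scope ereal_scope.

Lemma hausdorff_factor_lty s : hausdorff_factor R s < +oo.
Proof.
apply: leb_bounded_lty; exists 2^-1%R; split; first exact: num_real.
move=> M M2 x /= hx; apply: le_trans (norm_le_enorm x) _.
by move: hx; rewrite /eball/= subr0 => hx; exact: ltW (lt_trans hx M2).
Qed.

Lemma diam_le (d : nat) (A : set 'rV[R]_d) (r : R) : (0 <= r)%R ->
  (forall x y, A x -> A y -> enorm (x - y) <= r)%R ->
  exists2 t : R, (0 <= t <= r)%R & diam A = t%:E.
Proof.
move=> r0 h.
have d0 : 0 <= diam A by apply: ereal_sup_ubound; left.
have dr : diam A <= r%:E.
  apply: ge_ereal_sup => _ [->|[x Ax [y Ay <-]]]; rewrite lee_fin//.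
  exact: h.
have df : diam A \is a fin_num by rewrite ge0_fin_numE// (le_lt_trans dr) ?ltry.
exists (fine (diam A)); last by rewrite fineK.
by rewrite -!lee_fin fineK// d0.
Qed.

Lemma hausdorff_delta_le (d s : nat) (e r : R) (A : set 'rV[R]_d) :
  (0 <= r <= e)%R -> (forall x y, A x -> A y -> enorm (x - y) <= r)%R ->
  hausdorff_delta d s e A <= hausdorff_factor R s * (r ^+ s)%:E.
Proof.
move=> /andP[r0 re] h; have [t /andP[t0 tr] e1] := diam_le r0 h.
have f0 : 0 <= hausdorff_factor R s by exact: outer_measure_ge0.
apply: (@le_trans _ _ `|hausdorff_factor R s * diam A ^+ s|).
  apply: (@cover_outer_le _ _ [set A | diam A <= e%:E]
    (fun A => hausdorff_factor R s * diam A ^+ s)).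
  by rewrite /= e1 lee_fin (le_trans tr).
rewrite e1 -EFin_expe gee0_abs; last first.
  by rewrite mule_ge0// lee_fin exprn_ge0.
by rewrite lee_wpmul2l// lee_fin lerXn2r ?nnegrE.
Qed.

(** S is the image of a subset of a cube of R^s under a Lipschitz inverse of p. A grid on the cube
    cuts S into (n+1)^s pieces of diameter at most r = 2 M L/n, and (n+1) r <= 4 M L because n + 1
    <= 2 n: the bound does not depend on the mesh. *)
Lemma hausdorff_lipschitz_image (d s : nat) (S : set 'rV[R]_d)
    (p : 'rV[R]_d -> 'rV[R]_s) (M L : R) : (0 < M)%R -> (0 <= L)%R ->
  (forall x, S x -> `|p x| <= M)%R ->
  (forall x x', S x -> S x' -> enorm (x - x') <= L * `|p x - p x'|)%R ->
  hausdorff_outer s S < +oo.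
Proof.
move=> M0 L0 pM pL.
have F0 : 0 <= hausdorff_factor R s by exact: outer_measure_ge0.
apply: (@le_lt_trans _ _ (hausdorff_factor R s * ((4 * M * L) ^+ s)%:E)); last first.
  have := hausdorff_factor_lty s; move: F0; case: (hausdorff_factor R s) => //= f _ _.
  exact: ltry.
apply: ge_ereal_sup => _ [e /= e0 <-].
(* The mesh is fine enough for r <= e, so that the pieces are admissible for [hausdorff_delta]. *)
pose n := (Num.truncn (2 * M * L / e)%R).+1.
have n0 : (0 < (n%:R : R))%R by rewrite ltr0n.
pose r := (2 * M * L / n%:R)%R.
have ML0 : (0 <= 2 * M * L)%R by rewrite !mulr_ge0// ltW.
have r0 : (0 <= r)%R by rewrite divr_ge0// ltW.
have re : (r <= e)%R.
  rewrite /r ler_pdivrMr// [leRHS]mulrC -ler_pdivrMr//; apply: ltW; exact: truncnS_gt.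
(* Rescaled coordinates range over the closed interval [0, n], so the truncation can equal n: n + 1
   indices per coordinate. *)
pose cell (i : {ffun 'I_s -> 'I_n.+1}) : set 'rV[R]_d := [set x | S x /\
  forall j, (((i j : nat)%:R : R) <= (p x 0 j + M) * n%:R / (2 * M)
     <= (i j).+1%:R)%R].
have M20 : (0 < 2 * M)%R by rewrite mulr_gt0.
have cellr i x y : cell i x -> cell i y -> (enorm (x - y) <= r)%R.
  move=> [Sx hx] [Sy hy]; apply: le_trans (pL x y Sx Sy) _.
  have -> : r = (L * (2 * M / n%:R))%R by rewrite /r; ring.
  rewrite ler_wpM2l//; apply: norm_le_coord => [|j]; first by rewrite divr_ge0// ltW.
  have := hx j; have := hy j; rewrite !mxE => /andP[h1 h2] /andP[h3 h4].
  rewrite ler_pdivlMr//.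
  have -> : (`|p x 0 j - p y 0 j| * n%:R = `|(p x 0 j - p y 0 j) * n%:R|)%R.
    by rewrite normrM (gtr0_norm n0).
  rewrite ler_pdivlMr// in h1; rewrite ler_pdivrMr// in h2.
  rewrite ler_pdivlMr// in h3; rewrite ler_pdivrMr// in h4.
  move: h2 h4; rewrite -natr1 => h2 h4.
  by rewrite ler_norml; apply/andP; split; lra.
have Scell : S `<=` \big[setU/set0]_(i : {ffun 'I_s -> 'I_n.+1}) cell i.
  move=> x Sx; rewrite -bigcup_seq.
  pose q j : R := ((p x 0 j + M) * n%:R / (2 * M))%R.
  have pj j : (- M <= p x 0 j <= M)%R.
    by rewrite -ler_norml; apply: le_trans (coord_le_norm _ _) (pM _ Sx).
  have q0 j : (0 <= q j)%R.
    have /andP[h _] := pj j.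
    rewrite /q divr_ge0//; last exact: ltW.
    by apply: mulr_ge0; [lra|exact: ltW].
  have qn j : (q j <= n%:R)%R.
    have /andP[_ h] := pj j.
    by rewrite /q ler_pdivrMr// mulrC ler_pM2l//; lra.
  have tn j : (Num.truncn (q j) < n.+1)%N.
    rewrite ltnS -(ler_nat R); apply: le_trans (qn j).
    by have /andP[] := truncn_itv (q0 j).
  exists [ffun j => Ordinal (tn j)]; first by rewrite /= mem_index_enum.
  split => // j; rewrite ffunE/=; have /andP[h1 h2] := truncn_itv (q0 j).
  by rewrite -/(q j) h1/= ltW.
apply: le_trans (le_outer_measure (hausdorff_delta d s e) _ _ Scell) _.
apply: le_trans (outer_measure_finU _ (hausdorff_delta d s e) cell) _.
have rs : (0 <= r <= e)%R by rewrite r0.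
apply: (@le_trans _ _ (\sum_(i : {ffun 'I_s -> 'I_n.+1})
    hausdorff_factor R s * (r ^+ s)%:E)).
  by apply: lee_sum => i _; apply: hausdorff_delta_le rs _; exact: cellr.
have := hausdorff_factor_lty s; move: F0; case: (hausdorff_factor R s) => //= f f0 _.
rewrite -EFinM sumEFin lee_fin sumr_const card_ffun !card_ord.
rewrite -[leLHS]mulr_natr natrX -mulrA -exprMn; apply: ler_wpM2l; first by rewrite -lee_fin.
have h : (r * n.+1%:R <= 4 * M * L)%R.
  rewrite /r mulrAC ler_pdivrMr//.
  have -> : (4 * M * L * n%:R = 2 * M * L * (2 * n%:R))%R by ring.
  rewrite ler_wpM2l// -natr1.
  have : (1 <= (n%:R : R))%R by rewrite ler1n.
  by lra.
have h0 : (0 <= r * n.+1%:R)%R by rewrite mulr_ge0.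
by rewrite lerXn2r ?nnegrE// (le_trans h0).
Qed.

End hausdorff_finite.

Section C1_lipschitz.
Context {R : realType} {d : nat}.
Implicit Types (x y : 'rV[R]_d) (g : 'rV[R]_d -> R).

Lemma is_derive_on_line g x v (t l : R) : is_derive (t *: v + x) v g l ->
  is_derive t 1 (fun u : R => g (u *: v + x)) l.
Proof.
move=> /is_derive_line h.
rewrite (_ : (fun u : R => _) =
  (fun s : R => g (s *: v + (t *: v + x))) \o (fun u => u - t)); last first.
  by apply/funext => u /=; rewrite addrA -scalerDl subrK.
have e : is_derive t 1 (fun u : R => u - t) 1.
  apply: (is_derive_eqr (is_derive_fsub (is_derive1_id t) (is_derive_fcst _ _ _))).
  by rewrite subr0.
rewrite -[l]mulr1; apply: is_derive_comp e _.
by rewrite subrr.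
Qed.

Lemma compact_cube (M : R) : compact [set x : 'rV[R]_d | forall i, - M <= x 0 i <= M].
Proof.
have := @rV_compact _ d (fun=> `[- M, M]%classic) (fun=> @segment_compact _ _ _).
by congr (compact _).
Qed.

Lemma continuous_bounded_cube g (M : R) : continuous g ->
  exists2 K : R, 0 <= K & forall x, (forall i, - M <= x 0 i <= M) -> `|g x| <= K.
Proof.
move=> cg; set A := [set x : 'rV[R]_d | forall i, - M <= x 0 i <= M].
have [A0|/set0P A0] := eqVneq A set0.
  by exists 0 => // x hx; have : A x by []; rewrite A0.
have cN : {within A, continuous (fun x => `|g x|)}.
  apply: continuous_subspaceT => x; apply: continuous_comp; first exact: cg.
  exact: norm_continuous.
have [c _ H] := EVT_max_rV A0 (@compact_cube M) cN.
by exists `|g c| => // x hx; apply: H; rewrite inE.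
Qed.

(* Move from x to y one coordinate at a time. *)
Lemma Ck1_lipschitz g (M : R) : Ck setT 1 g -> exists2 L : R, 0 <= L &
  forall x y, (forall i, - M <= x 0 i <= M) -> (forall i, - M <= y 0 i <= M) ->
  `|g x - g y| <= L * enorm (x - y).
Proof.
move=> Cg.
have bD (i : 'I_d) : exists K : R, 0 <= K /\
    forall x, (forall i, - M <= x 0 i <= M) -> `|'D_(Defs.basis i) g x| <= K.
  have [K K0 HK] := continuous_bounded_cube M (Ck_continuous (Ck_derive i Cg)).
  by exists K.
have [K HK] := choice bD.
exists (\sum_i K i) => [|x y hx hy]; first by apply: sumr_ge0 => i _; have [] := HK i.
pose z (k : nat) : 'rV[R]_d := \row_i (if (i < k)%N then y 0 i else x 0 i).
have z0 : z 0%N = x by apply/rowP => i; rewrite mxE.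
have zd : z d = y by apply/rowP => i; rewrite mxE ltn_ord.
have hz k i : - M <= z k 0 i <= M by rewrite mxE; case: ifP.
have step (k : 'I_d) : `|g (z k) - g (z k.+1)| <= K k * enorm (x - y).
  have e : z k.+1 = (y 0 k - x 0 k) *: Defs.basis k + z k.
    apply/rowP => i; rewrite !mxE eqxx/= ltnS.
    have [->|ik] := eqVneq i k; first by rewrite leqnn ltnn mulr1 subrK.
    rewrite mulr0 add0r leq_eqVlt.
    by rewrite (_ : ((i : nat) == k) = false)//; apply/negbTE.
  have zk : z k = 0 *: Defs.basis k + z k by rewrite scale0r add0r.
  rewrite e [X in g X - _]zk.
  have [K0 bK] := HK k.
  apply: (@le_trans _ _ (K k * `|0 - (y 0 k - x 0 k)|)); last first.
    apply: ler_wpM2l => //; rewrite sub0r opprB.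
    by have := coord_le_enorm (x - y) k; rewrite !mxE.
  apply: (@lipschitz_of_derive _ (fun t => g (t *: Defs.basis k + z k))
    (fun t => 'D_(Defs.basis k) g (t *: Defs.basis k + z k))) => // t ht.
    exact/is_derive_on_line/(CkS_derive k _ Cg).
  apply: bK => i.
  have -> : (t *: Defs.basis k + z k) 0 i = t * (i == k)%:R + z k 0 i.
    by rewrite !mxE eqxx.
  have [->|ik] := eqVneq i k; last by rewrite mulr0 add0r.
  have -> : z k 0 k = x 0 k by rewrite mxE ltnn.
  rewrite mulr1; have /andP[a1 a2] := hx k; have /andP[a3 a4] := hy k.
  move: ht; rewrite ge_min le_max => /andP[/orP[h1|h1] /orP[h2|h2]];
  by apply/andP; split; lra.
rewrite -{1}z0 -{1}zd mulr_suml.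
have -> : g (z 0%N) - g (z d) = \sum_(k < d) (g (z k) - g (z k.+1)).
  rewrite -(big_mkord xpredT (fun k => g (z k) - g (z k.+1))).
  rewrite -[LHS]opprB -(telescope_sumr (g \o z) (leq0n d)) -sumrN.
  by apply: eq_bigr => k _ /=; rewrite opprB.
apply: le_trans (ler_norm_sum _ _ _) _.
by apply: ler_sum => k _; exact: step.
Qed.

End C1_lipschitz.

Section boundary_measure.
Context {R : realType} {d : nat}.
Implicit Types (A : set 'rV[R]_d) (p e x : 'rV[R]_d) (g : 'rV[R]_d -> R).

Lemma continuous_height e g : continuous g -> continuous (height e g).
Proof.
move=> cg x; have cdot : {for x, continuous (fun y => dot y e)}.
  have := Ck_continuous (@Ck_sum R d 0 _ (index_enum _)
    (fun i (y : 'rV[R]_d) => y 0 i * e 0 i) _).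
  by apply => i; apply: Ck_mul; [exact: Ck_coord|exact: Ck_cst].
have cproj : {for x, continuous (fun y : 'rV[R]_d => y - dot y e *: e)}.
  apply: (@cvgB _ _ _ (nbhs x) (nbhs_filter x)); first exact: cvg_id.
  exact: (@cvgZr_tmp _ _ _ (nbhs x) (nbhs_filter x) _ _ e cdot).
have cc : {for x, continuous (fun y : 'rV[R]_d => g (y - dot y e *: e))}.
  exact: (continuous_comp cproj (cg _)).
exact: (continuousB cdot cc).
Qed.

(** By continuity of the height, a point of negative height is interior to A, and a point of
    positive height has a neighbourhood disjoint from A; neither is a boundary point. *)
Lemma boundary_height0 A p e g : Ck setT 2 g -> local_hypograph A p e g ->
  exists2 r : R, 0 < r & forall x, boundary A x -> eball p r x -> height e g x = 0.
Proof.
move=> Cg [_ /nbhs_eballP[r r0 hA]]; exists r => // x [cx ix] px.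
have ch := @continuous_height e g (Ck_continuous Cg).
have nb : nbhs x (eball p r) by apply: open_nbhs_nbhs; split => //; exact: open_eball.
have [h|h|//] := ltgtP (height e g x) 0; exfalso.
- apply: ix.
  have := ch x _ (open_nbhs_nbhs (conj (@open_lt R 0) h)).
  by move=> /(filterI nb); apply: filterS => y [/hA]/= ->.
- have := ch x _ (open_nbhs_nbhs (conj (@open_gt R 0) h)).
  move=> /(filterI nb)/cx[y [Ay [/hA]]] /=.
  by move=> [h1 _] h2; have := lt_trans (h1 Ay) h2; rewrite ltxx.
Qed.

(** The boundary is locally the graph of g over the hyperplane orthogonal to e. Instead of an
    orthonormal basis of that hyperplane, its points are parametrised by all coordinates but one. *)
Lemma local_boundary_lty A p : C2_boundary A -> boundary A p -> (1 < d)%N ->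
  exists2 r : R, 0 < r &
    (surf_outer R d (boundary A `&` eball p r) < +oo)%E.
Proof.
move=> A2 /A2[e [g [Cg hyp]]] d1; have [e1 _] := hyp.
have [r r0 H0] := boundary_height0 Cg hyp; exists r => //.
pose pr (x : 'rV[R]_d) : 'rV[R]_d := x - dot x e *: e.
(* Points of the ball have norm below |p| + r, and [pr] at most doubles the norm. *)
pose M := 2 * (enorm p + r).
have M0 : 0 < M by rewrite mulr_gt0// ltr_wpDl// enorm_ge0.
have [L L0 HL] := Ck1_lipschitz M (CkS Cg).
have ndot x : `|dot x e| <= enorm x.
  rewrite ler_norml; apply/andP; split.
    have := dot_le_enorm (- x) e; rewrite enormN e1 mulr1 -scaleN1r dotZl; lra.
  by have := dot_le_enorm x e; rewrite e1 mulr1.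
have prle x : enorm (pr x) <= 2 * enorm x.
  apply: le_trans (enormD _ _) _; rewrite enormN enormZ e1 mulr1.
  by have := ndot x; lra.
have prM x : eball p r x -> forall i, - M <= pr x 0 i <= M.
  move=> px i; rewrite -ler_norml; apply: le_trans (coord_le_enorm _ _) _.
  apply: le_trans (prle x) _; rewrite /M ler_pM2l//.
  by have := enormD (x - p) p; rewrite subrK; move: px; rewrite /eball/=; lra.
have lin (x y : 'rV[R]_d) : pr (x - y) = pr x - pr y.
  rewrite /pr dotDl -scaleN1r dotZl mulN1r scalerBl scaleN1r opprD opprK.
  by rewrite [in RHS]opprB [dot y e *: e - y]addrC [in RHS]addrACA.
have [i0 ei0] : exists i, e 0 i != 0.
  apply: contrapT => /forallNP h; have : enorm e = 0.
    apply/eqP; rewrite -sqrf_eq0 sqr_enorm /dot big1// => i _.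
    by have := h i; move=> /negP; rewrite negbK => /eqP ->; rewrite mul0r.
  by rewrite e1 => /eqP; rewrite oner_eq0.
(* Drops a coordinate [i0] with e_i0 nonzero; on vectors orthogonal to e it can be recovered from
   the others. *)
pose q (y : 'rV[R]_d) : 'rV[R]_d.-1 := \row_j (y 0 (lift i0 j)).
have qlin (x y : 'rV[R]_d) : q (x - y) = q x - q y by apply/rowP => j; rewrite !mxE.
have coordq (y : 'rV[R]_d) i : i != i0 -> `|y 0 i| <= `|q y|.
  move=> ii0; have [j hj] : exists j, i = lift i0 j.
    by case: (unliftP i0 i) ii0 => [j ->|->]; [exists j|rewrite eqxx].
  by have := coord_le_norm (q y) j; rewrite mxE -hj.
have orth x : dot (pr x) e = 0.
  rewrite /pr dotDl -scaleNr dotZl -[dot e e]sqr_enorm e1 expr1n mulr1.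
  by rewrite subrr.
(* Orthogonality gives |y_i0| <= |e_i0|^-1 times the sum of the other |y_i|, as the coordinates of e
   are at most 1 in absolute value; the summand 1 accounts for those others. *)
pose c : R := 1 + `|e 0 i0|^-1.
have c0 : 0 <= c by rewrite addr_ge0// invr_ge0.
have eorth (y : 'rV[R]_d) : dot y e = 0 -> enorm y <= c * d%:R * `|q y|.
  move=> ye; apply: le_trans (enorm_le_sum y) _.
  have sq : \sum_(i | i != i0) `|y 0 i| <= d%:R * `|q y|.
    apply: (@le_trans _ _ (\sum_(i < d | i != i0) `|q y|)).
      by apply: ler_sum => i; exact: coordq.
    apply: (@le_trans _ _ (\sum_(i < d) `|q y|)).
      by rewrite [leRHS](bigID (fun i => i != i0))/= lerDl sumr_ge0.
    by rewrite sumr_const card_ord mulr_natl.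
  have yi0 : `|y 0 i0| <= `|e 0 i0|^-1 * \sum_(i | i != i0) `|y 0 i|.
    rewrite -ler_pdivrMl ?invr_gt0 ?normr_gt0// invrK mulrC -normrM.
    have -> : y 0 i0 * e 0 i0 = - \sum_(i | i != i0) y 0 i * e 0 i.
      by move: ye; rewrite /dot (bigD1 i0)//= => /eqP; rewrite addr_eq0 => /eqP.
    rewrite normrN; apply: le_trans (ler_norm_sum _ _ _) _.
    apply: ler_sum => i _; rewrite normrM ler_piMr//.
    by rewrite -e1; exact: coord_le_enorm.
  rewrite (bigD1 i0)//= -mulrA; apply: (@le_trans _ _ (c * \sum_(i | i != i0) `|y 0 i|)).
    by rewrite /c mulrDl mul1r addrC lerD2l.
  by rewrite ler_wpM2l.
apply: (@hausdorff_lipschitz_image R d d.-1 _ (fun x => q (pr x)) M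
  ((L + 1) * (c * d%:R))) => //.
- by rewrite mulr_ge0 ?addr_ge0// mulr_ge0.
- move=> x [_ px]; apply: norm_le_coord (ltW M0) _ => j.
  by rewrite mxE ler_norml; exact: prM.
move=> x y [bx px] [by_ py].
have hx : dot x e = g (pr x) by apply/eqP; rewrite -subr_eq0; apply/eqP; exact: H0.
have hy : dot y e = g (pr y) by apply/eqP; rewrite -subr_eq0; apply/eqP; exact: H0.
have -> : x - y = (g (pr x) - g (pr y)) *: e + (pr x - pr y).
  rewrite -hx -hy -lin /pr dotDl -[- y]scaleN1r dotZl mulN1r scaleN1r.
  by rewrite [RHS]addrC subrK.
apply: le_trans (enormD _ _) _; rewrite enormZ e1 mulr1.
have h1 : enorm (pr x - pr y) <= c * d%:R * `|q (pr x) - q (pr y)|.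
  by rewrite -lin -qlin -lin; apply/eorth/orth.
have h2 := HL _ _ (prM x px) (prM y py).
rewrite -mulrA mulrDl mul1r; apply: lerD => //.
by apply: le_trans h2 _; rewrite ler_wpM2l.
Qed.

Lemma bounded_boundary A : bounded_set A -> bounded_set (boundary A).
Proof.
move=> bA; have [M M0 hM] := bounded_enorm bA.
exists M; split; first exact: num_real.
move=> N MN x [cx _]; apply: le_trans (norm_le_enorm x) _.
rewrite leNgt; apply/negP => Nx.
have o : open [set y : 'rV[R]_d | N < enorm y].
  have -> : [set y : 'rV[R]_d | N < enorm y] = (@enorm R d) @^-1` [set t | N < t] by [].
  apply: open_comp; last exact: open_gt.
  by move=> y _; exact: continuous_enorm.
have [y [Ay /=]] := cx _ (open_nbhs_nbhs (conj o Nx)).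
by move=> Ny; have := lt_trans MN (lt_le_trans Ny (hM y Ay)); rewrite ltxx.
Qed.

Lemma boundary_lty A : C2_boundary A -> bounded_set A -> (1 < d)%N ->
  (surf_outer R d (boundary A) < +oo)%E.
Proof.
move=> A2 bA d1; set G := boundary A.
have cG : compact G.
  apply: bounded_closed_compact.
    exact: bounded_boundary.
  have -> : G = closure A `&` ~` (interior A) by [].
  apply: closedI; first exact: closed_closure.
  by apply: open_closedC; exact: open_interior.
have ex p : exists r : R, 0 < r /\ (G p -> (surf_outer R d (G `&` eball p r) < +oo)%E).
  have [Gp|Gp] := pselect (G p); last by exists 1.
  by have [r r0 h] := local_boundary_lty A2 Gp d1; exists r.
have [r Hr] := choice ex.
have := cG; rewrite compact_cover => /(_ _ G (fun p => eball p (r p))).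
case=> [p _|p Gp|D' D'G cover]; first exact: open_eball.
  by exists p => //; apply: eball_center; have [] := Hr p.
have sub : G `<=` \big[setU/set0]_(p <- finmap.enum_fset D') (G `&` eball p (r p)).
  move=> x Gx; have [p pD xp] := cover x Gx.
  by rewrite -bigcup_fset; exists p.
apply: le_lt_trans (le_outer_measure (surf_outer R d) _ _ sub) _.
apply: le_lt_trans (outer_measure_finU _ (surf_outer R d) _) _.
rewrite big_seq; apply: lte_sum_pinfty => p pD.
have [_] := Hr p; apply; have := D'G p pD; by rewrite inE.
Qed.

End boundary_measure.

(** * Decay of the fundamental solution *)

Section fundamental_solution.
Context {R : realType}.
Local Open Scope complex_scope.
Local Notation re := (@complex.Re _).
Local Notation im := (@complex.Im _).
Implicit Types (k r : R).

Definition radiating (d : nat) (P : R -> R) := exists P1 : R -> R, exists C r1 : R,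
  [/\ forall r, 0 < r -> is_derive r 1 P (P1 r), 0 < C, 0 < r1 &
      forall r, r1 <= r -> `|P r| <= C * r `^ ((1 - d%:R) / 2) /\
        `|P1 r| <= C * r `^ ((1 - d%:R) / 2)].

Lemma radiating_scale d P (c : R) : radiating d P -> radiating d (fun r => c * P r).
Proof.
move=> [P1 [C [r1 [dP C0 r10 H]]]].
exists (fun r => c * P1 r), ((1 + `|c|) * C), r1; split => //.
- by move=> r r0; exact: is_derive_fscale (dP r r0).
- by rewrite mulr_gt0// ltr_pwDl.
have aux (x y : R) : 0 <= y -> `|x| <= C * y -> `|c * x| <= (1 + `|c|) * C * y.
  move=> y0 h; rewrite normrM -mulrA; apply: ler_pM => //.
  by rewrite lerDr.
by move=> r /H[h1 h2]; split; apply: aux; rewrite ?powR_ge0.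
Qed.

Lemma radiating_bessel k (f f1 : R -> R) : 0 < k -> bessel_sol f f1 ->
  radiating 2 (fun r => f (k * r)).
Proof.
move=> k0 Hf; have [C C0 HC] := bessel_sol_decay Hf; have [f2 df] := Hf.
have kn : k != 0 by rewrite gt_eqF.
(* The factor 1 + k covers both the profile and its derivative, which carries a factor k; the decay
   of the Bessel solution holds from k r = 1 on. *)
exists (fun r => f1 (k * r) * k), (C / Num.sqrt k * (1 + k)), k^-1; split.
- move=> r r0; have [h _ _] := df (k * r) (mulr_gt0 k0 r0).
  apply: (is_derive_eqr (is_derive_comp (is_derive_fscale k (is_derive1_id r)) h)).
  by rewrite mulr1.
- by rewrite mulr_gt0 ?addr_gt0// divr_gt0// sqrtr_gt0.
- by rewrite invr_gt0.
move=> r rk; have r0 : 0 < r by apply: lt_le_trans rk; rewrite invr_gt0.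
have kr : 1 <= k * r by rewrite -ler_pdivrMl// mulr1.
have -> : r `^ ((1 - 2%:R) / 2) = (Num.sqrt r)^-1.
  have -> : (1 - 2%:R) / 2 = - 2^-1 :> R by lra.
  by rewrite powRN powR12_sqrt// ltW.
have D0 : 0 <= C / Num.sqrt k / Num.sqrt r.
  by rewrite !divr_ge0 ?sqrtr_ge0// ltW.
have e : C / Num.sqrt (k * r) = C / Num.sqrt k / Num.sqrt r.
  by rewrite sqrtrM ?ltW// invfM mulrA.
have [h1 h2] := HC (k * r) kr; rewrite e in h1 h2.
rewrite mulrAC mulrDr mulr1; split.
  by apply: le_trans h1 _; rewrite lerDl mulr_ge0// ltW.
rewrite normrM (gtr0_norm k0); apply: (@le_trans _ _ (C / Num.sqrt k / Num.sqrt r * k)).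
  by rewrite ler_wpM2r// ltW.
by rewrite lerDr.
Qed.

Lemma radiating_trig k (g g1 : R -> R) : 0 < k ->
  (forall t : R, is_derive t 1 g (g1 t)) -> (forall t, `|g t| <= 1 /\ `|g1 t| <= 1) ->
  radiating 3 (fun r => g (k * r) / (4 * pi * r)).
Proof.
move=> k0 dg bg; have pi0 := @pi_gt0 R.
have p4 : 0 < 4 * pi :> R by rewrite mulr_gt0.
exists (fun r => g1 (k * r) * k / (4 * pi * r) - g (k * r) / (4 * pi * r ^+ 2)).
exists ((1 + k) / (4 * pi)), 1; split => //.
- move=> r r0; have rn : r != 0 by rewrite gt_eqF.
  rewrite (_ : (fun r => _) = fun r => g (k * r) * ((4 * pi)^-1 * r^-1)); last first.
    by apply/funext => s; rewrite invfM.
  apply: (is_derive_eqr (is_derive_fmul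
    (is_derive_comp (is_derive_fscale k (is_derive1_id r)) (dg (k * r)))
    (is_derive_fscale _ (is_derive1_inv rn)))).
  by rewrite /= expr2 !invfM; ring.
- by rewrite divr_gt0// addr_gt0.
move=> r r1; have r0 := lt_le_trans ltr01 r1.
have -> : r `^ ((1 - 3%:R) / 2) = r^-1.
  have -> : (1 - 3%:R) / 2 = -1 :> R by lra.
  by rewrite powR_inv1// ltW.
have [h1 h2] := bg (k * r).
have q0 : 0 < (4 * pi)^-1 :> R by rewrite invr_gt0.
have i0 : 0 <= r^-1 by rewrite invr_ge0 ltW.
have i1 : r^-1 <= 1 by rewrite invf_le1.
have qr : 0 <= (4 * pi)^-1 * r^-1 by rewrite mulr_ge0// ltW.
have b1 : `|g (k * r) * ((4 * pi)^-1 * r^-1)| <= (4 * pi)^-1 * r^-1.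
  by rewrite normrM (ger0_norm qr) ler_piMl.
have kq : 0 <= k * ((4 * pi)^-1 * r^-1) by rewrite mulr_ge0// ltW.
have e : (1 + k) / (4 * pi) * r^-1 = (4 * pi)^-1 * r^-1 + k * ((4 * pi)^-1 * r^-1).
  by rewrite -mulrA mulrDl mul1r.
rewrite e; split.
  by rewrite invfM; apply: le_trans b1 _; rewrite lerDl.
have -> : g1 (k * r) * k / (4 * pi * r) - g (k * r) / (4 * pi * r ^+ 2) =
    g1 (k * r) * (k * ((4 * pi)^-1 * r^-1)) - g (k * r) * ((4 * pi)^-1 * r^-1) * r^-1.
  by rewrite expr2 !invfM; ring.
apply: le_trans (ler_normB _ _) _; rewrite addrC; apply: lerD.
  rewrite normrM (ger0_norm i0); apply: le_trans (ler_piMr _ i1) b1.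
  exact: normr_ge0.
by rewrite normrM (ger0_norm kq) ler_piMl.
Qed.

Lemma Phi_profile (d : nat) k : d = 2%N \/ d = 3%N -> 0 < k ->
  exists P Q : R -> R, [/\ radiating d P, radiating d Q &
    forall x y : 'rV[R]_d, re (Phi k x y) = P (enorm (x - y)) /\
      im (Phi k x y) = Q (enorm (x - y))].
Proof.
move=> [->|->] k0.
  have [j Hj] := @bessel_sol_J0 R; have [y Hy] := @bessel_sol_Y0 R.
  exists (fun r => - 4^-1 * besselY0 (k * r)), (fun r => 4^-1 * besselJ0 (k * r)); split.
  - exact: radiating_scale (radiating_bessel k0 Hy).
  - exact: radiating_scale (radiating_bessel k0 Hj).
  move=> x z; rewrite /Phi eqxx.
  have -> : (0 +i* 1) / 4 = 0 +i* 4^-1 :> R[i].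
    have -> : (4 : R[i]) = 4%:C by rewrite rmorph_nat.
    rewrite -fmorphV; apply/eqP; rewrite eq_complex/=.
    by apply/andP; split; apply/eqP; ring.
  by rewrite /hankel0; split => /=; ring.
exists (fun r => cos (k * r) / (4 * pi * r)), (fun r => sin (k * r) / (4 * pi * r)).
split.
- apply: (@radiating_trig k cos (fun t => - sin t)) => // t.
  by rewrite normrN !ler_norml cos_geN1 cos_le1 sin_geN1 sin_le1.
- apply: (@radiating_trig k sin cos) => // t.
  by rewrite !ler_norml cos_geN1 cos_le1 sin_geN1 sin_le1.
move=> x z; rewrite /Phi (_ : (3 == 2)%N = false)// -fmorphV.
by split => /=; ring.
Qed.

Section uniform_bounds.
Variables (d : nat) (P : R -> R).
Hypothesis rP : radiating d P.
Hypothesis d1 : (1 < d)%N.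
Implicit Types (x y z : 'rV[R]_d).

(** The mean value inequality is applied to the profile between the two distances and not along the
    segment from x to x', which might come near z: every intermediate radius is still at least s. *)
Lemma radiating_far : exists C r1 : R, [/\ 0 < C, 0 < r1 &
  forall (s : R) x x' z, r1 <= s -> s <= enorm (x - z) -> s <= enorm (x' - z) ->
   `|P (enorm (x - z))| <= C * s `^ ((1 - d%:R) / 2) /\
   `|P (enorm (x - z)) - P (enorm (x' - z))| <=
      C * s `^ ((1 - d%:R) / 2) * enorm (x - x')].
Proof.
have [P1 [C [r1 [dP C0 r10 H]]]] := rP; exists C, r1; split => //.
move=> s x x' z s1 sx sx'; have s0 := lt_le_trans r10 s1.
have mono r : s <= r -> r `^ ((1 - d%:R) / 2) <= s `^ ((1 - d%:R) / 2).
  move=> sr; have e : (1 - d%:R) / 2 = - ((d%:R - 1) / 2) :> R by lra.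
  rewrite e !powRN lef_pV2 ?posrE ?powR_gt0//; last exact: lt_le_trans sr.
  apply: ge0_ler_powR; rewrite ?nnegrE ?(ltW s0)//.
    by rewrite divr_ge0// subr_ge0 ler1n ltnW.
  exact: le_trans (ltW s0) sr.
have CH r : s <= r -> `|P r| <= C * s `^ ((1 - d%:R) / 2) /\
    `|P1 r| <= C * s `^ ((1 - d%:R) / 2).
  move=> sr; have [h1 h2] := H r (le_trans s1 sr).
  by split; [apply: le_trans h1 _|apply: le_trans h2 _];
    rewrite ler_pM2l//; exact: mono.
split; first by have [] := CH _ sx.
have K0 : 0 <= C * s `^ ((1 - d%:R) / 2) by rewrite mulr_ge0 ?powR_ge0// ltW.
have ge_s t : Num.min (enorm (x - z)) (enorm (x' - z)) <= t -> s <= t.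
  by apply: le_trans; rewrite le_min sx.
apply: le_trans (@lipschitz_of_derive _ P P1 _ _ _ K0 _ _) _.
- by move=> t /andP[/ge_s h _]; apply: dP; exact: lt_le_trans h.
- by move=> t /andP[/ge_s h _]; have [] := CH t h.
apply: ler_wpM2l => //; apply: le_trans (ler_dist_enorm _ _) _.
by rewrite opprB addrA subrK.
Qed.

Lemma radiating_near (a b : R) : 0 < a -> exists2 M : R, 0 <= M &
  forall r, a <= r <= b -> `|P r| <= M.
Proof.
move=> a0; have [P1 [C [r1 [dP _ _ _]]]] := rP.
apply: continuous_bounded_segment => t /andP[at_ _].
apply: (is_derive1_continuous (dP t _)); exact: lt_le_trans at_.
Qed.

Lemma radiating_continuous z x : 0 < enorm (x - z) ->
  {for x, continuous (fun x => P (enorm (x - z)))}.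
Proof.
move=> xz; have [P1 [C [r1 [dP _ _ _]]]] := rP.
have cP := is_derive1_continuous (dP _ xz).
have cs : {for x, continuous (fun x : 'rV[R]_d => x - z)}.
  exact: (@cvgB _ _ _ (nbhs x) (nbhs_filter x) id (cst z) x z (@cvg_id _ _) (@cvg_cst _ _ _ _ _)).
exact: (continuous_comp (continuous_comp cs (@continuous_enorm _ _ _)) cP).
Qed.

End uniform_bounds.

End fundamental_solution.

(** * The weak Helmholtz equation off D, in real form *)

Lemma Rintegral_ae_eq {R : realType} (dm : measure_display) (T : measurableType dm)
  (mu : {measure set T -> \bar R}) (f h : T -> R) (N : set T) :
  measurable N -> mu N = 0%E ->
  measurable_fun setT f -> measurable_fun setT h -> (forall x, ~ N x -> f x = h x) ->
  \int[mu]_x f x = \int[mu]_x h x.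
Proof.
move=> mN N0 mf mh fh; rewrite /Rintegral; congr fine.
apply: ae_eq_integral => //; try exact/measurable_EFinP.
exists N; split => // x /= nfh; apply: contrapT => Nx.
by apply: nfh => _; rewrite (fh x Nx).
Qed.

(** Where q phi = 0 the coefficient of u is the real number l + k^2 phi, so the complex equation
    decouples into the same real equation for both parts of u. *)
Lemma Rintegral_contrast {R : realType} (dm : measure_display) (T : measurableType dm)
  (mu : {measure set T -> \bar R}) (k : R) (q u : T -> R[i]) (phi l : T -> R) (N : set T) :
  measurable N -> mu N = 0%E -> (forall x, ~ N x -> q x * (phi x)%:C%C = 0) ->
  complex_measurable setT q -> complex_measurable setT u ->
  measurable_fun setT phi -> measurable_fun setT l ->
  complex_integral mu setT
    (fun x => u x * (l x)%:C%C + (k ^+ 2)%:C%C * (1 + q x) * u x * (phi x)%:C%C) =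
  ((\int[mu]_x (complex.Re (u x) * (l x + k ^+ 2 * phi x))) +i*
   (\int[mu]_x (complex.Im (u x) * (l x + k ^+ 2 * phi x))))%C.
Proof.
move=> mN N0 Nq [mqr mqi] [mur mui] mphi ml.
pose F x := u x * (l x)%:C%C + (k ^+ 2)%:C%C * (1 + q x) * u x * (phi x)%:C%C.
have FN x : ~ N x -> F x = u x * (l x + k ^+ 2 * phi x)%:C%C.
  move=> /Nq e; rewrite /F.
  have -> : (k ^+ 2)%:C%C * (1 + q x) * u x * (phi x)%:C%C =
      (k ^+ 2)%:C%C * (u x * (phi x)%:C%C) +
      (k ^+ 2)%:C%C * u x * (q x * (phi x)%:C%C) by ring.
  by rewrite e mulr0 addr0 rmorphD rmorphM; ring.
have reF x : complex.Re (F x) = complex.Re (u x) * l x + k ^+ 2 * phi x *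
    ((1 + complex.Re (q x)) * complex.Re (u x) - complex.Im (q x) * complex.Im (u x)).
  by rewrite /F; case: (u x) (q x) => a b [e f] /=; ring.
have imF x : complex.Im (F x) = complex.Im (u x) * l x + k ^+ 2 * phi x *
    ((1 + complex.Re (q x)) * complex.Im (u x) + complex.Im (q x) * complex.Re (u x)).
  by rewrite /F; case: (u x) (q x) => a b [e f] /=; ring.
have mk : measurable_fun setT (fun x => k ^+ 2 * phi x).
  exact: measurable_funM.
rewrite /complex_integral; congr (_ +i* _)%C; apply: (Rintegral_ae_eq mN N0).
- apply: eq_measurable_fun (fun x _ => esym (reF x)) _.
  apply: measurable_funD; first exact: measurable_funM.
  apply: measurable_funM => //; apply: measurable_funB; apply: measurable_funM => //.
  exact: measurable_funD.
- by apply: measurable_funM => //; exact: measurable_funD.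
- by move=> x /FN; rewrite /F => ->; case: (u x) => a b /=; ring.
- apply: eq_measurable_fun (fun x _ => esym (imF x)) _.
  apply: measurable_funD; first exact: measurable_funM.
  apply: measurable_funM => //; apply: measurable_funD; apply: measurable_funM => //.
  exact: measurable_funD.
- by apply: measurable_funM => //; exact: measurable_funD.
- by move=> x /FN; rewrite /F => ->; case: (u x) => a b /=; ring.
Qed.

Section scattering_bounds.
Context {R : realType} {d : nat}.
Local Open Scope complex_scope.
Local Notation re := (@complex.Re _).
Local Notation im := (@complex.Im _).
Local Notation T := (caratheodory_type (leb_outer R d)).
Local Notation mu := (leb R d).
Implicit Types (k : R) (D G : set 'rV[R]_d) (q u g : 'rV[R]_d -> R[i]).

Lemma L2loc_measurable u : L2loc u -> complex_measurable (setT : set T) u.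
Proof.
by move=> h; split; apply: measurable_leb_eballs => r; have [[]] := h r.
Qed.

Lemma test_laplacian_measurable (phi : 'rV[R]_d -> R) : test_function phi ->
  measurable_fun (setT : set T) (phi : T -> R) /\
  measurable_fun (setT : set T) (laplacian phi : T -> R).
Proof.
move=> [Cphi _]; split.
  by apply: continuous_measurable_leb; [exact: openT|move=> x _; exact: (Ck_continuous (Cphi 0%N))].
apply: continuous_measurable_leb; first exact: openT.
move=> x _; apply: (@Ck_continuous _ _ 0%N); apply: Ck_sum => i.
by apply: Ck_derive; apply: Ck_derive; exact: Cphi.
Qed.


Lemma scattered_test k D q g u (phi : 'rV[R]_d -> R) :
  Linfty q -> (\forall x \ae mu, (~` closure D) x -> q x = 0) ->
  L2loc u -> helmholtz k q (fun x => - (k ^+ 2)%:C * q x * g x) u ->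
  test_function phi -> (forall y, closure D y -> phi y = 0) ->
  \int[mu]_y (re (u y) * (laplacian phi y + k ^+ 2 * phi y)) = 0 /\
  \int[mu]_y (im (u y) * (laplacian phi y + k ^+ 2 * phi y)) = 0.
Proof.
move=> [[mqr mqi] _] [N [mN N0 qN]] Lu hu tphi phiD.
have [mur mui] := L2loc_measurable Lu.
have [mphi mlap] := test_laplacian_measurable tphi.
have qphi y : ~ N y -> q y * (phi y)%:C = 0.
  move=> Ny; have [/phiD ->|Dy] := pselect (closure D y); first by rewrite mulr0.
  suff -> : q y = 0 by rewrite mul0r.
  by apply: contrapT => qy; apply/Ny/qN => /(_ Dy).
have := hu phi tphi.
rewrite (Rintegral_contrast _ mN N0 qphi (conj mqr mqi) (conj mur mui) mphi mlap).
(* The source contains [g], whose measurability is unknown, so [Rintegral_negligible] is used: the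
   integrand vanishes off the null set N. *)
have rhs0 (F : R[i] -> R) : F 0 = 0 ->
    \int[mu]_x F (- (k ^+ 2)%:C * q x * g x * (phi x)%:C) = 0.
  move=> F0; apply: (Rintegral_negligible N0) => x /qphi e.
  by rewrite mulrAC -(mulrA _ (q x)) e mulr0 mul0r.
rewrite /complex_integral (rhs0 (@complex.Re _))// (rhs0 (@complex.Im _))//.
by case.
Qed.

End scattering_bounds.

Local Notation normc := (@ComplexField.Normc.normc _).

Lemma normc_sqrE {R : realType} (z : R[i]) :
  normc z ^+ 2 = complex.Re z ^+ 2 + complex.Im z ^+ 2.
Proof. by case: z => a b /=; rewrite sqr_sqrtr// addr_ge0// sqr_ge0. Qed.

Lemma normc_le_ReIm {R : realType} (z : R[i]) :
  normc z <= `|complex.Re z| + `|complex.Im z|.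
Proof.
rewrite -[leLHS]ger0_norm; last by case: z => a b; exact: sqrtr_ge0.
rewrite -ler_sqr ?nnegrE ?addr_ge0// real_normK ?num_real// normc_sqrE sqrrD.
by rewrite !real_normK ?num_real// -addrA lerD2l lerDr mulrn_wge0// mulr_ge0.
Qed.

Lemma norm_le_sqr {R : realFieldType} (a : R) : `|a| <= 1 + a ^+ 2.
Proof. by case: ler0P => _; nra. Qed.

(** W = 1 + |u|^2 on A and 0 elsewhere. The inequality |a| <= 1 + a^2 turns an L^2 bound into an
    integrable majorant of both parts of u and of 1, the weight required by the interior
    estimate. *)
Lemma L2_dominating_function {R : realType} (dm : measure_display)
  (T : measurableType dm) (mu : {measure set T -> \bar R}) (A : set T) (u : T -> R[i])
  (m M : R) : measurable A -> (mu A <= m%:E)%E -> complex_measurable A u ->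
  (\int[mu]_(x in A) ((normc (u x)) ^+ 2)%:E <= M%:E)%E ->
  exists W : T -> R, [/\ mu.-integrable setT (EFin \o W), forall x, 0 <= W x,
    forall x, A x -> [/\ `|complex.Re (u x)| <= W x, `|complex.Im (u x)| <= W x & 1 <= W x] &
    \int[mu]_x W x <= m + M].
Proof.
move=> mA muA [mr mi] IM; pose g x := 1 + normc (u x) ^+ 2.
have g0 x : 0 <= g x by rewrite addr_ge0// sqr_ge0.
have mN : measurable_fun A (fun x => normc (u x) ^+ 2).
  apply: eq_measurable_fun (fun x _ => esym (normc_sqrE (u x))) _.
  by apply: measurable_funD; apply: measurable_funX.
have mg : measurable_fun A g by exact: measurable_funD.
have Ig : (\int[mu]_(x in A) (g x)%:E <= (m + M)%:E)%E.
  under eq_integral do rewrite EFinD.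
  rewrite ge0_integralD//; last 2 first.
  - by move=> x _; rewrite lee_fin sqr_ge0.
  - exact/measurable_EFinP.
  by rewrite integral_cst// mul1e EFinD leeD.
have iW : mu.-integrable setT (EFin \o (g \_ A)).
  rewrite -restrict_EFin; apply/(integrable_mkcond _ mA).
  apply/integrableP; split; first exact/measurable_EFinP.
  apply: le_lt_trans (ltry (m + M)).
  by under eq_integral do rewrite /= ger0_norm//.
exists (g \_ A); split => //.
- by move=> x; rewrite patchE; case: ifP.
- move=> x Ax; rewrite patchE mem_set// /g normc_sqrE.
  split; last by rewrite lerDl addr_ge0 ?sqr_ge0.
    by apply: le_trans (norm_le_sqr _) _; rewrite lerD2l lerDl sqr_ge0.
  by apply: le_trans (norm_le_sqr _) _; rewrite lerD2l lerDr sqr_ge0.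
rewrite /Rintegral -lee_fin fineK ?integrable_fin_num//.
by apply: le_trans Ig; rewrite [leRHS]integral_mkcond restrict_EFin.
Qed.

(** * Distance to D, and positive volume of the unit box *)

Section separation.
Context {R : realType} {d : nat}.
Implicit Types (A B G D : set 'rV[R]_d) (x y : 'rV[R]_d).

Lemma dist_set_le A B x y : A x -> B y -> dist_set A B <= enorm (x - y).
Proof.
move=> Ax By; apply: ge_inf; last by exists x => //; exists y.
by exists 0 => _ [s _ [t _ <-]]; exact: enorm_ge0.
Qed.

Lemma dist_set_le_closure A B x y : A x -> closure B y -> dist_set A B <= enorm (x - y).
Proof.
move=> Ax cBy; rewrite leNgt; apply/negP => xy.
have r0 : 0 < dist_set A B - enorm (x - y) by rewrite subr_gt0.
have [y' [By' yy']] := cBy _ (nbhs_eball y r0).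
have := dist_set_le Ax By'; have := enorm_dist x y' y.
by move: yy'; rewrite /eball/= (enormB y y'); lra.
Qed.

(** If the unit box were null, every set would be negligible and the essential support of q would be
    empty. *)
Lemma leb_unit_box_gt0 (q : 'rV[R]_d -> R[i]) x : ess_support q x ->
  exists2 c : R, 0 < c & leb_outer R d unit_box = c%:E.
Proof.
move=> qx; have u0 : (0 <= leb_outer R d unit_box)%E by exact: outer_measure_ge0.
have uf : leb_outer R d unit_box \is a fin_num.
  by rewrite ge0_fin_numE// (le_lt_trans leb_unit_box_le1)// ltry.
exists (fine (leb_outer R d unit_box)); last by rewrite fineK.
rewrite lt_neqAle fine_ge0// andbT eq_sym; apply/eqP => u1.
apply: (qx setT); first exact: filterT.
have z A := @leb_degenerate R d (etrans (esym (fineK uf)) (congr1 EFin u1)) A.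
by exists setT; split => //; exact: z.
Qed.

Lemma leb_bounded_fin A : bounded_set A -> exists m : R, leb_outer R d A = m%:E.
Proof.
move=> /leb_bounded_lty; have := outer_measure_ge0 (leb_outer R d) A.
by case: (leb_outer R d A) => // m _ _; exists m.
Qed.

Lemma bounded_eball (r : R) : bounded_set (eball (0 : 'rV[R]_d) r).
Proof.
exists r; split; first exact: num_real.
move=> M rM x; rewrite /eball/= subr0 => /ltW xr.
by apply: le_trans (norm_le_enorm x) _; apply: le_trans xr (ltW rM).
Qed.

End separation.

(** * Uniform bounds for the scattered field near Gamma *)

Section scattered_field_bounds.
Context {R : realType} {d : nat}.
Local Notation re := (@complex.Re _).
Local Notation im := (@complex.Im _).
Variables (k : R) (D G : set 'rV[R]_d).
Hypotheses (hd : d = 2%N \/ d = 3%N) (k0 : 0 < k).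
Hypotheses (oD : open D) (bD : bounded_set D).
Hypotheses (bG : bounded_set G) (GD : 0 < dist_set G D).

(** For x in D and y in G, the distance |x - y| lies in a fixed compact interval away from 0, on
    which the two profiles of Phi are bounded. *)
Lemma incident_bound : exists2 M : R, 0 <= M & forall y, G y ->
  L2 D (fun x => Phi k x y) /\ (sqnorm2 D (fun x => Phi k x y) <= M%:E)%E.
Proof.
have [P [Q [rP rQ PQ]]] := @Phi_profile R d k hd k0.
have [MD MD0 hD] := bounded_enorm bD; have [MG MG0 hG] := bounded_enorm bG.
have [A A0 hA] := @radiating_near _ _ _ rP _ (MD + MG) GD.
have [B B0 hB] := @radiating_near _ _ _ rQ _ (MD + MG) GD.
have [m mD] := leb_bounded_fin bD.
have m0 : 0 <= m by rewrite -lee_fin -mD outer_measure_ge0.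
have AB0 : 0 <= A ^+ 2 + B ^+ 2 by rewrite addr_ge0// sqr_ge0.
exists ((A ^+ 2 + B ^+ 2) * m); first exact: mulr_ge0.
move=> y Gy.
have xy x : D x -> dist_set G D <= enorm (x - y) <= MD + MG.
  move=> Dx; rewrite enormB dist_set_le//= enormB.
  apply: le_trans (enormD _ _) _; rewrite enormN.
  by apply: lerD; [exact: hD|exact: hG].
have sq : (sqnorm2 D (fun x => Phi k x y) <= ((A ^+ 2 + B ^+ 2) * m)%:E)%E.
  rewrite /sqnorm2; apply: le_trans (@integral_le_outer _ _ (leb_outer R d) _ _
    (A ^+ 2 + B ^+ 2)%:E _ _) _.
  - by rewrite lee_fin.
  - move=> x Dx; rewrite !lee_fin sqr_ge0 normc_sqrE.
    have [-> ->] := PQ x y; have h := xy x Dx.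
    by apply: lerD; rewrite -(real_normK (num_real _)) lerXn2r ?nnegrE ?hA ?hB.
  - by rewrite mD.
split => //; split; last by apply: le_lt_trans sq _; exact: ltry.
have pos x : D x -> 0 < enorm (x - y).
  by move=> /xy/andP[h _]; exact: lt_le_trans h.
split.
  have -> : re \o (Phi k ^~ y) = (fun x => P (enorm (x - y))).
    by apply/funext => x; have [] := PQ x y.
  by apply: continuous_measurable_leb => // x /pos; exact: radiating_continuous.
have -> : im \o (Phi k ^~ y) = (fun x => Q (enorm (x - y))).
  by apply/funext => x; have [] := PQ x y.
by apply: continuous_measurable_leb => // x /pos; exact: radiating_continuous.
Qed.

Variables (q : 'rV[R]_d -> R[i]) (us : 'rV[R]_d -> 'rV[R]_d -> R[i]).
Hypotheses (q_Linfty : Linfty q).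
Hypotheses (q_exterior : \forall x \ae leb R d, (~` closure D) x -> q x = 0).
Hypotheses (q_support : ess_support q = closure D).
Hypotheses (hwp : well_posed k D q).
Hypotheses (hus : forall y, G y ->
  scattered_field k D q (fun x => Phi k x y) (us ^~ y)).

(** This is where continuous dependence on the data enters: its constant depends on r only, while
    the data Phi(., y) are bounded in L^2(D) uniformly in y. The absolute value of C is taken since
    its sign is unspecified. *)
Lemma scattered_sqnorm_bound (r : R) : exists M : R, forall y, G y ->
  (sqnorm2 (eball 0 r) (us ^~ y) <= M%:E)%E.
Proof.
have [M M0 HM] := incident_bound; have [_ _ /(_ r)[C HC]] := hwp.
exists (`|C| * M) => y Gy; have [LPhi leM] := HM y Gy.
have [[_ [v wv]] _ _ _] := hus Gy.
apply: (@le_trans _ _ (C%:E * sqnorm2 D (fun x => Phi k x y))%E).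
  apply: le_trans (HC _ _ _ LPhi (hus Gy) wv); rewrite leeDl//.
  by apply: sume_ge0 => i _; apply: integral_ge0 => x _; rewrite lee_fin sqr_ge0.
apply: (@le_trans _ _ (`|C|%:E * sqnorm2 D (fun x => Phi k x y))%E).
  apply: lee_wpmul2r; last by rewrite lee_fin ler_norm.
  by apply: integral_ge0 => x _; rewrite lee_fin sqr_ge0.
by rewrite EFinM; apply: lee_wpmul2l => //; rewrite lee_fin.
Qed.

Lemma scattered_field_bound : D !=set0 -> exists B a : R, [/\ 0 < B, 0 < a &
  forall x x' y : 'rV[R]_d, G x -> G y -> enorm (x' - x) < a ->
  [/\ `|re (us x y)| <= B, `|im (us x y)| <= B,
     `|re (us x y) - re (us x' y)| <= B * enorm (x - x') &
     `|im (us x y) - im (us x' y)| <= B * enorm (x - x')]].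
Proof.
move=> [x0 Dx0].
have [c c0 hc] : exists2 c : R, 0 < c & leb_outer R d unit_box = c%:E.
  apply: (@leb_unit_box_gt0 R d q x0); rewrite q_support; exact: subset_closure.
have [MG MG0 hG] := bounded_enorm bG.
(* Half the separation: a point x' within a of G is still at distance at least a from closure D, so
   the ball of radius a around x' carries admissible test functions. The radius r then contains all
   these balls. *)
pose a := dist_set G D / 2; have a0 : 0 < a by rewrite divr_gt0.
pose r := MG + dist_set G D.
have [M HM] := scattered_sqnorm_bound r.
have [m mr] := leb_bounded_fin (@bounded_eball R d r).
have b0 : 0 < a ^+ 2 by rewrite exprn_gt0.
have sb : Num.sqrt (a ^+ 2) = a by rewrite sqrtr_sqr gtr0_norm.
have [C C0 HC] := helmholtz_interior_bound k hd b0 hc c0.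
rewrite sb in HC.
exists (C * (`|m + M| + 1) + 1), a; split => //.
  by rewrite ltr_wpDl// mulr_ge0// addr_ge0.
move=> x x' y Gx Gy xx'.
have [[Lu _] [Cre Cim] hu _] := hus Gy.
have [mre mim] := L2loc_measurable Lu.
have le_m : (leb R d (eball 0 r : set (caratheodory_type (leb_outer R d))) <= m%:E)%E.
  by rewrite -mr.
have mball := open_measurable_leb (@open_eball R d 0 r).
have [W [iW W0 uW IW]] := @L2_dominating_function _ _ _ (leb R d) (eball 0 r)
  (us ^~ y) m M mball le_m (Lu r).1 (HM y Gy).
have IWB : C * \int[leb R d]_z W z <= C * (`|m + M| + 1) + 1.
  apply: ler_wpDr => //; apply: ler_wpM2l => //.
  by apply: le_trans IW _; apply: ler_wpDr => //; exact: ler_norm.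
have zx z : z = x \/ z = x' -> enorm (z - x) < a.
  by move=> [->|->//]; rewrite subrr enorm0.
have zD z t : z = x \/ z = x' -> closure D t -> a <= enorm (t - z).
  move=> /zx h /(dist_set_le_closure Gx) h'; rewrite enormB.
  have := enorm_dist x t z; rewrite (enormB x z) in h h' *.
  by rewrite /a in h *; lra.
have zr z : z = x \/ z = x' -> eball z a `<=` eball 0 r.
  move=> /zx h t; rewrite /eball/= subr0 => tz.
  have := enormD (t - z) (z - x); rewrite addrA subrK => h1.
  have := enormD (t - x) x; rewrite subrK => h2; have := hG _ Gx.
  by rewrite /r; rewrite /a in tz h; lra.
have zc z : z = x \/ z = x' -> (~` closure D) z.
  by move=> hz /(zD _ _ hz); rewrite subrr enorm0 leNgt a0.
have test phi z : z = x \/ z = x' -> test_function phi ->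
    (forall t, a <= enorm (t - z) -> phi t = 0) ->
    \int[leb R d]_t (re (us t y) * (laplacian phi t + k ^+ 2 * phi t)) = 0 /\
    \int[leb R d]_t (im (us t y) * (laplacian phi t + k ^+ 2 * phi t)) = 0.
  move=> hz tphi h; apply: (scattered_test q_Linfty q_exterior Lu hu tphi).
  by move=> t Dt; apply: h; exact: zD.
have fin (w : 'rV[R]_d -> R) :
    measurable_fun (setT : set (caratheodory_type (leb_outer R d))) w ->
    (forall t, eball 0 r t -> `|w t| <= W t /\ 1 <= W t) ->
    (forall z, (~` closure D) z -> {for z, continuous w}) ->
    (forall phi z, z = x \/ z = x' -> test_function phi ->
      (forall t, a <= enorm (t - z) -> phi t = 0) ->
      \int[leb R d]_t (w t * (laplacian phi t + k ^+ 2 * phi t)) = 0) ->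
    `|w x| <= C * (`|m + M| + 1) + 1 /\
    `|w x - w x'| <= (C * (`|m + M| + 1) + 1) * enorm (x - x').
  move=> mw wW cw tw.
  have [|h1 h2] := HC w W (eball 0 r) x x' mw iW W0 wW.
    by move=> z hz; split; [exact: zr|exact: cw (zc _ hz)|move=> phi; exact: tw].
  split; first exact: le_trans h1 IWB.
  by apply: le_trans h2 _; apply: ler_wpM2r => //; exact: enorm_ge0.
have [|||r1 r2] := fin _ mre.
- by move=> t /uW[].
- exact: Cre.1.
- by move=> phi z hz tphi /(test _ _ hz tphi)[].
have [|||i1 i2] := fin _ mim.
- by move=> t /uW[].
- exact: Cim.1.
- by move=> phi z hz tphi /(test _ _ hz tphi)[].
by split.
Qed.

End scattered_field_bounds.

(** * The boundary pairing with a far source *)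

Section far_field.
Context {R : realType} {d : nat}.
Local Open Scope complex_scope.
Local Notation re := (@complex.Re _).
Local Notation im := (@complex.Im _).
Implicit Types (x y z v : 'rV[R]_d).

Lemma derive_le_enorm_lipschitz (f : 'rV[R]_d -> R) x v (a L : R) : 0 < a -> 0 <= L ->
  enorm v <= 1 -> (forall x', enorm (x' - x) < a -> `|f x - f x'| <= L * enorm (x - x')) ->
  `|'D_v f x| <= L.
Proof.
move=> a0 L0 v1 h; apply: (@derive_le_lipschitz _ _ f x v L a L0 a0) => t ta.
have e : enorm (t *: v + x - x) <= `|t|.
  by rewrite addrK enormZ ler_piMr.
rewrite distrC; apply: le_trans (h _ (le_lt_trans e ta)) _.
by rewrite enormB ler_wpM2l.
Qed.

Lemma Phi_far (k : R) : d = 2%N \/ d = 3%N -> 0 < k -> exists C r1 : R, [/\ 0 < C, 0 < r1 &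
  forall (s : R) (x x' z : 'rV[R]_d), r1 <= s -> s <= enorm (x - z) -> s <= enorm (x' - z) ->
  [/\ `|re (Phi k x z)| <= C * s `^ ((1 - d%:R) / 2),
      `|im (Phi k x z)| <= C * s `^ ((1 - d%:R) / 2),
      `|re (Phi k x z) - re (Phi k x' z)| <=
        C * s `^ ((1 - d%:R) / 2) * enorm (x - x') &
      `|im (Phi k x z) - im (Phi k x' z)| <=
        C * s `^ ((1 - d%:R) / 2) * enorm (x - x')]].
Proof.
move=> hd k0; have d1 : (1 < d)%N by case: hd => ->.
have [P [Q [rP rQ PQ]]] := @Phi_profile R d k hd k0.
have [A [rA [A0 rA0 hA]]] := @radiating_far _ _ _ rP d1.
have [B [rB [B0 rB0 hB]]] := @radiating_far _ _ _ rQ d1.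
exists (A + B), (rA + rB); split; rewrite ?addr_gt0// => s x x' z rs sx sx'.
have rAs : rA <= s by apply: le_trans rs; rewrite lerDl ltW.
have rBs : rB <= s by apply: le_trans rs; rewrite lerDr ltW.
have [[-> ->] [-> ->]] := (PQ x z, PQ x' z).
have [a1 a2] := hA s x x' z rAs sx sx'; have [b1 b2] := hB s x x' z rBs sx sx'.
have p0 := powR_ge0 s ((1 - d%:R) / 2); have e0 := enorm_ge0 (x - x').
have pA : 0 <= A * s `^ ((1 - d%:R) / 2) by rewrite mulr_ge0// ltW.
have pB : 0 <= B * s `^ ((1 - d%:R) / 2) by rewrite mulr_ge0// ltW.
rewrite (mulrDl A B); split; rewrite ?(mulrDl _ _ (enorm _)).
- by apply: le_trans a1 _; rewrite lerDl.
- by apply: le_trans b1 _; rewrite lerDr.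
- by apply: le_trans a2 _; rewrite lerDl mulr_ge0.
- by apply: le_trans b2 _; rewrite lerDr mulr_ge0.
Qed.

Lemma complex_product_bound (A B u w : R[i]) (K L : R) :
  `|re A| <= K -> `|im A| <= K -> `|re B| <= K -> `|im B| <= K ->
  `|re u| <= L -> `|im u| <= L -> `|re w| <= L -> `|im w| <= L ->
  `|re (A * u - B * w)| <= 4 * K * L /\ `|im (A * u - B * w)| <= 4 * K * L.
Proof.
case: A B u w => [a1 a2] [b1 b2] [u1 u2] [w1 w2] /= hA1 hA2 hB1 hB2 hu1 hu2 hw1 hw2.
have m (a b : R) : `|a| <= K -> `|b| <= L -> `|a * b| <= K * L.
  by move=> ha hb; rewrite normrM; apply: ler_pM.
have s (a b c e t : R) : `|a| <= t -> `|b| <= t -> `|c| <= t -> `|e| <= t ->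
    `|a + b + (c + e)| <= 4 * t.
  move=> ha hb hc he; apply: le_trans (ler_normD _ _) _.
  by have := ler_normD a b; have := ler_normD c e; lra.
rewrite -mulrA; split.
  have -> : a1 * u1 - a2 * u2 - (b1 * w1 - b2 * w2) =
    a1 * u1 + - (a2 * u2) + (- (b1 * w1) + b2 * w2) by ring.
  by apply: s; rewrite ?normrN; exact: m.
have -> : a1 * u2 + a2 * u1 - (b1 * w2 + b2 * w1) =
  a1 * u2 + a2 * u1 + (- (b1 * w2) + - (b2 * w1)) by ring.
by apply: s; rewrite ?normrN; exact: m.
Qed.

(** A vanishing gradient would give n = 0, since [0^-1 = 0]; hence an inequality, which is enough to
    bound directional derivatives. *)
Lemma outward_unit_normal_le1 (A : set 'rV[R]_d) p n :
  outward_unit_normal A p n -> enorm n <= 1.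
Proof.
move=> [e [g [_ _ ->]]]; set c := gradient _ _.
rewrite enormZ normfV ger0_norm ?enorm_ge0//.
have [->|c0] := eqVneq (enorm c) 0; first by rewrite mulr0.
by rewrite mulVf.
Qed.

(* Nothing is known about the measurability of the integrand: the bounds by outer
   measures do not need it. *)
Lemma pairing_bound (G : set 'rV[R]_d) (f u : 'rV[R]_d -> R[i])
    (nu : 'rV[R]_d -> 'rV[R]_d) (K L a m : R) : 0 < a -> 0 <= K -> 0 <= L ->
  (surf_outer R d G <= m%:E)%E -> (forall x, G x -> enorm (nu x) <= 1) ->
  (forall x x' : 'rV[R]_d, G x -> enorm (x' - x) < a ->
    [/\ `|re (f x)| <= K, `|im (f x)| <= K,
       `|re (f x) - re (f x')| <= K * enorm (x - x') &
       `|im (f x) - im (f x')| <= K * enorm (x - x')]) ->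
  (forall x x' : 'rV[R]_d, G x -> enorm (x' - x) < a ->
    [/\ `|re (u x)| <= L, `|im (u x)| <= L,
       `|re (u x) - re (u x')| <= L * enorm (x - x') &
       `|im (u x) - im (u x')| <= L * enorm (x - x')]) ->
  normc (complex_integral (surf R d) G (fun x =>
    complex_derive (nu x) f x * u x - f x * complex_derive (nu x) u x))
  <= 8 * K * L * m.
Proof.
move=> a0 K0 L0 Gm nu1 Hf Hu.
have der (w : 'rV[R]_d -> R) (M : R) (x : 'rV[R]_d) : 0 <= M -> G x ->
    (forall x', enorm (x' - x) < a -> `|w x - w x'| <= M * enorm (x - x')) ->
    `|'D_(nu x) w x| <= M.
  by move=> M0 Gx; exact: (derive_le_enorm_lipschitz a0 M0 (nu1 x Gx)).
have KL0 : 0 <= 4 * K * L by rewrite !mulr_ge0.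
have bnd x : G x ->
    `|re (complex_derive (nu x) f x * u x - f x * complex_derive (nu x) u x)|
      <= 4 * K * L /\
    `|im (complex_derive (nu x) f x * u x - f x * complex_derive (nu x) u x)|
      <= 4 * K * L.
  move=> Gx; have xx : enorm (x - x) < a by rewrite subrr enorm0.
  have [f1 f2 _ _] := Hf x x Gx xx; have [u1 u2 _ _] := Hu x x Gx xx.
  apply: complex_product_bound => //; apply: der => // x'.
  - by move=> h; have [] := Hf x x' Gx h.
  - by move=> h; have [] := Hf x x' Gx h.
  - by move=> h; have [] := Hu x x' Gx h.
  - by move=> h; have [] := Hu x x' Gx h.
(* One half for each of the real and imaginary parts of the integral, whose integrands are at most 4
   K L. *)
have -> : 8 * K * L * m = 4 * K * L * m + 4 * K * L * m by ring.
apply: le_trans (normc_le_ReIm _) _; apply: lerD;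
  apply: (@abs_integral_le_outer _ _ (surf_outer R d)) => // x Gx;
  by have [] := bnd x Gx.
Qed.

End far_field.

(** * The decay estimate *)

Local Open Scope complex_scope.

Theorem theorem2p5 (R : realType) (d : nat) (k rho : R)
    (D Omega : set 'rV[R]_d) (q : 'rV[R]_d -> R[i])
    (nu : 'rV[R]_d -> 'rV[R]_d) (us : 'rV[R]_d -> 'rV[R]_d -> R[i])
    (hd : d = 2%N \/ d = 3%N) (hk : 0 < k) (hrho : 0 < rho)
    (D_open : open D) (D_bounded : bounded_set D)
    (D_simply_connected : simply_connected D)
    (D_lipschitz : lipschitz_boundary D)
    (D_exterior : connected (~` closure D))
    (q_Linfty : Linfty q)
    (q_Im_ge0 : \forall x \ae leb R d, 0 <= complex.Im (q x))
    (q_exterior : \forall x \ae leb R d, (~` closure D) x -> q x = 0)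
    (q_support : ess_support q = closure D)
    (Omega_open : open Omega) (Omega_connected : connected Omega)
    (Omega_bounded : bounded_set Omega) (Omega_C2 : C2_boundary Omega)
    (D_Omega : D `<=` Omega)
    (D_Gamma : 0 < dist_set (boundary Omega) D)
    (hnu : forall x, boundary Omega x -> outward_unit_normal Omega x (nu x))
    (hwp : well_posed k D q)
    (hus : forall y, boundary Omega y ->
       scattered_field k D q (fun x => Phi k x y) (us ^~ y)) :
  exists C r0 : R, [/\ 0 < C, 0 < r0 &
    forall z, ~ D z -> ~ boundary Omega z -> r0 <= dist z D ->
      (I_CD k rho (boundary Omega) nu us z
        <= (C * dist z D `^ ((1 - d%:R) * rho / 2))%:E)%E].
Proof.
have [D0|/set0P Dne] := eqVneq D set0.
  exists 1, 1; split => // z _ _.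
  by rewrite /dist D0 image_set0 inf0 lt_geF.
have d1 : (1 < d)%N by case: hd => ->.
have bG := bounded_boundary Omega_bounded.
have [m mG] : exists m : R, surf_outer R d (boundary Omega) = m%:E.
  have := boundary_lty Omega_C2 Omega_bounded d1.
  have := outer_measure_ge0 (surf_outer R d) (boundary Omega).
  by case: (surf_outer R d (boundary Omega)) => // m _ _; exists m.
have m0 : 0 <= m by rewrite -lee_fin -mG outer_measure_ge0.
have [B [a [B0 a0 HB]]] := scattered_field_bound hd hk D_open D_bounded bG D_Gamma
  q_Linfty q_exterior q_support hwp hus Dne.
have [C [r1 [C0 r10 HC]]] := @Phi_far R d k hd hk.
have [y0 Dy0] := Dne; have [M M0 hM] := bounded_enorm bG.
(* Any x' within a of Gamma satisfies |x' - y0| <= S, and |z - y0| >= t, so t >= 2 S gives |x' - z|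
   >= t - S >= t/2. Including [r1] ensures that the decay of Phi applies at distance t/2. *)
pose S := enorm y0 + M + a + r1.
have S0 : 0 < S by rewrite ltr_wpDl// !addr_ge0 ?enorm_ge0// ltW.
pose al : R := (1 - d%:R) / 2; pose E := 8 * (C * 2^-1 `^ al) * B * m.
have E0 : 0 <= E by rewrite !mulr_ge0 ?powR_ge0// ltW.
exists (E `^ rho * m + 1), (2 * S); split.
- by rewrite ltr_wpDl// mulr_ge0// powR_ge0.
- exact: mulr_gt0.
move=> z _ _ zS; set t := dist z D in zS *.
have t0 : 0 < t by apply: lt_le_trans zS; exact: mulr_gt0.
have ty0 : t <= enorm (z - y0).
  apply: ge_inf; last by exists y0.
  by exists 0 => _ [? _ <-]; exact: enorm_ge0.
have sS : S <= t / 2 by rewrite ler_pdivlMr// mulrC.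
have far x x' : boundary Omega x -> enorm (x' - x) < a -> t / 2 <= enorm (x' - z).
  move=> Gx xx'.
  have h1 := enorm_dist z y0 x'; have h2 := enorm_dist x' y0 x.
  have := enormD x (- y0); rewrite enormN => h3; have h4 := hM x Gx.
  by rewrite (enormB z x') in h1; rewrite /S in sS; lra.
have s_ge : r1 <= t / 2.
  apply: le_trans sS; rewrite /S lerDr !addr_ge0 ?enorm_ge0//; exact: ltW.
pose K := C * (t / 2) `^ al; have K0 : 0 <= K by rewrite mulr_ge0 ?powR_ge0// ltW.
have KE : 8 * K * B * m = E * t `^ al.
  by rewrite /K /E powRM ?invr_ge0// ?(ltW t0)//; ring.
(* The power rho turns t^al into the claimed rate, since al rho = (1 - d) rho/2. *)
have pw : (E * t `^ al) `^ rho = E `^ rho * t `^ ((1 - d%:R) * rho / 2).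
  by rewrite powRM ?powR_ge0// -powRrM /al mulrAC.
have inner y : boundary Omega y -> normc (complex_integral (surf R d) (boundary Omega)
    (fun x => complex_derive (nu x) (fun x' => conjc (Phi k x' z)) x * us x y
       - conjc (Phi k x z) * complex_derive (nu x) (us ^~ y) x)) <= E * t `^ al.
  move=> Gy; rewrite -KE; apply: (@pairing_bound _ _ _ _ _ _ _ _ a) => //.
  - exact: ltW.
  - by rewrite -mG.
  - by move=> x /hnu; exact: outward_unit_normal_le1.
  - move=> x x' Gx xx'; have xx : enorm (x - x) < a by rewrite subrr enorm0.
    have [p1 p2 p3 p4] := HC (t / 2) x x' z s_ge (far _ _ Gx xx) (far _ _ Gx xx').
    rewrite /=; case: (Phi k x z) (Phi k x' z) p1 p2 p3 p4 => [b1 b2] [c1 c2] /= *.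
    by split; rewrite ?normrN// -opprD normrN.
  - by move=> x x' Gx xx'; exact: HB.
(* The outer integral is again bounded by the supremum of the integrand times the surface measure m;
   the constant E^rho m + 1 is kept positive by the added 1. *)
rewrite /I_CD.
apply: le_trans (@integral_le_outer _ _ (surf_outer R d) _ _
  (E `^ rho * t `^ ((1 - d%:R) * rho / 2))%:E _ _) _.
- by rewrite lee_fin mulr_ge0 ?powR_ge0.
- move=> y Gy; rewrite !lee_fin powR_ge0 -pw; apply: ge0_ler_powR; rewrite ?nnegrE.
  + exact: ltW.
  + by case: complex_integral => *; exact: sqrtr_ge0.
  + by rewrite mulr_ge0 ?powR_ge0.
  + exact: inner.
rewrite mG lee_fin mulrAC ler_wpM2r ?powR_ge0// lerDl//.
Qed.
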